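(* Let $k$ be a field of characteristic $0$. For any simplicial (associative unital) $k$-algebra $A$, the map $$\mathrm{SR}(A)_*:\ \mathrm{HS}_*(A)\longrightarrow\mathrm{HR}_*(A,k)$$ from the symmetric homology of $A$ to its one-dimensional representation homology is an isomorphism of graded commutative $k$-algebras.
   Context: **Symmetric category.** $\Delta S$ has objects $[n]=\{0,1,\dots,n\}$, $n\ge 0$. A morphism $f:[n]\to[m]$ is an ordered tuple $f=X_0\otimes X_1\otimes\cdots\otimes X_m$ of noncommutative (possibly empty) monomials in formal variables $x_0,\dots,x_n$ such that each variable occurs exactly once in total (equivalently: a map of sets with a total order on each fibre). Composition is substitution: if $g=Y_0\otimes\cdots\otimes Y_l:[m]\to[l]$ in variables $y_0,\dots,y_m$, then $g\circ f$ is obtained by substituting $y_i=X_i$. **Symmetric bar construction and symmetric homology.** For an associative unital $k$-algebra $A$, $B_{\rm sym}A:\Delta S\to \mathrm{Mod}_k$ is the functor $[n]\mapsto A^{\otimes(n+1)}$, where $f=X_0\otimes\cdots\otimes X_m$ sends $a_0\otimes\cdots\otimes a_n$ to the tensor obtained by substituting $x_i=a_i$ (empty monomial $=1_A$). Then $\mathrm{HS}_*(A):=\mathrm{Tor}^{\Delta S}_*(k,B_{\rm sym}A)=H_*(k\otimes^{\boldsymbol L}_{\Delta S}B_{\rm sym}A)$, where $k$ is the constant contravariant functor and $\otimes_{\Delta S}$ is the functor tensor product. For a simplicial algebra $A$, apply $B_{\rm sym}$ degreewise, regard the resulting simplicial $\Delta S$-module as a chain complex of $\Delta S$-modules via Dold–Kan,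 and use hyper-Tor. **Algebra structure on $\mathrm{HS}_*$ (Ault).** Let $\Delta S_+$ be $\Delta S$ with an initial object $[-1]$ adjoined; it is permutative under $[m]\sqcup[n]=[m+n+1]$ (concatenation of tuples), with unit $[-1]$. Extend $B_{\rm sym}A$ to $B_{\rm sym,+}A$ on $\Delta S_+$ by $[-1]\mapsto k$. Put $CA=k[N(-\downarrow\Delta S_+)]\otimes_{\Delta S_+}B_{\rm sym,+}A$, where $N(-\downarrow \Delta S_+)$ is the nerve of the under-category; so $(CA)_p=\bigoplus_{[n_0]\to\cdots\to[n_p]}B_{\rm sym,+}A([n_0])$. One has $\pi_*(CA)\cong\mathrm{HS}_*(A)$, and the product on $\mathrm{HS}_*(A)$ is induced by the simplicial product on $CA$ given by $\sqcup$ of chains and tensor product of coefficients (it is part of an $E_\infty$-structure on $CA$). For a simplicial algebra $A$, apply $C$ degreewise and use the diagonal of the resulting bisimplicial module with its degreewise product. **Representation homology.** The inclusion of simplicial commutative $k$-algebras into simplicial associative $k$-algebras has left adjoint $R\mapsto R_{\rm ab}=R/(\text{two-sided ideal generated by commutators})$, taken degreewise. Then $\mathrm{HR}_*(A,k):=\pi_*(R_{\rm ab})$, where $R\to A$ is a semi-free simplicial resolution: a weak equivalence of simplicial algebras with each $R_m$ a free (tensor) algebra and the degeneracies preserving generators. It is a graded commutative algebra independent of the choice of $R$. **The map $\mathrm{SR}(A)_*$.** For any algebra $B$ there is a natural isomorphism $k\otimes_{\Delta S}B_{\rm sym}B\cong B_{\rm ab}$, induced by $b_0\otimes\cdots\otimes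 b_n\mapsto b_0\cdots b_n$. For a semi-free simplicial resolution $R\to A$ (so that $B_{\rm sym}R\to B_{\rm sym}A$ is a weak equivalence), $\mathrm{SR}(A)_*$ is the map induced on homology by the canonical map $k\otimes^{\boldsymbol L}_{\Delta S}C(B_{\rm sym}R)\to k\otimes_{\Delta S}C(B_{\rm sym}R)\cong C(R_{\rm ab})$, where $C(-)$ here denotes the associated chain complex. *)

(* Defs.v *)
From HB Require Import structures.
From mathcomp Require Import all_boot all_algebra.
From mathcomp Require Import finmap.
From mathcomp Require Import boolp classical_sets functions.
From mathcomp Require Import ring_quotient.
From mathcomp.multinomials Require Import monalg.

Set Implicit Arguments.
Unset Strict Implicit.
Unset Printing Implicit Defensive.

Import GRing.Theory.
Import Quotient.

Local Open Scope ring_scope.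
Local Open Scope quotient_scope.

Definition freemod (k : fieldType) (T : Type) : lmodType k :=
  {malg k[{classic T}]}.

Definition fgen (k : fieldType) (T : Type) (t : T) : freemod k T :=
  (<< 1 *g (t : {classic T}) >>)%R.

Section FreeLift.
Context (k : fieldType) (T : Type) (V : lmodType k) (f : T -> V).

Definition flift (x : freemod k T) : V :=
  \sum_(t <- msupp x) (mcoeff t x) *: f t.

Lemma flift_fset (D : {fset {classic T}}) (x : freemod k T) :
  (msupp x `<=` D)%fset -> flift x = \sum_(t <- D) (mcoeff t x) *: f t.
Proof.
move=> sD; rewrite /flift; apply: big_fset_incl => // t _ tx.
by rewrite mcoeff_outdom // scale0r.
Qed.

Fact flift_linear : linear flift.
Proof.
move=> c x y.
pose D := (msupp x `|` msupp y `|` msupp (c *: x + y))%fset.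
rewrite (@flift_fset D x) ?(@flift_fset D y) ?(@flift_fset D (c *: x + y)).
- rewrite scaler_sumr -big_split /=; apply: eq_bigr => t _.
  by rewrite mcoeffD mcoeffZ scalerDl scalerA.
- exact: fsubsetUr.
- by rewrite /D -fsetUA fsetUCA fsubsetUl.
- by rewrite /D -fsetUA fsubsetUl.
Qed.

HB.instance Definition _ :=
  GRing.isLinear.Build k (freemod k T) V _ flift flift_linear.

Lemma flift_gen t : flift (fgen k t) = f t.
Proof.
rewrite /flift /fgen msuppU oner_eq0 big_seq_fset1 mcoeffUU scale1r //.
Qed.

End FreeLift.

Lemma fgenE (k : fieldType) (T : Type) (x : freemod k T) :
  x = flift (fgen k (T := T)) x.
Proof.
rewrite {1}(monalgE x) /flift; apply: eq_bigr => t _.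
apply/malgP => u; rewrite mcoeffZ /fgen !mcoeffU.
by case: eqP; rewrite ?mulr1 ?mulr0.
Qed.

Lemma free_ext (k : fieldType) (T : Type) (V : lmodType k)
    (f g : {linear freemod k T -> V}) :
  (forall t, f (fgen k t) = g (fgen k t)) -> f =1 g.
Proof.
move=> fg x; rewrite (fgenE x) /flift !linear_sum; apply: eq_bigr => t _.
by rewrite !linearZ fg.
Qed.

Section Quotients.
Context (k : fieldType) (V : lmodType k).

Inductive span (S : V -> Prop) : V -> Prop :=
| span0 : span S 0
| span_lin c x y : S x -> span S y -> span S (c *: x + y).

Lemma span_in (S : V -> Prop) x : S x -> span S x.
Proof. by move=> Sx; rewrite -[x]addr0 -[x]scale1r; apply: span_lin => //; exact: span0. Qed.

Lemma spanD (S : V -> Prop) x y : span S x -> span S y -> span S (x + y).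
Proof.
move=> Sx Sy; elim: Sx => [|c u v Su _ IH]; first by rewrite add0r.
by rewrite -addrA; apply: span_lin.
Qed.

Lemma spanZ (S : V -> Prop) c x : span S x -> span S (c *: x).
Proof.
elim=> [|d u v Su _ IH]; first by rewrite scaler0; exact: span0.
by rewrite scalerDr scalerA; apply: span_lin.
Qed.

Lemma span_ker (W : lmodType k) (f : {linear V -> W}) (S : V -> Prop) :
  (forall x, S x -> f x = 0) -> forall x, span S x -> f x = 0.
Proof.
move=> fS x; elim=> [|c u v Su _ IH]; first exact: linear0.
by rewrite linearD linearZ /= fS // IH scaler0 addr0.
Qed.

Definition spanb (S : V -> Prop) : {pred V} := fun x => `[< span S x >].

Fact spanb_zmod (S : V -> Prop) : zmod_closed (spanb S).
Proof.
split=> [|x y /asboolP Sx /asboolP Sy]; apply/asboolP; first exact: span0.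
by apply: spanD => //; rewrite -scaleN1r; apply: spanZ.
Qed.

HB.instance Definition _ (S : V -> Prop) :=
  GRing.isZmodClosed.Build V (spanb S) (spanb_zmod S).

Definition quomod (S : V -> Prop) : Type := @quot V (spanb S).

HB.instance Definition _ (S : V -> Prop) := GRing.Zmodule.on (quomod S).

Section Structure.
Variable S : V -> Prop.

Definition qpi (x : V) : quomod S := \pi_(@quot V (spanb S)) x.

Definition qrepr (q : quomod S) : V := repr (q : @quot V (spanb S)).

Lemma qreprK q : qpi (qrepr q) = q.
Proof. exact: reprK. Qed.

Lemma qpi_eq x y : qpi x = qpi y <-> span S (x - y).
Proof.
split=> [/eqmodP/=|H]; first by rewrite /Quotient.equiv => /asboolP.
by apply/eqmodP; rewrite /= /Quotient.equiv; apply/asboolP.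
Qed.

Lemma qpiD x y : qpi (x + y) = qpi x + qpi y.
Proof. exact: raddfD. Qed.

Definition qscale c (q : quomod S) : quomod S := qpi (c *: qrepr q).

Lemma qscaleE c x : qscale c (qpi x) = qpi (c *: x).
Proof.
by apply/qpi_eq; rewrite -scalerBr; apply: spanZ; apply/qpi_eq; rewrite qreprK.
Qed.

Fact qscaleA a b q : qscale a (qscale b q) = qscale (a * b) q.
Proof. by rewrite -[q]qreprK !qscaleE scalerA. Qed.
Fact qscale1 : left_id 1 qscale.
Proof. by move=> q; rewrite -[q]qreprK !qscaleE scale1r. Qed.
Fact qscaleDr : right_distributive qscale +%R.
Proof.
by move=> c p q; rewrite -[q]qreprK -[p]qreprK -qpiD !qscaleE scalerDr qpiD.
Qed.
Fact qscaleDl q : {morph qscale^~ q : a b / a + b}.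
Proof. by move=> a b /=; rewrite -[q]qreprK !qscaleE scalerDl qpiD. Qed.

HB.instance Definition _ :=
  GRing.Zmodule_isLmodule.Build k (quomod S) qscaleA qscale1 qscaleDr qscaleDl.

Fact qpi_linear : linear qpi.
Proof. by move=> c x y; rewrite qpiD -qscaleE. Qed.

HB.instance Definition _ := GRing.isLinear.Build k V (quomod S) _ qpi qpi_linear.

Definition qlift (W : lmodType k) (f : {linear V -> W})
  (fS : forall x, S x -> f x = 0) (q : quomod S) : W := f (qrepr q).

Section Lift.
Context (W : lmodType k) (f : {linear V -> W}).
Hypothesis fS : forall x, S x -> f x = 0.

Lemma qlift_pi x : qlift fS (qpi x) = f x.
Proof.
apply/eqP; rewrite -subr_eq0 -linearB; apply/eqP.
by apply: (span_ker fS); apply/qpi_eq; rewrite qreprK.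
Qed.

Fact qlift_linear : linear (qlift fS).
Proof.
move=> c p q; rewrite -[p]qreprK -[q]qreprK -linearP !qlift_pi.
exact: linearP.
Qed.

HB.instance Definition _ :=
  GRing.isLinear.Build k (quomod S) W _ (qlift fS) qlift_linear.

End Lift.

End Structure.
End Quotients.

Lemma quo_ext (k : fieldType) (V W : lmodType k) (S : V -> Prop)
    (f g : {linear quomod S -> W}) :
  (forall x, f (qpi S x) = g (qpi S x)) -> f =1 g.
Proof. by move=> fg q; rewrite -[q]qreprK. Qed.

Section Presentations.
Context (k : fieldType) (T : Type) (R : freemod k T -> Prop).

(* Generators T, relations r = 0 for R r. *)
Definition pres : lmodType k := quomod R.

Definition pgen (t : T) : pres := qpi R (fgen k t).

Definition respects (W : lmodType k) (f : T -> W) :=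
  forall r, R r -> flift f r = 0.

Definition plift (W : lmodType k) (f : T -> W) (fR : respects f) :
  pres -> W := qlift (f := flift f) fR.

HB.instance Definition _ (W : lmodType k) (f : T -> W) (fR : respects f) :=
  GRing.Linear.copy (plift fR) (qlift (f := flift f) fR).

Lemma plift_gen (W : lmodType k) (f : T -> W) (fR : respects f) t :
  plift fR (pgen t) = f t.
Proof. by rewrite /plift qlift_pi /= flift_gen. Qed.

Lemma plift_pi (W : lmodType k) (f : T -> W) (fR : respects f) x :
  plift fR (qpi R x) = flift f x.
Proof. by rewrite /plift qlift_pi. Qed.

Lemma pres_ext (W : lmodType k) (f g : {linear pres -> W}) :
  (forall t, f (pgen t) = g (pgen t)) -> f =1 g.
Proof.
move=> fg; apply: quo_ext => x.
exact: (@free_ext k T W (f \o qpi R) (g \o qpi R)).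
Qed.

Lemma pgen_rel r : R r -> flift pgen r = 0.
Proof.
move=> Rr; have <- : qpi R r = 0.
  by rewrite -(linear0 (qpi R)); apply/qpi_eq; rewrite subr0; apply: span_in.
by rewrite {2}(fgenE r) /flift linear_sum; apply: eq_bigr => t _; rewrite linearZ.
Qed.

End Presentations.

Lemma flift_fct (k : fieldType) (T U : Type) (W : lmodType k)
    (f : T -> U -> W) x u :
  flift f x u = flift (f^~ u) x.
Proof. by rewrite /flift fct_sumE; apply: eq_bigr. Qed.

Lemma flift_add (k : fieldType) (T : Type) (W : lmodType k) c
    (f g : T -> W) x :
  flift (fun t => c *: f t + g t) x = c *: flift f x + flift g x.
Proof.
rewrite /flift scaler_sumr -big_split /=; apply: eq_bigr => t _.
by rewrite scalerDr !scalerA mulrC.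
Qed.

Section Bilinear.
Context (k : fieldType) (T U : Type) (W : lmodType k) (f : T -> U -> W).

Definition flift2 (x : freemod k T) (y : freemod k U) : W :=
  flift (fun t => flift (f t) y) x.

Lemma flift2_linl y : linear (flift2^~ y).
Proof. by move=> c x x'; rewrite /flift2 linearP. Qed.

Lemma flift2_linr x : linear (flift2 x).
Proof.
move=> c y y'; rewrite /flift2 -flift_add; congr (flift _ x).
by apply: funext => t; rewrite linearP.
Qed.

Lemma flift2_gen t u : flift2 (fgen k t) (fgen k u) = f t u.
Proof. by rewrite /flift2 !flift_gen. Qed.

Lemma flift2C x y : flift2 x y = flift (fun u => flift (f^~ u) x) y.
Proof.
rewrite /flift2 /flift; under eq_bigr do rewrite scaler_sumr.
rewrite exchange_big; apply: eq_bigr => u _; rewrite scaler_sumr.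
by apply: eq_bigr => t _; rewrite !scalerA mulrC.
Qed.

Context (R : freemod k T -> Prop) (S : freemod k U -> Prop).
Hypothesis fR : forall u, respects R (f^~ u).
Hypothesis fS : forall t, respects S (f t).

Fact plift2_respects : respects R (fun t => plift (fS t) : pres S -> W).
Proof.
move=> r Rr; apply: funext => q; rewrite flift_fct -[q]qreprK.
under eq_fun do rewrite plift_pi.
rewrite -[LHS]/(flift2 r _) flift2C /flift; apply: big1 => u _.
by rewrite -/(flift _ _) fR // scaler0.
Qed.

Definition plift2 (p : pres R) (q : pres S) : W := plift plift2_respects p q.

Lemma plift2_pi x y : plift2 (qpi R x) (qpi S y) = flift2 x y.
Proof.
rewrite /plift2 plift_pi flift_fct /flift2; congr (flift _ x).
by apply: funext => t; rewrite plift_pi.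
Qed.

Lemma plift2_linl q : linear (plift2^~ q).
Proof. by move=> c p p'; rewrite /plift2 linearP. Qed.

Lemma plift2_linr p : linear (plift2 p).
Proof.
move=> c q q'; rewrite -[p]qreprK -[q]qreprK -[q']qreprK -linearP.
by rewrite !plift2_pi flift2_linr.
Qed.

Lemma plift2_gen t u : plift2 (pgen R t) (pgen S u) = f t u.
Proof. by rewrite /plift2 !plift_gen. Qed.

End Bilinear.

Record category := Category {
  obj :> Type;
  hom : obj -> obj -> Type;
  idm : forall a, hom a a;
  cmp : forall a b c, hom b c -> hom a b -> hom a c;
  cmp1m : forall a b (f : hom a b), cmp (idm b) f = f;
  cmpm1 : forall a b (f : hom a b), cmp f (idm a) = f;
  cmpA : forall a b c d (h : hom c d) (g : hom b c) (f : hom a b),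
    cmp h (cmp g f) = cmp (cmp h g) f }.

Arguments hom {_}.
Arguments idm {_}.
Arguments cmp {_ _ _ _}.

Definition opcat (C : category) : category :=
  @Category C (fun a b => hom b a) idm (fun a b c g f => cmp f g)
    (fun a b f => cmpm1 f) (fun a b f => cmp1m f)
    (fun a b c d h g f => esym (cmpA f g h)).

Section Prodcat.
Variables C D : category.
Let homp (a b : C * D) : Type := (hom a.1 b.1 * hom a.2 b.2)%type.
Let idp (a : C * D) : homp a a := (idm a.1, idm a.2).
Let cmpp (a b c : C * D) (g : homp b c) (f : homp a b) : homp a c :=
  (cmp g.1 f.1, cmp g.2 f.2).

Fact prodcat_cmp1m a b (f : homp a b) : cmpp (idp b) f = f.
Proof. by case: f => f1 f2; rewrite /cmpp /= !cmp1m. Qed.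
Fact prodcat_cmpm1 a b (f : homp a b) : cmpp f (idp a) = f.
Proof. by case: f => f1 f2; rewrite /cmpp /= !cmpm1. Qed.
Fact prodcat_cmpA a b c d (h : homp c d) (g : homp b c) (f : homp a b) :
  cmpp h (cmpp g f) = cmpp (cmpp h g) f.
Proof. by rewrite /cmpp /= !cmpA. Qed.

Definition prodcat : category :=
  Category prodcat_cmp1m prodcat_cmpm1 prodcat_cmpA.
End Prodcat.

Definition fullsub (C : category) (T : Type) (i : T -> C) : category :=
  @Category T (fun a b => hom (i a) (i b)) (fun a => idm (i a))
    (fun a b c g f => cmp g f) (fun a b f => cmp1m f) (fun a b f => cmpm1 f)
    (fun a b c d h g f => cmpA h g f).

Record cmod (k : fieldType) (C : category) := CMod {
  cob :> C -> lmodType k;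
  cmap : forall a b, hom a b -> {linear cob a -> cob b};
  cmap_id : forall a x, cmap (idm a) x = x;
  cmap_cmp : forall a b c (g : hom b c) (f : hom a b) x,
    cmap (cmp g f) x = cmap g (cmap f x) }.

Arguments cmap {k C} M {a b} : rename.

Record ctrans (k : fieldType) (C : category) (M N : cmod k C) := CTrans {
  ctr :> forall a, {linear M a -> N a};
  ctr_nat : forall a b (f : hom a b) x, ctr b (cmap M f x) = cmap N f (ctr a x) }.

Section RestrictModule.
Context (k : fieldType) (C D : category) (T : Type) (i : T -> C).
Variable M : cmod k (prodcat C D).

Definition crestr : cmod k (prodcat (fullsub i) D) :=
  @CMod k (prodcat (fullsub i) D) (fun a => M (i a.1, a.2))
    (fun a b f => @cmap k _ M (i a.1, a.2) (i b.1, b.2) f)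
    (fun a x => cmap_id x) (fun a b c g f x => 
       @cmap_cmp k _ M (i a.1, a.2) (i b.1, b.2) (i c.1, c.2) g f x).
End RestrictModule.

Section ConstModule.
Context (k : fieldType) (C : category).

Definition cconst : cmod k C :=
  @CMod k C (fun=> k^o) (fun a b f => idfun) (fun a x => erefl)
    (fun a b c g f x => erefl).
End ConstModule.

(* Associative unital algebras.  Unlike in algType, 1 = 0 is allowed. *)
Record algebra (k : fieldType) := Algebra {
  alg_mod : lmodType k;
  alg_mul : alg_mod -> alg_mod -> alg_mod;
  alg_one : alg_mod;
  alg_mulA : associative alg_mul;
  alg_mul1 : left_id alg_one alg_mul;
  alg_mulr1 : right_id alg_one alg_mul;
  alg_mulDl : left_distributive alg_mul +%R;
  alg_mulDr : right_distributive alg_mul +%R;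
  alg_mulZl : forall c x y, alg_mul (c *: x) y = c *: alg_mul x y;
  alg_mulZr : forall c x y, alg_mul x (c *: y) = c *: alg_mul x y }.

Definition alg_car (k : fieldType) (A : algebra k) : Type := alg_mod A.
Coercion alg_car : algebra >-> Sortclass.

HB.instance Definition _ (k : fieldType) (A : algebra k) :=
  GRing.Lmodule.copy (alg_car A) (alg_mod A).
HB.instance Definition _ (k : fieldType) (A : algebra k) :=
  GRing.Zmodule_isPzRing.Build (alg_car A) (@alg_mulA k A) (@alg_mul1 k A)
    (@alg_mulr1 k A) (@alg_mulDl k A) (@alg_mulDr k A).

Lemma alg_scaleAl (k : fieldType) (A : algebra k) c (x y : A) :
  (c *: x) * y = c *: (x * y).
Proof. exact: alg_mulZl. Qed.

Lemma alg_scaleAr (k : fieldType) (A : algebra k) c (x y : A) :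
  x * (c *: y) = c *: (x * y).
Proof. exact: alg_mulZr. Qed.

Record algHom (k : fieldType) (A B : algebra k) := AlgHom {
  ahom :> {linear A -> B};
  ahom1 : ahom 1 = 1;
  ahomM : {morph ahom : x y / x * y} }.

Record calg (k : fieldType) (C : category) := CAlg {
  aob :> C -> algebra k;
  amap : forall a b, hom a b -> algHom (aob a) (aob b);
  amap_id : forall a x, amap (idm a) x = x;
  amap_cmp : forall a b c (g : hom b c) (f : hom a b) x,
    amap (cmp g f) x = amap g (amap f x) }.

Arguments amap {k C} A {a b} : rename.

Record atrans (k : fieldType) (C : category) (A B : calg k C) := ATrans {
  atr :> forall a, algHom (A a) (B a);
  atr_nat : forall a b (f : hom a b) x, atr b (amap A f x) = amap B f (atr a x) }.

Definition calg_mod (k : fieldType) (C : category) (A : calg k C) : cmod k C :=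
  @CMod k C (fun a => A a) (fun a b f => amap A f) (@amap_id k C A)
    (@amap_cmp k C A).

Definition atrans_mod (k : fieldType) (C : category) (A B : calg k C)
    (f : atrans A B) : ctrans (calg_mod A) (calg_mod B) :=
  @CTrans k C (calg_mod A) (calg_mod B) (fun a => f a) (@atr_nat _ _ _ _ f).

Definition dhom (m n : nat) : Type :=
  {f : 'I_m.+1 -> 'I_n.+1 | {homo f : i j / (i <= j)%N}}.

Definition dmk (m n : nat) (f : 'I_m.+1 -> 'I_n.+1)
    (hf : {homo f : i j / (i <= j)%N}) : dhom m n :=
  exist _ f hf.

Lemma dhom_eq (m n : nat) (f g : dhom m n) : sval f =1 sval g -> f = g.
Proof.
case: f g => [f hf] [g hg] /= /funext fg; rewrite fg in hf *.
by congr exist.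
Qed.

Definition did n : dhom n n := dmk (f := id) (fun i j h => h).
Definition dcmp a b c (g : dhom b c) (f : dhom a b) : dhom a c :=
  dmk (f := sval g \o sval f) (fun i j h => svalP g _ _ (svalP f _ _ h)).

Fact dcmp1m a b (f : dhom a b) : dcmp (did b) f = f.
Proof. exact: dhom_eq. Qed.
Fact dcmpm1 a b (f : dhom a b) : dcmp f (did a) = f.
Proof. exact: dhom_eq. Qed.
Fact dcmpA a b c d (h : dhom c d) (g : dhom b c) (f : dhom a b) :
  dcmp h (dcmp g f) = dcmp (dcmp h g) f.
Proof. exact: dhom_eq. Qed.

Definition Delta : category := Category dcmp1m dcmpm1 dcmpA.

Fact coface_homo n (i : 'I_n.+2) : {homo @lift n.+2 i : a b / (a <= b)%N}.
Proof. by move=> a b; rewrite /= leq_bump2. Qed.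
Definition coface n (i : 'I_n.+2) : dhom n n.+1 := dmk (@coface_homo n i).

Fact codegen_subproof n (j : 'I_n.+1) (a : 'I_n.+2) : (unbump j a < n.+1)%N.
Proof.
rewrite /unbump; case: (ltnP j a) => h; last by rewrite subn0 (leq_ltn_trans h).
by rewrite subn1 -ltnS prednK ?(leq_ltn_trans _ h).
Qed.
Fact codegen_homo n (j : 'I_n.+1) :
  {homo (fun a => Ordinal (codegen_subproof j a)) : a b / (a <= b)%N}.
Proof.
move=> a b /= ab; rewrite /unbump; case: (ltnP j a) => h.
  by rewrite (leq_trans h ab) leq_sub2r.
rewrite subn0; case: ltnP => jb; last by rewrite subn0.
by rewrite subn1 -ltnS prednK ?(leq_ltn_trans _ jb) // (leq_ltn_trans h).
Qed.
Definition codegen n (j : 'I_n.+1) : dhom n.+1 n := dmk (@codegen_homo n j).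

Notation smod k := (cmod k (opcat Delta)).
Notation salg k := (calg k (opcat Delta)).

(* A morphism m -> n of DeltaSp is a tuple X_0, ..., X_(n-1) of words in the
   variables 'I_m in which every variable occurs exactly once in total.  The
   object n of DeltaSp stands for [n-1], so that 0 is the initial object. *)
Definition shom (m n : nat) : Type :=
  {f : n.-tuple (seq 'I_m) | [forall i, count_mem i (flatten f) == 1%N]}.

Definition sword (m n : nat) (f : shom m n) (j : 'I_n) : seq 'I_m :=
  tnth (sval f) j.

Lemma shom_eq (m n : nat) (f g : shom m n) : sword f =1 sword g -> f = g.
Proof. by move=> fg; apply/val_inj/eq_from_tnth. Qed.

Lemma shom_count (m n : nat) (F : 'I_n -> seq 'I_m) i :
  count_mem i (flatten [tuple F j | j < n]) = (\sum_j count_mem i (F j))%N.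
Proof.
by rewrite count_flatten sumnE -map_comp big_map big_enum.
Qed.

Lemma sword_count (m n : nat) (f : shom m n) i :
  (\sum_j count_mem i (sword f j))%N = 1%N.
Proof.
have /forallP/(_ i)/eqP <- := svalP f.
rewrite -shom_count; congr (count_mem i (flatten _)).
by congr val; apply: eq_from_tnth => j; rewrite tnth_mktuple.
Qed.

Definition smk (m n : nat) (F : 'I_n -> seq 'I_m)
    (hF : forall i, (\sum_j count_mem i (F j))%N = 1%N) : shom m n :=
  exist _ [tuple F j | j < n]
    (introT forallP (fun i => introT eqP (etrans (shom_count F i) (hF i)))).

Lemma sword_mk m n F hF j : sword (@smk m n F hF) j = F j.
Proof. exact: tnth_mktuple. Qed.

Fact sid_subproof n i : (\sum_(j < n) count_mem i [:: j])%N = 1%N.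
Proof.
rewrite (bigD1 i) //= eqxx big1 // => j ji.
by rewrite (negPf ji).
Qed.
Definition sid n : shom n n := smk (@sid_subproof n).

Definition ssubst a b (f : shom a b) (w : seq 'I_b) : seq 'I_a :=
  flatten [seq sword f i | i <- w].

Lemma count_ssubst a b (f : shom a b) w i :
  count_mem i (ssubst f w) = (\sum_(j <- w) count_mem i (sword f j))%N.
Proof. by rewrite count_flatten sumnE -map_comp big_map. Qed.

Lemma sum_count b n (w : 'I_n -> seq 'I_b) (F : 'I_b -> nat) :
  (\sum_j \sum_(i <- w j) F i = \sum_i (\sum_j count_mem i (w j)) * F i)%N.
Proof.
under [RHS]eq_bigr do rewrite big_distrl /=.
rewrite exchange_big; apply: eq_bigr => j _.
elim: (w j) => [|x s IH]; first by rewrite big_nil big1.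
rewrite big_cons IH (bigD1 x) //= [in RHS](bigD1 x) //= eqxx mulnDl mul1n addnA.
by congr (_ + _)%N; apply: eq_bigr => i /negPf; rewrite eq_sym => ->.
Qed.

Fact scmp_subproof a b c (g : shom b c) (f : shom a b) i :
  (\sum_(j < c) count_mem i (ssubst f (sword g j)))%N = 1%N.
Proof.
under eq_bigr do rewrite count_ssubst.
rewrite sum_count -[RHS](sword_count f i); apply: eq_bigr => l _.
by rewrite sword_count mul1n.
Qed.
Definition scmp a b c (g : shom b c) (f : shom a b) : shom a c :=
  smk (scmp_subproof g f).

Lemma ssubst_cat a b (f : shom a b) u v :
  ssubst f (u ++ v) = ssubst f u ++ ssubst f v.
Proof. by rewrite /ssubst map_cat flatten_cat. Qed.

Lemma ssubst_cmp a b c (g : shom b c) (f : shom a b) w :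
  ssubst (scmp g f) w = ssubst f (ssubst g w).
Proof.
elim: w => // x w IH; rewrite -[x :: w]/([:: x] ++ w) !ssubst_cat IH.
by rewrite /ssubst /= !cats0 sword_mk.
Qed.

Lemma ssubst_id n w : ssubst (sid n) w = w.
Proof.
elim: w => // x w IH; rewrite -[x :: w]/([:: x] ++ w) ssubst_cat IH.
by rewrite /ssubst /= sword_mk.
Qed.

Fact scmp1m a b (f : shom a b) : scmp (sid b) f = f.
Proof.
by apply: shom_eq => j; rewrite !sword_mk /ssubst /= cats0.
Qed.
Fact scmpm1 a b (f : shom a b) : scmp f (sid a) = f.
Proof. by apply: shom_eq => j; rewrite sword_mk ssubst_id. Qed.
Fact scmpA a b c d (h : shom c d) (g : shom b c) (f : shom a b) :
  scmp h (scmp g f) = scmp (scmp h g) f.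
Proof.
by apply: shom_eq => j; rewrite !sword_mk -ssubst_cmp.
Qed.

Definition DeltaSp : category := Category scmp1m scmpm1 scmpA.

(* Here the object n stands for [n]. *)
Definition DeltaS : category := @fullsub DeltaSp nat S.

Definition upd (I : eqType) (T : Type) (a : I -> T) (i : I) (x : T) : I -> T :=
  fun j => if j == i then x else a j.

Section TensorPower.
Context (k : fieldType) (V : lmodType k) (n : nat).

Inductive tpow_rel : freemod k ('I_n -> V) -> Prop :=
| TpowRel (a : 'I_n -> V) i c x y :
    tpow_rel (fgen k (upd a i (c *: x + y))
              - (c *: fgen k (upd a i x) + fgen k (upd a i y))).

Definition tpow : lmodType k := pres tpow_rel.

Definition tensor (a : 'I_n -> V) : tpow := pgen tpow_rel a.

Definition multilinear (W : lmodType k) (f : ('I_n -> V) -> W) :=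
  forall (a : 'I_n -> V) i c x y,
    f (upd a i (c *: x + y)) =
      c *: f (upd a i x) + f (upd a i y).

Lemma multilinear_respects (W : lmodType k) (f : ('I_n -> V) -> W) :
  multilinear f -> respects tpow_rel f.
Proof.
by move=> fl _ [a i c x y]; rewrite linearB linearP /= !flift_gen fl subrr.
Qed.

Lemma tensor_multilinear : multilinear tensor.
Proof.
move=> a i c x y; have := pgen_rel (TpowRel a i c x y).
rewrite linearB linearP /= !flift_gen => /eqP.
by rewrite subr_eq0 => /eqP.
Qed.

End TensorPower.

Lemma prod_update (k : fieldType) (I : eqType) (A : algebra k) (w : seq I)
    (g : I -> A) (i : I) :
  count_mem i w = 1%N ->
  {uv : A * A | forall z : A, \prod_(j <- w) upd g i z j = uv.1 * z * uv.2}.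
Proof.
move=> ci; rewrite /upd; exists (\prod_(j <- take (index i w) w) g j,
                   \prod_(j <- drop (index i w).+1 w) g j) => z /=.
have iw : i \in w by rewrite -has_pred1 has_count ci.
rewrite -{1}(cat_take_drop (index i w) w) (drop_nth i) ?index_mem // nth_index //.
rewrite big_cat big_cons /= eqxx mulrA.
have := ci; rewrite -{1}(cat_take_drop (index i w) w) (drop_nth i) ?index_mem //.
rewrite nth_index // count_cat /= eqxx add1n addnS => -[/eqP].
rewrite addn_eq0 => /andP[/eqP c1 /eqP c2].
have aux s : count_mem i s = 0%N ->
    \prod_(j <- s) (if j == i then z else g j) = \prod_(j <- s) g j.
  move=> /eqP; rewrite -leqn0 leqNgt -has_count => /hasPn/= si.
  by apply: eq_big_seq => j js; rewrite (negPf (si j js)).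
by rewrite !aux.
Qed.

Lemma prod_update_notin (k : fieldType) (I : eqType) (A : algebra k)
    (w : seq I) (g : I -> A) (i : I) z :
  count_mem i w = 0%N ->
  \prod_(j <- w) upd g i z j = \prod_(j <- w) g j.
Proof.
move=> /eqP; rewrite -leqn0 leqNgt -has_count => /hasPn/= si.
by apply: eq_big_seq => j js; rewrite /upd (negPf (si j js)).
Qed.

Section SymmetricBar.
Context (k : fieldType) (D : category) (A : calg k D).

Section Map.
Context (a b : prodcat DeltaSp D) (f : hom a b).

(* The first factor acts by substitution in the words of f.1, the second through A. *)
Definition bsym_gen (x : 'I_a.1 -> A a.2) : tpow (A b.2) b.1 :=
  tensor (fun j => \prod_(i <- sword f.1 j) amap A f.2 (x i)).

Fact bsym_multilinear : multilinear bsym_gen.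
Proof.
move=> x i c y z.
have [j0 cj0 cj] : exists2 j0, count_mem i (sword f.1 j0) = 1%N &
    forall j, j != j0 -> count_mem i (sword f.1 j) = 0%N.
  have /eqP/sum_nat_eq1[j0 [_ c1 c0]] := sword_count f.1 i.
  by exists j0 => // j jj0; apply: c0.
pose g j := amap A f.2 (x j).
have [[u v] /= uv] := @prod_update k _ _ (sword f.1 j0) g i cj0.
have E t : bsym_gen (upd x i t) =
  tensor (upd (fun j => \prod_(i <- sword f.1 j) g i) j0
            (u * amap A f.2 t * v)).
  congr tensor; apply: funext => j.
  transitivity (\prod_(l <- sword f.1 j) upd g i (amap A f.2 t) l).
    by apply: eq_bigr => l _; rewrite /g /upd; case: (l == i).
  rewrite [RHS]/upd; case: eqVneq => [->|jj0]; first exact: uv.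
  exact: prod_update_notin (cj _ jj0).
rewrite !E linearP mulrDr mulrDl alg_scaleAr alg_scaleAl.
exact: tensor_multilinear.
Qed.

Definition bsym_map : tpow (A a.2) a.1 -> tpow (A b.2) b.1 :=
  plift (multilinear_respects bsym_multilinear).
HB.instance Definition _ := GRing.Linear.on bsym_map.

Lemma bsym_map_tensor x : bsym_map (tensor x) = bsym_gen x.
Proof. exact: plift_gen. Qed.

End Map.

Fact bsym_id a x : bsym_map (idm a) x = x.
Proof.
apply: (pres_ext (f := bsym_map (idm a)) (g := idfun)) => {}x /=.
rewrite bsym_map_tensor; congr tensor; apply: funext => j.
by rewrite sword_mk big_seq1 amap_id.
Qed.

Fact bsym_cmp a b c (g : hom b c) (f : hom a b) x :
  bsym_map (cmp g f) x = bsym_map g (bsym_map f x).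
Proof.
apply: (pres_ext (f := bsym_map (cmp g f)) (g := bsym_map g \o bsym_map f)) => {}x /=.
rewrite !bsym_map_tensor; congr tensor; apply: funext => j.
rewrite sword_mk /ssubst; elim: (sword g.1 j) => [|i w IH].
  by rewrite !big_nil.
rewrite /= big_cat big_cons /= IH; congr (_ * _).
rewrite (big_morph (amap A g.2) (@ahomM _ _ _ _) (@ahom1 _ _ _ _)).
by apply: eq_bigr => l _; rewrite amap_cmp.
Qed.

(* B_sym,+ applied to each A d; D is the opposite simplex category below.  The
   value at the initial object 0 is the empty tensor power k. *)
Definition bsymp : cmod k (prodcat DeltaSp D) :=
  @CMod k (prodcat DeltaSp D) (fun a => tpow (A a.2) a.1) bsym_map
    bsym_id bsym_cmp.

Definition bsym : cmod k (prodcat DeltaS D) :=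
  @crestr k DeltaSp D nat S bsymp.

End SymmetricBar.

Section SymmetricBarMap.
Context (k : fieldType) (D : category) (A B : calg k D) (f : atrans A B).

Section Component.
Variable a : prodcat DeltaSp D.

Definition bsymt_gen (x : 'I_a.1 -> A a.2) : tpow (B a.2) a.1 :=
  tensor (fun i => f a.2 (x i)).

Fact bsymt_multilinear : multilinear bsymt_gen.
Proof.
move=> x i c y z.
have E t : bsymt_gen (upd x i t) =
    tensor (upd (fun j => f a.2 (x j)) i (f a.2 t)).
  by congr tensor; apply: funext => j; rewrite /upd; case: (j == i).
by rewrite !E linearP; exact: tensor_multilinear.
Qed.

Definition bsymt_fun : bsymp A a -> bsymp B a :=
  plift (multilinear_respects bsymt_multilinear).
HB.instance Definition _ := GRing.Linear.on bsymt_fun.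
End Component.

Fact bsymt_nat a b (g : hom a b) x :
  bsymt_fun (cmap (bsymp A) g x) = cmap (bsymp B) g (bsymt_fun x).
Proof.
apply: (pres_ext (f := @bsymt_fun b \o cmap (bsymp A) g)
                 (g := cmap (bsymp B) g \o @bsymt_fun a)) => {}x /=.
rewrite /bsymt_fun bsym_map_tensor !plift_gen.
rewrite bsym_map_tensor; congr tensor; apply: funext => j /=.
rewrite (big_morph (f b.2) (@ahomM _ _ _ _) (@ahom1 _ _ _ _)).
by apply: eq_bigr => i _; rewrite atr_nat.
Qed.

Definition bsymp_trans : ctrans (bsymp A) (bsymp B) :=
  @CTrans k _ (bsymp A) (bsymp B) bsymt_fun bsymt_nat.

Definition bsym_trans : ctrans (bsym A) (bsym B) :=
  @CTrans k _ (bsym A) (bsym B) (fun a => bsymp_trans (a.1.+1, a.2))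
    (fun a b g => @bsymt_nat (a.1.+1, a.2) (b.1.+1, b.2) g).
End SymmetricBarMap.

Lemma idm_cmp (C D : category) (x : C) (a b c : D) (g : hom b c) (f : hom a b) :
  @cmp (prodcat C D) (x, a) (x, b) (x, c) (idm x, g) (idm x, f)
    = (idm x, cmp g f).
Proof. by rewrite /cmp /= cmp1m. Qed.

Section FunctorTensor.
Context (k : fieldType) (C D : category).
Context (N : cmod k (prodcat (opcat C) D)) (M : cmod k (prodcat C D)).

Definition ractl (d : D) (x y : C) (f : hom x y) : {linear N (y, d) -> N (x, d)} :=
  @cmap k _ N (y, d) (x, d) (f, idm d).
Definition lactl (d : D) (x y : C) (f : hom x y) : {linear M (x, d) -> M (y, d)} :=
  @cmap k _ M (x, d) (y, d) (f, idm d).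

Section Object.
Variable d : D.

Definition ten_idx : Type := {x : C & (N (x, d) * M (x, d))%type}.
Definition ten_pair (x : C) (n : N (x, d)) (m : M (x, d)) : ten_idx :=
  existT _ x (n, m).

Inductive ten_rel : freemod k ten_idx -> Prop :=
| TenRelL (x : C) (c : k) (n n' : N (x, d)) (m : M (x, d)) :
    ten_rel (fgen k (ten_pair (c *: n + n') m)
             - (c *: fgen k (ten_pair n m) + fgen k (ten_pair n' m)))
| TenRelR (x : C) (c : k) (n : N (x, d)) (m m' : M (x, d)) :
    ten_rel (fgen k (ten_pair n (c *: m + m'))
             - (c *: fgen k (ten_pair n m) + fgen k (ten_pair n m')))
| TenRelB (x y : C) (f : hom x y) (n : N (y, d)) (m : M (x, d)) :
    ten_rel (fgen k (ten_pair (ractl d f n) m)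
             - fgen k (ten_pair n (lactl d f m))).

(* The coend of N(-, d) and M(-, d) over C, presented by the elementary tensors.
   Taking both values at the same d, with D = opcat Delta, gives the diagonal of the
   bisimplicial module N_p (x)_C M_q. *)
Definition ten_ob : lmodType k := pres ten_rel.

Definition ten (x : C) (n : N (x, d)) (m : M (x, d)) : ten_ob :=
  pgen ten_rel (ten_pair n m).

Definition ten_lift (W : lmodType k)
    (F : forall x : C, N (x, d) -> M (x, d) -> W) (t : ten_idx) : W :=
  F (projT1 t) (projT2 t).1 (projT2 t).2.

Definition balanced (W : lmodType k) (F : forall x : C, N (x, d) -> M (x, d) -> W) :=
  [/\ forall (x : C) m, linear ((F x)^~ m), forall (x : C) n, linear (F x n) &
      forall (x y : C) (f : hom x y) n m,
        F x (ractl d f n) m = F y n (lactl d f m)].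

Lemma balanced_respects (W : lmodType k)
    (F : forall x : C, N (x, d) -> M (x, d) -> W) :
  balanced F -> respects ten_rel (ten_lift F).
Proof.
case=> Fl Fr Fb _ [x c n n' m|x c n m m'|x y f n m];
  apply/eqP; rewrite linearB subr_eq0; apply/eqP;
  rewrite ?linearP /= !flift_gen /ten_lift /=.
- exact: Fl.
- exact: Fr.
- exact: Fb.
Qed.

Lemma ten_balanced : balanced ten.
Proof.
split=> [x m c n n'|x n c m m'|x y f n m]; apply/eqP; rewrite -subr_eq0.
- have := pgen_rel (TenRelL c n n' m).
  by rewrite linearB linearD linearZ /= !flift_gen => /eqP.
- have := pgen_rel (TenRelR c n m m').
  by rewrite linearB linearD linearZ /= !flift_gen => /eqP.
- by have := pgen_rel (TenRelB f n m); rewrite linearB /= !flift_gen => /eqP.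
Qed.

Lemma ten_ext (W : lmodType k) (f g : {linear ten_ob -> W}) :
  (forall (x : C) n m, f (@ten x n m) = g (ten n m)) -> f =1 g.
Proof. by move=> fg; apply: pres_ext => -[x [n m]]; apply: fg. Qed.

End Object.

Section Map.
Context (d d' : D) (g : hom d d').

Definition ten_map_gen (x : C) (n : N (x, d)) (m : M (x, d)) : ten_ob d' :=
  ten (@cmap k _ N (x, d) (x, d') (@idm (opcat C) x, g) n)
      (@cmap k _ M (x, d) (x, d') (idm x, g) m).

Fact ten_map_balanced : balanced ten_map_gen.
Proof.
have [Tl Tr Tb] := ten_balanced d'.
split=> [x m c n n'|x n c m m'|x y f n m]; rewrite /ten_map_gen.
- by rewrite linearP; apply: Tl.
- by rewrite linearP; apply: Tr.
have -> : @cmap k _ N (x, d) (x, d') (@idm (opcat C) x, g) (ractl d f n) =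
    ractl d' f (@cmap k _ N (y, d) (y, d') (@idm (opcat C) y, g) n).
  rewrite /ractl -!cmap_cmp; congr (cmap N _ n).
  by rewrite /cmp /= !cmp1m !cmpm1.
rewrite Tb; congr ten.
rewrite /lactl -!cmap_cmp; congr (cmap M _ m).
by rewrite /cmp /= !cmp1m !cmpm1.
Qed.

Definition ten_map : ten_ob d -> ten_ob d' :=
  plift (balanced_respects ten_map_balanced).
HB.instance Definition _ := GRing.Linear.on ten_map.

Lemma ten_mapE x n m : ten_map (@ten d x n m) = ten_map_gen n m.
Proof. exact: plift_gen. Qed.

End Map.

Fact ten_map_id d x : ten_map (idm d) x = x.
Proof.
apply: (ten_ext (f := ten_map (idm d)) (g := idfun)) => y n m /=.
rewrite ten_mapE /ten_map_gen.
by congr ten; [exact: (@cmap_id _ _ N (y, d)) | exact: (@cmap_id _ _ M (y, d))].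
Qed.

Fact ten_map_cmp a b c (g : hom b c) (f : hom a b) x :
  ten_map (cmp g f) x = ten_map g (ten_map f x).
Proof.
apply: (ten_ext (f := ten_map (cmp g f)) (g := ten_map g \o ten_map f)) => y n m.
rewrite /= !ten_mapE /ten_map_gen -!cmap_cmp.
by congr ten; rewrite idm_cmp.
Qed.

Definition tens : cmod k D := CMod ten_map_id ten_map_cmp.

End FunctorTensor.

Section FunctorTensorMap.
Context (k : fieldType) (C D : category).
Context (N N' : cmod k (prodcat (opcat C) D)) (M M' : cmod k (prodcat C D)).
Variables (p : ctrans N N') (q : ctrans M M').

Section Component.
Variable d : D.

Definition tenst_gen (x : C) (n : N (x, d)) (m : M (x, d)) : tens N' M' d :=
  ten (p (x, d) n) (q (x, d) m).

Fact tenst_balanced : balanced tenst_gen.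
Proof.
have [Tl Tr Tb] := ten_balanced N' M' d.
split=> [x m c n n'|x n c m m'|x y f n m]; rewrite /tenst_gen.
- by rewrite linearP; apply: Tl.
- by rewrite linearP; apply: Tr.
rewrite (@ctr_nat _ _ _ _ p (y, d) (x, d)).
by rewrite (@ctr_nat _ _ _ _ q (x, d) (y, d)); apply: Tb.
Qed.

Definition tenst_fun : tens N M d -> tens N' M' d :=
  plift (balanced_respects tenst_balanced).
HB.instance Definition _ := GRing.Linear.on tenst_fun.

Lemma tenst_funE x n m : tenst_fun (@ten _ _ _ N M d x n m) = tenst_gen n m.
Proof. exact: plift_gen. Qed.
End Component.

Fact tenst_nat d d' (g : hom d d') x :
  tenst_fun (cmap (tens N M) g x) = cmap (tens N' M') g (tenst_fun x).
Proof.
apply: (ten_ext (f := @tenst_fun d' \o cmap (tens N M) g)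
                (g := cmap (tens N' M') g \o @tenst_fun d)) => y n m /=.
rewrite ten_mapE tenst_funE {1}/ten_map_gen tenst_funE ten_mapE /tenst_gen.
by rewrite /ten_map_gen -!ctr_nat.
Qed.

Definition tens_trans : ctrans (tens N M) (tens N' M') :=
  @CTrans k D (tens N M) (tens N' M') tenst_fun tenst_nat.

End FunctorTensorMap.

Definition ctrans_id (k : fieldType) (C : category) (M : cmod k C) : ctrans M M :=
  @CTrans k C M M (fun=> idfun) (fun a b f x => erefl).

Definition ctrans_cmp (k : fieldType) (C : category) (M N P : cmod k C)
    (q : ctrans N P) (p : ctrans M N) : ctrans M P :=
  @CTrans k C M P (fun a => q a \o p a)
    (fun a b f x => etrans (congr1 (q b) (ctr_nat p f x)) (ctr_nat q f (p a x))).

(* A p-simplex of the nerve of the under-category of x in C: a functor from the poset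
   {0, ..., p} to that category.  Its objects are the morphisms uleg i : x -> uob i. *)
Record usimp (C : category) (x : C) (p : nat) := USimp {
  uob : 'I_p.+1 -> C;
  uleg : forall i, hom x (uob i);
  uarr : forall i j : 'I_p.+1, (i <= j)%N -> hom (uob i) (uob j);
  uarr_id : forall (i : 'I_p.+1) (h : (i <= i)%N), uarr h = idm (uob i);
  uarr_cmp : forall (i j l : 'I_p.+1) (hij : (i <= j)%N) (hjl : (j <= l)%N) (hil : (i <= l)%N),
    cmp (uarr hjl) (uarr hij) = uarr hil;
  uarr_leg : forall (i j : 'I_p.+1) (h : (i <= j)%N), cmp (uarr h) (uleg i) = uleg j }.

Lemma usimp_eq (C : category) (x : C) (p : nat) (s t : usimp x p)
    (e : uob s = uob t) :
  (forall i, ecast o (hom x (o i)) e (uleg s i) = uleg t i) ->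
  (forall (i j : 'I_p.+1) (h : (i <= j)%N),
     ecast o (hom (o i) (o j)) e (uarr s h) = uarr t h) ->
  s = t.
Proof.
case: s t e => ob l a a1 a2 a3 [ob' l' a' a1' a2' a3'] /= e; subst ob' => /= el ea.
have {el} el : l = l' by apply: functional_extensionality_dep.
have {ea} ea : a = a'.
  do 3!(apply: functional_extensionality_dep => ?); exact: ea.
by subst l' a'; congr USimp; exact: Prop_irrelevance.
Qed.

Section Nerve.
Context (k : fieldType) (C : category).

Section Act.
Context (x y : C) (p q : nat) (f : hom y x) (g : dhom q p) (s : usimp x p).

Fact usimp_act_id (i : 'I_q.+1) (h : (i <= i)%N) :
  uarr s (svalP g i i h) = idm (uob s (sval g i)).
Proof. exact: uarr_id. Qed.
Fact usimp_act_cmp (i j l : 'I_q.+1) (hij : (i <= j)%N) (hjl : (j <= l)%N)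
    (hil : (i <= l)%N) :
  cmp (uarr s (svalP g j l hjl)) (uarr s (svalP g i j hij)) =
    uarr s (svalP g i l hil).
Proof. exact: uarr_cmp. Qed.
Fact usimp_act_leg (i j : 'I_q.+1) (h : (i <= j)%N) :
  cmp (uarr s (svalP g i j h)) (cmp (uleg s (sval g i)) f) =
    cmp (uleg s (sval g j)) f.
Proof. by rewrite cmpA uarr_leg. Qed.

Definition usimp_act : usimp y q :=
  @USimp C y q (fun i => uob s (sval g i)) (fun i => cmp (uleg s (sval g i)) f)
    (fun i j h => uarr s (svalP g i j h))
    usimp_act_id usimp_act_cmp usimp_act_leg.
End Act.

Section Map.
Context (a b : prodcat (opcat C) (opcat Delta)) (fg : hom a b).

Definition nerve_map : freemod k (@usimp C a.1 a.2) -> freemod k (@usimp C b.1 b.2) :=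
  flift (fun s => fgen k (@usimp_act a.1 b.1 a.2 b.2 fg.1 fg.2 s)).
HB.instance Definition _ := GRing.Linear.on nerve_map.
Lemma nerve_mapE s :
  nerve_map (fgen k s) = fgen k (@usimp_act a.1 b.1 a.2 b.2 fg.1 fg.2 s).
Proof. exact: flift_gen. Qed.
End Map.

Fact nerve_map_id a x : nerve_map (idm a) x = x.
Proof.
apply: (free_ext (f := nerve_map (idm a)) (g := idfun)) => s /=.
rewrite nerve_mapE; congr fgen; 
apply: (@usimp_eq C a.1 a.2 (@usimp_act a.1 a.1 a.2 a.2 (idm a).1 (idm a).2 s) s erefl) => /=.
  by move=> i; rewrite cmpm1.
by move=> i j h; congr uarr; apply: bool_irrelevance.
Qed.

Fact nerve_map_cmp a b c (g : hom b c) (f : hom a b) x :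
  nerve_map (cmp g f) x = nerve_map g (nerve_map f x).
Proof.
apply: (free_ext (f := nerve_map (cmp g f)) (g := nerve_map g \o nerve_map f)) => s /=.
rewrite !nerve_mapE; congr fgen; 
apply: (@usimp_eq C c.1 c.2 (@usimp_act a.1 c.1 a.2 c.2 (cmp g f).1 (cmp g f).2 s)
  (@usimp_act b.1 c.1 b.2 c.2 g.1 g.2 (@usimp_act a.1 b.1 a.2 b.2 f.1 f.2 s)) erefl) => /=.
  by move=> i; rewrite cmpA.
by move=> i j h; congr uarr; apply: bool_irrelevance.
Qed.

(* The simplicial right C-module k[N(- | C)], where x | C is the under-category of x.
   In each degree it is a direct sum of representables, and it resolves the constant
   right C-module k because x | C has an initial object. *)
Definition nerve : cmod k (prodcat (opcat C) (opcat Delta)) :=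
  @CMod k (prodcat (opcat C) (opcat Delta))
    (fun a => freemod k (@usimp C a.1 a.2)) nerve_map nerve_map_id nerve_map_cmp.

Definition rconst : cmod k (prodcat (opcat C) (opcat Delta)) :=
  cconst k (prodcat (opcat C) (opcat Delta)).

Definition augm_fun (a : prodcat (opcat C) (opcat Delta)) : nerve a -> rconst a :=
  flift (fun=> 1 : k^o).
HB.instance Definition _ a := GRing.Linear.on (@augm_fun a).

Fact augm_nat a b (f : hom a b) x :
  augm_fun (cmap nerve f x) = cmap rconst f (augm_fun x).
Proof.
apply: (free_ext (f := @augm_fun b \o cmap nerve f)
                 (g := cmap rconst f \o @augm_fun a)) => s /=.
by rewrite nerve_mapE /augm_fun !flift_gen.
Qed.

Definition augm : ctrans nerve rconst := @CTrans k _ nerve rconst augm_fun augm_nat.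

End Nerve.

(* The derived tensor product of k and a simplicial C-module M over C, computed with the
   resolution nerve k C: its homotopy groups are the hyper-Tor groups of k and M, the
   diagonal being equivalent to the total complex by Eilenberg-Zilber. *)
Definition dtens (k : fieldType) (C : category)
    (M : cmod k (prodcat C (opcat Delta))) : smod k :=
  tens (nerve k C) M.

Definition ctens (k : fieldType) (C : category)
    (M : cmod k (prodcat C (opcat Delta))) : smod k :=
  tens (rconst k C) M.

Definition dtens_ctens (k : fieldType) (C : category)
    (M : cmod k (prodcat C (opcat Delta))) : ctrans (dtens M) (ctens M) :=
  tens_trans (augm k C) (ctrans_id M).

Definition dtens_trans (k : fieldType) (C : category)
    (M M' : cmod k (prodcat C (opcat Delta))) (f : ctrans M M') :
  ctrans (dtens M) (dtens M') :=
  tens_trans (ctrans_id (nerve k C)) f.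

Section Homotopy.
Context (k : fieldType).

Definition face (X : smod k) (n : nat) (i : 'I_n.+2) : {linear X n.+1 -> X n} :=
  @cmap k (opcat Delta) X n.+1 n (coface i).

Definition is_cycle (X : smod k) (n : nat) : X n -> Prop :=
  match n return X n -> Prop with
  | 0 => fun=> True
  | m.+1 => fun x => forall i : 'I_m.+2, face X i x = 0
  end.

Definition cycb (X : smod k) (n : nat) : {pred X n} := fun x => `[< is_cycle x >].

Fact cycb_submod (X : smod k) (n : nat) : submod_closed (@cycb X n).
Proof.
split=> [|c x y /asboolP hx /asboolP hy]; apply/asboolP.
  by case: n => // n i; rewrite linear0.
by case: n x y hx hy => // n x y hx hy i; rewrite linearP hx hy scaler0 addr0.
Qed.

HB.instance Definition _ (X : smod k) (n : nat) :=
  GRing.isSubmodClosed.Build k (X n) (@cycb X n) (cycb_submod X n).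

Record cycle (X : smod k) (n : nat) := Cycle { cyc :> X n; _ : cyc \in @cycb X n }.

HB.instance Definition _ (X : smod k) (n : nat) := [isSub of cycle X n for @cyc X n].
HB.instance Definition _ (X : smod k) (n : nat) := [Choice of cycle X n by <:].
HB.instance Definition _ (X : smod k) (n : nat) :=
  [SubChoice_isSubLmodule of cycle X n by <:].

Definition is_bnd (X : smod k) (n : nat) (z : cycle X n) : Prop :=
  exists2 y : X n.+1,
    (forall i : 'I_n.+2, i != ord0 -> face X i y = 0) & face X ord0 y = cyc z.

(* pi_n X is the n-th homology of the normalized chain complex of X, whose n-th
   term is the common kernel of the faces d_1, ..., d_n, with differential d_0. *)
Definition piS (X : smod k) (n : nat) : lmodType k := quomod (@is_bnd X n).

(* The class of x if x is a cycle, and 0 otherwise. *)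
Definition pclass (X : smod k) (n : nat) (x : X n) : piS X n :=
  qpi (@is_bnd X n) (insubd (0 : cycle X n) x).

Definition prepr (X : smod k) (n : nat) (u : piS X n) : X n := cyc (qrepr u).

Section Map.
Context (X Y : smod k) (f : ctrans X Y) (n : nat).

Fact cyc_map_subproof (z : cycle X n) : f n (cyc z) \in @cycb Y n.
Proof.
case: z => x /= /asboolP hx; apply/asboolP.
case: n x hx => // m x hx i; rewrite /face -ctr_nat.
by rewrite -/(face X i) [X in f m X]hx linear0.
Qed.

Definition cyc_map (z : cycle X n) : cycle Y n := Cycle (cyc_map_subproof z).

Fact cyc_map_linear : linear cyc_map.
Proof. by move=> c x y; apply: val_inj; rewrite /= linearP. Qed.

HB.instance Definition _ :=
  GRing.isLinear.Build k (cycle X n) (cycle Y n) _ cyc_map cyc_map_linear.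

Definition pi_map_pre : {linear cycle X n -> piS Y n} :=
  qpi (@is_bnd Y n) \o cyc_map.

Fact pi_map_subproof (z : cycle X n) : is_bnd z -> pi_map_pre z = 0.
Proof.
case=> y hy yz; rewrite /= -(linear0 (qpi _)).
apply/qpi_eq; rewrite subr0; apply: span_in; exists (f n.+1 y).
  by move=> i /hy hi; rewrite /face -ctr_nat -/(face X i) [X in f n X]hi linear0.
by rewrite /face -ctr_nat -/(face X _) [X in f n X]yz.
Qed.

Definition pi_map : piS X n -> piS Y n := qlift pi_map_subproof.
HB.instance Definition _ := GRing.Linear.on pi_map.
End Map.

(* A (p, q)-shuffle is given by the set S of the p steps i -> i+1 of the
   path {0, ..., p+q} -> {0, ..., p} x {0, ..., q} in the first direction. *)
Section Steps.
Context (n p : nat) (S : {set 'I_n}) (hS : #|S| = p).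

Fact steps_subproof (i : 'I_n.+1) : (#|[set j in S | (j < i)%N]| < p.+1)%N.
Proof.
by rewrite ltnS -hS; apply/subset_leq_card/fintype.subsetP => j; rewrite inE => /andP[].
Qed.

Fact steps_homo :
  {homo (fun i => Ordinal (steps_subproof i)) : i i' / (i <= i')%N}.
Proof.
move=> i i' ii' /=; apply/subset_leq_card/fintype.subsetP => j; rewrite !inE.
by case/andP=> -> /= ji; apply: leq_trans ii'.
Qed.

Definition steps : dhom n p := dmk steps_homo.
End Steps.

Lemma steps_compl (p q : nat) (S : {set 'I_(p + q)}) : #|S| = p -> #|~: S| = q.
Proof. by move=> hS; rewrite cardsCs finset.setCK card_ord hS addKn. Qed.

Definition inversions n (S : {set 'I_n}) : nat :=
  #|[set ij : 'I_n * 'I_n | [&& ij.1 \in S, ij.2 \notin S & (ij.2 < ij.1)%N]]|.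

(* The degeneracies applied to x are indexed by the complement of S, those applied to
   y by S; the sign is that of the shuffle (S, ~: S). *)
Definition shuffle (X : smod k) (mul : forall n : nat, X n -> X n -> X n) (p q : nat)
    (x : X p) (y : X q) : X (p + q)%N :=
  \sum_(S : {S : {set 'I_(p + q)} | #|S| == p})
    (-1) ^+ inversions (val S) *:
      mul _ (@cmap k (opcat Delta) X p (p + q)%N (steps (eqP (valP S))) x)
            (@cmap k (opcat Delta) X q (p + q)%N
               (steps (steps_compl (eqP (valP S)))) y).

Definition pi_mul (X : smod k) (mul : forall n : nat, X n -> X n -> X n) (p q : nat)
    (u : piS X p) (v : piS X q) : piS X (p + q)%N :=
  pclass (shuffle mul (prepr u) (prepr v)).

End Homotopy.

Section Abelianization.
Context (k : fieldType).

Section Algebra.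
Variable A : algebra k.

(* The span of these elements is the two-sided ideal generated by commutators. *)
Inductive comm_rel : A -> Prop :=
| CommRel (u x y v : A) : comm_rel (u * (x * y - y * x) * v).

Definition ab_mod : lmodType k := quomod comm_rel.

Definition ab_mul (p q : ab_mod) : ab_mod :=
  qpi comm_rel (qrepr p * qrepr q).

Lemma comm_span_mull (u z : A) : span comm_rel z -> span comm_rel (u * z).
Proof.
elim=> [|c _ y [v x x' w] _ IH]; first by rewrite mulr0; exact: span0.
rewrite mulrDr alg_scaleAr; apply: span_lin IH.
by rewrite !mulrA -[u * v * _ * _]mulrA -mulrA !mulrA; apply: CommRel.
Qed.

Lemma comm_span_mulr (u z : A) : span comm_rel z -> span comm_rel (z * u).
Proof.
elim=> [|c _ y [v x x' w] _ IH]; first by rewrite mul0r; exact: span0.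
rewrite mulrDl alg_scaleAl; apply: span_lin IH.
by rewrite -mulrA; apply: CommRel.
Qed.

Lemma ab_mulE (x y : A) : ab_mul (qpi _ x) (qpi _ y) = qpi _ (x * y).
Proof.
apply/qpi_eq; set x' := qrepr _; set y' := qrepr _.
have -> : x' * y' - x * y = (x' - x) * y' + x * (y' - y).
  by rewrite mulrBl mulrBr addrA subrK.
apply: spanD; [apply: comm_span_mulr|apply: comm_span_mull];
  by apply/qpi_eq; rewrite qreprK.
Qed.

Definition ab_one : ab_mod := qpi comm_rel 1.

Fact ab_mulA : associative ab_mul.
Proof. by move=> p q r; rewrite -[p]qreprK -[q]qreprK -[r]qreprK !ab_mulE mulrA. Qed.
Fact ab_mul1 : left_id ab_one ab_mul.
Proof. by move=> p; rewrite -[p]qreprK /ab_one ab_mulE mul1r. Qed.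
Fact ab_mulr1 : right_id ab_one ab_mul.
Proof. by move=> p; rewrite -[p]qreprK /ab_one ab_mulE mulr1. Qed.
Fact ab_mulDl : left_distributive ab_mul +%R.
Proof.
move=> p q r; rewrite -[p]qreprK -[q]qreprK -[r]qreprK -linearD !ab_mulE.
by rewrite mulrDl linearD.
Qed.
Fact ab_mulDr : right_distributive ab_mul +%R.
Proof.
move=> p q r; rewrite -[p]qreprK -[q]qreprK -[r]qreprK -linearD !ab_mulE.
by rewrite mulrDr linearD.
Qed.
Fact ab_mulZl c p q : ab_mul (c *: p) q = c *: ab_mul p q.
Proof.
rewrite -[p]qreprK -[q]qreprK -linearZ !ab_mulE -linearZ /=.
by rewrite alg_scaleAl.
Qed.
Fact ab_mulZr c p q : ab_mul p (c *: q) = c *: ab_mul p q.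
Proof.
rewrite -[p]qreprK -[q]qreprK -linearZ !ab_mulE -linearZ /=.
by rewrite alg_scaleAr.
Qed.

Definition ab : algebra k :=
  Algebra ab_mulA ab_mul1 ab_mulr1 ab_mulDl ab_mulDr ab_mulZl ab_mulZr.

Lemma ab_mulC (p q : ab) : p * q = q * p.
Proof.
rewrite -[p]qreprK -[q]qreprK.
rewrite -[LHS]/(ab_mul (qpi _ _) (qpi _ _)) -[RHS]/(ab_mul (qpi _ _) (qpi _ _)).
rewrite !ab_mulE; apply/qpi_eq; apply: span_in.
set x := qrepr p; set y := qrepr q.
by rewrite -[_ - _]mul1r -[1 * _]mulr1; apply: CommRel.
Qed.

Definition ab_pi : A -> ab := qpi comm_rel.
HB.instance Definition _ := GRing.Linear.on ab_pi.

Lemma ab_piM (x y : A) : ab_pi (x * y) = ab_pi x * ab_pi y.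
Proof. by rewrite -[RHS]/(ab_mul (qpi _ _) (qpi _ _)) ab_mulE. Qed.

Lemma ab_pi_prod (I : Type) (s : seq I) (F : I -> A) :
  ab_pi (\prod_(i <- s) F i) = \prod_(i <- s) ab_pi (F i).
Proof. by apply: (big_morph ab_pi); [exact: ab_piM|]. Qed.
End Algebra.

Section Map.
Context (A B : algebra k) (f : algHom A B).

Fact ab_map_subproof x : comm_rel x -> (qpi (@comm_rel B) \o f) x = 0.
Proof.
case=> u z y v; rewrite /= -(linear0 (qpi _)); apply/qpi_eq; rewrite subr0.
by rewrite !ahomM linearB !ahomM; apply: span_in; apply: CommRel.
Qed.

Definition ab_map_fun : ab A -> ab B := qlift ab_map_subproof.
HB.instance Definition _ := GRing.Linear.on ab_map_fun.

Lemma ab_map_pi x : ab_map_fun (ab_pi x) = ab_pi (f x).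
Proof. exact: qlift_pi. Qed.

Fact ab_map1 : ab_map_fun 1 = 1.
Proof. by rewrite -[X in ab_map_fun X]/(ab_pi 1) ab_map_pi ahom1. Qed.
Fact ab_mapM : {morph ab_map_fun : x y / x * y}.
Proof.
move=> p q; rewrite -[p]qreprK -[q]qreprK -![qpi _ _]/(ab_pi _).
by rewrite -ab_piM !ab_map_pi ahomM ab_piM.
Qed.

Definition ab_map : algHom (ab A) (ab B) := @AlgHom k _ _ ab_map_fun ab_map1 ab_mapM.
End Map.

Section Functor.
Context (C : category) (A : calg k C).

Fact ab_functor_id a (x : ab (A a)) : ab_map (amap A (idm a)) x = x.
Proof.
by rewrite -[x]qreprK -![qpi _ _]/(ab_pi _) /= ab_map_pi amap_id.
Qed.
Fact ab_functor_cmp a b c (g : hom b c) (f : hom a b) (x : ab (A a)) :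
  ab_map (amap A (cmp g f)) x = ab_map (amap A g) (ab_map (amap A f) x).
Proof.
by rewrite -[x]qreprK -![qpi _ _]/(ab_pi _) /= !ab_map_pi amap_cmp.
Qed.

Definition abC : calg k C := CAlg ab_functor_id ab_functor_cmp.
End Functor.
End Abelianization.

Lemma prod_words (R : comPzRingType) (m n : nat) (w : 'I_n -> seq 'I_m)
    (F : 'I_m -> R) :
  (forall i, (\sum_j count_mem i (w j))%N = 1%N) ->
  \prod_j \prod_(i <- w j) F i = \prod_i F i.
Proof.
move=> w1; transitivity (\prod_i F i ^+ (\sum_j count_mem i (w j))%N); last first.
  by apply: eq_bigr => i _; rewrite w1.
under [RHS]eq_bigr do rewrite -prodrXr.
rewrite exchange_big; apply: eq_bigr => j _.
elim: (w j) => [|x s IH]; first by rewrite big_nil big1.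
rewrite big_cons IH (bigD1 x) //= [in RHS](bigD1 x) //= eqxx exprS mulrA.
by congr (_ * _); apply: eq_bigr => i /negPf; rewrite eq_sym => ->.
Qed.

Section BsymToAb.
Context (k : fieldType) (A : salg k).

Section Component.
Variable d : opcat Delta.

Definition prod_ab (n : nat) (b : 'I_n -> A d) : ab (A d) :=
  ab_pi (\prod_(i < n) b i).

Fact prod_ab_multilinear n : multilinear (@prod_ab n).
Proof.
move=> b i c x y; rewrite /prod_ab !ab_pi_prod.
have c1 : count_mem i (index_enum 'I_n) = 1%N.
  by rewrite count_uniq_mem ?index_enum_uniq // mem_index_enum.
have [[u v] /= uv] := @prod_update k _ _ (index_enum 'I_n) (fun j => ab_pi (b j)) i c1.
have E z : \prod_(j < n) ab_pi (upd b i z j) = u * ab_pi z * v.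
  rewrite -uv; apply: eq_bigr => j _; rewrite /upd.
  by case: (j == i).
by rewrite !E linearP mulrDr mulrDl alg_scaleAr alg_scaleAl.
Qed.

Definition mult_ab (n : nat) : tpow (A d) n -> ab (A d) :=
  plift (multilinear_respects (@prod_ab_multilinear n)).
HB.instance Definition _ n := GRing.Linear.on (@mult_ab n).

Lemma mult_ab_tensor n b : mult_ab (@tensor k (A d) n b) = prod_ab b.
Proof. exact: plift_gen. Qed.

Lemma mult_ab_bsym (x y : DeltaSp) (f : hom x y) (m : bsymp A (x, d)) :
  mult_ab (cmap (bsymp A) ((f, idm d) : @hom (prodcat DeltaSp _) (x, d) (y, d)) m)
    = mult_ab m.
Proof.
move: m; apply: (pres_ext (f := @mult_ab y \o
  @cmap _ _ (bsymp A) (x, d) (y, d) (f, idm d)) (g := @mult_ab x)) => b /=.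
rewrite bsym_map_tensor !mult_ab_tensor /prod_ab !ab_pi_prod.
under eq_bigr => j _ do rewrite ab_pi_prod.
under eq_bigr => j _ do under eq_bigr => i _ do rewrite amap_id.
pose R : comPzRingType := HB.pack (alg_car (ab (A d)))
  (GRing.PzSemiRing_hasCommutativeMul.Build (alg_car (ab (A d))) (@ab_mulC k (A d))).
exact: (@prod_words R x y (sword f) (fun i => ab_pi (b i)) (sword_count f)).
Qed.

Definition bsym_ab_gen (x : DeltaS) (c : rconst k DeltaS (x, d))
    (m : bsym A (x, d)) : calg_mod (abC A) d :=
  (c : k) *: mult_ab m.

Fact bsym_ab_balanced :
  @balanced k DeltaS _ (rconst k DeltaS) (bsym A) d _ bsym_ab_gen.
Proof.
split=> [x m c n n'|x n c m m'|x y f n m]; rewrite /bsym_ab_gen.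
- by rewrite scalerDl scalerA.
- by rewrite linearP scalerDr !scalerA mulrC.
- by congr (_ *: _); exact/esym/(@mult_ab_bsym x.+1 y.+1 f).
Qed.

Definition bsym_ab_fun : ctens (bsym A) d -> calg_mod (abC A) d :=
  plift (balanced_respects bsym_ab_balanced).
HB.instance Definition _ := GRing.Linear.on bsym_ab_fun.
End Component.

Fact bsym_ab_nat d d' (g : hom d d') x :
  bsym_ab_fun (cmap (ctens (bsym A)) g x) =
    cmap (calg_mod (abC A)) g (bsym_ab_fun x).
Proof.
apply: (ten_ext (f := @bsym_ab_fun d' \o cmap (ctens (bsym A)) g)
  (g := cmap (calg_mod (abC A)) g \o @bsym_ab_fun d)) => y n m /=.
rewrite ten_mapE /bsym_ab_fun !plift_gen /ten_lift /= /bsym_ab_gen.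
rewrite linearZ /=; congr (_ *: _).
move: m; apply: (pres_ext (f := @mult_ab d' _ \o
    @bsym_map k _ A (y.+1, d) (y.+1, d') (@idm DeltaSp y.+1, g))
  (g := ab_map_fun (amap A g) \o @mult_ab d _)) => b /=.
rewrite bsym_map_tensor !mult_ab_tensor /prod_ab ab_map_pi.
rewrite (big_morph (amap A g) (@ahomM _ _ _ _) (@ahom1 _ _ _ _)).
congr ab_pi; apply: eq_bigr => i _.
by rewrite sword_mk big_seq1.
Qed.

Definition bsym_ab : ctrans (ctens (bsym A)) (calg_mod (abC A)) :=
  @CTrans k _ (ctens (bsym A)) (calg_mod (abC A)) bsym_ab_fun bsym_ab_nat.
End BsymToAb.

Section Comparison.
Context (k : fieldType) (C : category) (T : Type) (i : T -> C).
Context (M : cmod k (prodcat C (opcat Delta))).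
Let C' := fullsub i.

Definition usimp_incl (x : T) (p : nat) (s : @usimp C' x p) : @usimp C (i x) p :=
  @USimp C (i x) p (fun j => i (uob s j)) (fun j => uleg s j)
    (fun j l h => uarr s h) (fun j h => uarr_id s h)
    (fun j l m a b c => uarr_cmp s a b c) (fun j l h => uarr_leg s h).

Lemma usimp_incl_act (x y : T) p q (f : @hom C' y x) (g : dhom q p)
    (s : @usimp C' x p) :
  usimp_incl (usimp_act f g s) = @usimp_act C (i x) (i y) p q f g (usimp_incl s).
Proof.
exact: (@usimp_eq C (i y) q (usimp_incl (usimp_act f g s))
  (@usimp_act C (i x) (i y) p q f g (usimp_incl s)) erefl).
Qed.

Section Component.
Variable d : opcat Delta.

Definition cmpr_gen (x : C') (n : nerve k C' (x, d))
    (m : crestr (D := opcat Delta) i M (x, d)) : dtens M d :=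
  @ten k C _ (nerve k C) M d (i x) (flift (fun s => fgen k (usimp_incl s)) n) m.

Fact cmpr_balanced :
  @balanced k C' _ (nerve k C') (crestr i M) d _ cmpr_gen.
Proof.
have [Tl Tr Tb] := ten_balanced (nerve k C) M d.
split=> [x m c n n'|x n c m m'|x y f n m]; rewrite /cmpr_gen.
- by rewrite linearP; apply: Tl.
- exact: Tr.
rewrite -[RHS](@Tb (i x) (i y) f); congr ten.
move: n; apply: (free_ext
  (f := flift (fun s => fgen k (usimp_incl s)) \o ractl (nerve k C') d f)
  (g := ractl (nerve k C) d (f : @hom C (i x) (i y))
        \o flift (fun s => fgen k (usimp_incl s)))) => s /=.
rewrite nerve_mapE !flift_gen nerve_mapE; congr fgen.
exact: usimp_incl_act.
Qed.

Definition cmpr_fun : dtens (C := C') (crestr i M) d -> dtens M d :=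
  plift (balanced_respects cmpr_balanced).
HB.instance Definition _ := GRing.Linear.on cmpr_fun.
End Component.

Fact cmpr_nat d d' (g : hom d d') x :
  cmpr_fun (cmap (dtens (C := C') (crestr i M)) g x) =
    cmap (dtens M) g (cmpr_fun x).
Proof.
apply: (ten_ext (f := @cmpr_fun d' \o cmap (dtens (C := C') (crestr i M)) g)
  (g := cmap (dtens M) g \o @cmpr_fun d)) => y n m /=.
rewrite ten_mapE /cmpr_fun !plift_gen /ten_lift /= /cmpr_gen ten_mapE.
rewrite /ten_map_gen; congr ten.
move: n; apply: (free_ext
  (f := flift (fun s => fgen k (usimp_incl s)) \o
    @cmap _ _ (nerve k C') (y, d) (y, d') (@idm (opcat C') y, g))
  (g := @cmap _ _ (nerve k C) (i y, d) (i y, d') (@idm (opcat C) (i y), g)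
        \o flift (fun s => fgen k (usimp_incl s)))) => s /=.
rewrite nerve_mapE !flift_gen nerve_mapE; congr fgen.
exact: (usimp_incl_act (@idm C' y) g s).
Qed.

Definition cmpr : ctrans (dtens (C := C') (crestr i M)) (dtens M) :=
  @CTrans k _ (dtens (C := C') (crestr i M)) (dtens M) cmpr_fun cmpr_nat.
End Comparison.

Definition ssum_word (a a' b b' : nat) (f : shom a b) (f' : shom a' b')
    (j : 'I_(b + b')) : seq 'I_(a + a') :=
  match fintype.split j with
  | inl l => map (lshift a') (sword f l)
  | inr l => map (@rshift a a') (sword f' l)
  end.

Fact ssum_subproof (a a' b b' : nat) (f : shom a b) (f' : shom a' b') i :
  (\sum_j count_mem i (ssum_word f f' j))%N = 1%N.
Proof.
rewrite big_split_ord /=.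
have El l : ssum_word f f' (lshift b' l) = map (lshift a') (sword f l).
  by rewrite /ssum_word -[lshift _ _]/(unsplit (inl l)) unsplitK.
have Er l : ssum_word f f' (rshift b l) = map (@rshift a a') (sword f' l).
  by rewrite /ssum_word -[rshift _ _]/(unsplit (inr l)) unsplitK.
under eq_bigr do rewrite El count_map.
under [X in (_ + X)%N]eq_bigr do rewrite Er count_map.
case: (split_ordP i) => i' ->.
  rewrite [X in (_ + X)%N]big1 ?addn0 => [|l _].
    rewrite -[RHS](sword_count f i'); apply: eq_bigr => l _.
    by apply: eq_count => z /=; rewrite (inj_eq (@lshift_inj _ _)).
  by apply/eqP; rewrite -leqn0 leqNgt -has_count; apply/hasPn => z _ /=; rewrite eq_sym eq_lrshift.
rewrite big1 ?add0n => [|l _].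
  rewrite -[RHS](sword_count f' i'); apply: eq_bigr => l _.
  by apply: eq_count => z /=; rewrite (inj_eq (@rshift_inj _ _)).
by apply/eqP; rewrite -leqn0 leqNgt -has_count; apply/hasPn => z _ /=; rewrite eq_lrshift.
Qed.

Definition ssum (a a' b b' : nat) (f : shom a b) (f' : shom a' b') :
  shom (a + a') (b + b') := smk (ssum_subproof f f').

Lemma ssumE (a a' b b' : nat) (f : shom a b) (f' : shom a' b') j :
  sword (ssum f f') j = ssum_word f f' j.
Proof. exact: sword_mk. Qed.

Fact ssum_id a a' : ssum (sid a) (sid a') = sid (a + a').
Proof.
apply: shom_eq => j; rewrite ssumE sword_mk /ssum_word -{2}[j]splitK.
by case: (fintype.split j) => l; rewrite sword_mk.
Qed.

Fact ssum_cmp a a' b b' c c' (g : shom b c) (g' : shom b' c')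
    (f : shom a b) (f' : shom a' b') :
  ssum (scmp g f) (scmp g' f') = scmp (ssum g g') (ssum f f').
Proof.
apply: shom_eq => j; rewrite ssumE sword_mk ssumE /ssum_word.
case: (fintype.split j) => l; rewrite sword_mk /ssubst map_flatten -!map_comp;
  congr flatten; apply: eq_map => z /=; rewrite ssumE /ssum_word.
- by rewrite -[lshift _ _]/(unsplit (inl z)) unsplitK.
- by rewrite -[rshift _ _]/(unsplit (inr z)) unsplitK.
Qed.

Section NerveSum.
Context (x y : DeltaSp) (p : nat) (s : @usimp DeltaSp x p) (t : @usimp DeltaSp y p).

Let ob (i : 'I_p.+1) : DeltaSp := (uob s i + uob t i)%N.
Let leg i : @hom DeltaSp (x + y)%N (ob i) := ssum (uleg s i) (uleg t i).
Let arr (i j : 'I_p.+1) (h : (i <= j)%N) : @hom DeltaSp (ob i) (ob j) :=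
  ssum (uarr s h) (uarr t h).

Fact usum_id (i : 'I_p.+1) (h : (i <= i)%N) : arr h = idm (ob i).
Proof. by rewrite /arr !uarr_id; apply: ssum_id. Qed.
Fact usum_cmp (i j l : 'I_p.+1) (hij : (i <= j)%N) (hjl : (j <= l)%N)
    (hil : (i <= l)%N) : cmp (arr hjl) (arr hij) = arr hil.
Proof.
by rewrite /arr -(uarr_cmp s hij hjl) -(uarr_cmp t hij hjl) [RHS]ssum_cmp.
Qed.
Fact usum_leg (i j : 'I_p.+1) (h : (i <= j)%N) : cmp (arr h) (leg i) = leg j.
Proof.
by rewrite /leg -(uarr_leg s h) -(uarr_leg t h) [RHS]ssum_cmp.
Qed.

Definition usum : @usimp DeltaSp (x + y)%N p := USimp usum_id usum_cmp usum_leg.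
End NerveSum.

Section TensorCat.
Context (k : fieldType) (V : lmodType k) (m n : nat).

Definition cat_fun (a : 'I_m -> V) (b : 'I_n -> V) (i : 'I_(m + n)) : V :=
  match fintype.split i with inl j => a j | inr j => b j end.

Lemma cat_upd_l a b i x : cat_fun (upd a i x) b = upd (cat_fun a b) (lshift n i) x.
Proof.
apply: funext => j; rewrite /cat_fun /upd; case: (split_ordP j) => l ->.
  by rewrite (inj_eq (@lshift_inj _ _)).
by rewrite eq_rlshift.
Qed.

Lemma cat_upd_r a b i x : cat_fun a (upd b i x) = upd (cat_fun a b) (rshift m i) x.
Proof.
apply: funext => j; rewrite /cat_fun /upd; case: (split_ordP j) => l ->.
  by rewrite eq_lrshift.
by rewrite (inj_eq (@rshift_inj _ _)).
Qed.

Fact tcat_l b : respects (@tpow_rel k V m) (fun a => tensor (cat_fun a b)).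
Proof.
apply: multilinear_respects => a i c x y.
by rewrite !cat_upd_l; apply: tensor_multilinear.
Qed.
Fact tcat_r a : respects (@tpow_rel k V n) (fun b => tensor (cat_fun a b)).
Proof.
apply: multilinear_respects => b i c x y.
by rewrite !cat_upd_r; apply: tensor_multilinear.
Qed.

Definition tcat : tpow V m -> tpow V n -> tpow V (m + n) := plift2 tcat_l tcat_r.

Lemma tcat_tensor a b : tcat (tensor a) (tensor b) = tensor (cat_fun a b).
Proof. exact: plift2_gen. Qed.
Lemma tcat_linl v : linear (tcat^~ v).
Proof. exact: plift2_linl. Qed.
Lemma tcat_linr u : linear (tcat u).
Proof. exact: plift2_linr. Qed.
End TensorCat.

Section ProductC.
Context (k : fieldType) (A : salg k).

Definition CA : smod k := dtens (bsymp A).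

Section Component.
Variable d : opcat Delta.

Definition ncat (x y : DeltaSp) :
    nerve k DeltaSp (x, d) -> nerve k DeltaSp (y, d) ->
    nerve k DeltaSp ((x + y)%N : DeltaSp, d) :=
  flift2 (fun s t => fgen k (usum s t)).

Lemma ncat_gen (x y : DeltaSp) (s : usimp x d) (t : usimp y d) :
  ncat (fgen k s) (fgen k t) = fgen k (usum s t).
Proof. exact: flift2_gen. Qed.

Lemma ncat_act (x x' y y' : DeltaSp) (f : hom x x') (f' : hom y y') n n' :
  ncat (ractl (nerve k DeltaSp) d f n) (ractl (nerve k DeltaSp) d f' n') =
    @ractl k DeltaSp _ (nerve k DeltaSp) d (x + y)%N (x' + y')%N (ssum f f')
      (ncat n n').
Proof.
pose G (z w : DeltaSp) (s : usimp z d) (t : usimp w d) := fgen k (usum s t).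
pose R := @ractl k DeltaSp _ (nerve k DeltaSp) d (x + y)%N (x' + y')%N (ssum f f').
move: n; apply: (free_ext
  (f := flift (fun s => flift (@G x y s) (ractl (nerve k DeltaSp) d f' n'))
        \o ractl (nerve k DeltaSp) d f)
  (g := R \o flift (fun s => flift (@G x' y' s) n'))) => s /=.
rewrite nerve_mapE !flift_gen; move: n'; apply: (free_ext
  (f := flift (@G x y (usimp_act f (did d) s)) \o ractl (nerve k DeltaSp) d f')
  (g := R \o flift (@G x' y' s))) => t /=.
rewrite nerve_mapE !flift_gen /R nerve_mapE; congr fgen.
apply: (@usimp_eq DeltaSp (x + y)%N d
  (usum (usimp_act f (did d) s) (usimp_act f' (did d) t))
  (@usimp_act DeltaSp (x' + y')%N (x + y)%N d d (ssum f f') (did d) (usum s t))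
  erefl) => // i.
exact: ssum_cmp.
Qed.

Lemma tcat_act (x x' y y' : DeltaSp) (f : hom x x') (f' : hom y y')
   (m : bsymp A (x, d)) (m' : bsymp A (y, d)) :
  tcat (lactl (bsymp A) d f m : tpow (A d) _) (lactl (bsymp A) d f' m') =
    @lactl k DeltaSp _ (bsymp A) d (x + y)%N (x' + y')%N (ssum f f') (tcat m m').
Proof.
pose Ll a b v : {linear tpow (A d) a -> tpow (A d) (a + b)} :=
  HB.pack ((@tcat k (A d) a b)^~ v)
    (GRing.isLinear.Build k _ _ _ ((@tcat k (A d) a b)^~ v) (tcat_linl v)).
pose Lr a b u : {linear tpow (A d) b -> tpow (A d) (a + b)} :=
  HB.pack (@tcat k (A d) a b u)
    (GRing.isLinear.Build k _ _ _ (@tcat k (A d) a b u) (tcat_linr u)).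
pose R := @lactl k DeltaSp _ (bsymp A) d (x + y)%N (x' + y')%N (ssum f f').
move: m; apply: (pres_ext
  (f := Ll x' y' (lactl (bsymp A) d f' m') \o lactl (bsymp A) d f)
  (g := R \o Ll x y m')) => a /=.
rewrite bsym_map_tensor; move: m'; apply: (pres_ext
  (f := Lr x' y' (bsym_gen ((f, idm d) : @hom (prodcat DeltaSp _) (x, d) (x', d)) a)
        \o lactl (bsymp A) d f')
  (g := R \o Lr x y (tensor a))) => b /=.
rewrite bsym_map_tensor !tcat_tensor /R bsym_map_tensor; congr tensor.
apply: funext => j; rewrite /cat_fun /= ssumE /ssum_word.
case: (fintype.split j) => l; rewrite big_map; apply: eq_bigr => i _.
  by rewrite -[lshift _ _]/(unsplit (inl i)) unsplitK.
by rewrite -[rshift _ _]/(unsplit (inr i)) unsplitK.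
Qed.

Definition CA_idx := @ten_idx k DeltaSp _ (nerve k DeltaSp) (bsymp A) d.
Definition CA_rel := @ten_rel k DeltaSp _ (nerve k DeltaSp) (bsymp A) d.

Definition CA_ten (x : DeltaSp) : nerve k DeltaSp (x, d) -> bsymp A (x, d) -> CA d :=
  @ten k DeltaSp _ (nerve k DeltaSp) (bsymp A) d x.

Definition CA_gen (u v : CA_idx) : CA d :=
  CA_ten (ncat (projT2 u).1 (projT2 v).1) (tcat (projT2 u).2 (projT2 v).2).

Fact CA_gen_l v : respects CA_rel (CA_gen^~ v).
Proof.
have [Tl Tr Tb] := ten_balanced (nerve k DeltaSp) (bsymp A) d.
case: v => y [n' m'].
pose F (x : DeltaSp) (n : nerve k DeltaSp (x, d)) (m : bsymp A (x, d)) : CA d :=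
  @CA_ten (x + y)%N (ncat n n') (tcat m m').
apply: (@balanced_respects k DeltaSp _ (nerve k DeltaSp) (bsymp A) d _ F).
split=> [x m c n1 n2|x n c m1 m2|x x' f n m]; rewrite /F.
- by rewrite [ncat _ _]flift2_linl; apply: Tl.
- by rewrite [tcat _ _]tcat_linl; apply: Tr.
have e1 : ractl (nerve k DeltaSp) d (idm y) n' = n'.
  exact: (@cmap_id _ _ (nerve k DeltaSp) (y, d)).
have e2 : lactl (bsymp A) d (idm y) m' = m'.
  exact: (@cmap_id _ _ (bsymp A) (y, d)).
rewrite -{1}e1 ncat_act -{2}e2 tcat_act.
exact: Tb.
Qed.

Fact CA_gen_r u : respects CA_rel (CA_gen u).
Proof.
have [Tl Tr Tb] := ten_balanced (nerve k DeltaSp) (bsymp A) d.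
case: u => y [n' m'].
pose F (x : DeltaSp) (n : nerve k DeltaSp (x, d)) (m : bsymp A (x, d)) : CA d :=
  @CA_ten (y + x)%N (ncat n' n) (tcat m' m).
apply: (@balanced_respects k DeltaSp _ (nerve k DeltaSp) (bsymp A) d _ F).
split=> [x m c n1 n2|x n c m1 m2|x x' f n m]; rewrite /F.
- by rewrite [ncat _ _]flift2_linr; apply: Tl.
- by rewrite [tcat _ _]tcat_linr; apply: Tr.
have e1 : ractl (nerve k DeltaSp) d (idm y) n' = n'.
  exact: (@cmap_id _ _ (nerve k DeltaSp) (y, d)).
have e2 : lactl (bsymp A) d (idm y) m' = m'.
  exact: (@cmap_id _ _ (bsymp A) (y, d)).
rewrite -{1}e1 ncat_act -{2}e2 tcat_act.
exact: Tb.
Qed.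

Definition CA_mul : CA d -> CA d -> CA d := plift2 CA_gen_l CA_gen_r.

End Component.
End ProductC.

(* The unit of CA: the constant chain at the initial object, with coefficient 1 in
   B_sym,+ A (0) = k, the empty tensor. *)
Definition usimp_const (C : category) (x : C) (p : nat) : @usimp C x p :=
  @USimp C x p (fun=> x) (fun=> idm x) (fun _ _ _ => idm x) (fun _ _ => erefl)
    (fun _ _ _ _ _ _ => cmp1m (idm x)) (fun _ _ _ => cmp1m (idm x)).

Definition CA_one (k : fieldType) (A : salg k) (d : opcat Delta) : CA A d :=
  @CA_ten k A d 0%N (fgen k (@usimp_const DeltaSp 0%N d))
    (tensor (fun=> 1 : A d)).

(* Only the operations are recorded: for HS and HR the laws are theorems. *)
Record galg (k : fieldType) := GAlg {
  gcomp :> nat -> lmodType k;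
  gmul : forall p q : nat, gcomp p -> gcomp q -> gcomp (p + q)%N;
  gone : gcomp 0%N }.

Arguments gmul {k} g {p q}.
Arguments gone {k}.

Record galg_iso (k : fieldType) (G H : galg k) (f : forall n, G n -> H n) : Prop :=
  GAlgIso {
    giso_linear : forall n, linear (f n);
    giso_bij : forall n, bijective (f n);
    giso_mul : forall p q (u : G p) (v : G q),
      f (p + q)%N (gmul G u v) = gmul H (f p u) (f q v);
    giso_one : f 0%N (gone G) = gone H }.

Definition pi_alg (k : fieldType) (X : smod k)
    (mul : forall n : nat, X n -> X n -> X n) (one : X 0%N) : galg k :=
  @GAlg k (piS X) (fun p q => @pi_mul k X mul p q) (pclass one).

Section SymmetricHomology.
Context (k : fieldType) (A : salg k).

Definition pi_CA : galg k := @pi_alg k (CA A) (@CA_mul k A) (@CA_one k A 0%N).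

Definition HS_mod (n : nat) : lmodType k := piS (dtens (bsym A)) n.

(* An isomorphism, by a theorem of Ault. *)
Definition HS_CA (n : nat) : HS_mod n -> pi_CA n :=
  pi_map (@cmpr k DeltaSp nat S (bsymp A)) (n := n).

(* The algebra structure of pi_*(CA), transported along HS_CA: xget picks the
   preimage under HS_CA. *)
Definition HS : galg k :=
  @GAlg k HS_mod
    (fun p q u v => xget 0
       (fun w : HS_mod (p + q) => HS_CA w = gmul pi_CA (HS_CA u) (HS_CA v)))
    (xget 0 (fun w : HS_mod 0 => HS_CA w = gone pi_CA)).

End SymmetricHomology.

Definition HS_map (k : fieldType) (A B : salg k) (f : atrans A B) (n : nat) :
    HS A n -> HS B n :=
  pi_map (dtens_trans (bsym_trans f)) (n := n).

Definition weak_equivalence (k : fieldType) (A B : salg k) (f : atrans A B) : Prop :=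
  forall n : nat, bijective (pi_map (atrans_mod f) (n := n)).

(* A is the tensor algebra on the vector space with basis G. *)
Definition free_on (k : fieldType) (A : algebra k) (G : A -> Prop) : Prop :=
  forall (B : algebra k) (h : A -> B), exists f : algHom A B,
    (forall x, G x -> f x = h x) /\
    (forall g : algHom A B, (forall x, G x -> g x = h x) -> g =1 f).

Definition degen (k : fieldType) (A : salg k) (n : nat) (j : 'I_n.+1) :
    algHom (A n) (A n.+1) :=
  @amap k (opcat Delta) A n n.+1 (codegen j).

Definition semi_free (k : fieldType) (R : salg k) : Prop :=
  exists G : forall n : nat, R n -> Prop,
    (forall n : nat, free_on (G n)) /\
    (forall (n : nat) (j : 'I_n.+1) x, G n x -> G n.+1 (degen R j x)).

Record resolution (k : fieldType) (A : salg k) := Resolution {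
  res_alg : salg k;
  res_map : atrans res_alg A;
  res_weq : weak_equivalence res_map;
  res_free : semi_free res_alg }.

Definition HR (k : fieldType) (A : salg k) (R : resolution A) : galg k :=
  @pi_alg k (calg_mod (abC (res_alg R)))
    (fun n (x y : abC (res_alg R) n) => x * y) (1 : abC (res_alg R) 0%N).

(* The augmentation nerve k DeltaS -> k induces HS(R) -> HR, and xget inverts the
   isomorphism HS(R) -> HS(A) given by the weak equivalence R -> A. *)
Definition SR (k : fieldType) (A : salg k) (R : resolution A) (n : nat)
    (u : HS A n) : HR R n :=
  pi_map (ctrans_cmp (bsym_ab (res_alg R)) (dtens_ctens (bsym (res_alg R))))
    (xget 0 (fun r : HS (res_alg R) n => HS_map (res_map R) r = u)).

(* Main.v *)
From HB Require Import structures.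
From mathcomp Require Import all_boot all_algebra.
From mathcomp Require Import fingroup perm finmap.
From mathcomp Require Import boolp classical_sets functions.
From mathcomp Require Import zify.
From mathcomp.multinomials Require Import monalg.
Require Import Defs.

(* The idea is to avoid bisimplicial methods and to argue by dimension shifting: if a
   class of maps of simplicial modules is such that each of its members f fits in a ladder
   of short exact sequences whose middle map is a weak equivalence and whose left map is
   again in the class, then the five lemma proves by induction on the degree that all
   members are weak equivalences.  With the decalage sequence 0 -> M' -> Dec M -> M -> 0,
   which is split in each degree and whose middle term contracts onto the constant M_0,
   this reduces statements on the diagonal of N (x)_C M to the case where N or M is constant
   in the simplicial direction.
   - For N free in each degree, a pointwise weak equivalence M -> M' induces one on
     N (x)_C M.  Over a field this applies to tensor powers (with C the unit category) and
     then to the symmetric bar construction, so that R may replace A.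
   - For a free algebra T over a field of characteristic 0, the functor x |-> T^(x) on
     Delta S has a section of its free cover up to the shift x |-> 1 + x: a tensor of words
     is the image of the tensor of its letters under n! morphisms, which are averaged.  Such
     sections are inherited by syzygies, whence Tor_i(k, B_sym T) = 0 for i > 0 and the
     derived tensor product reduces to B_sym T's coinvariants T_ab.
   Both points hold for Delta S_+ as well, so that CA computes the same groups as HS; the
   product of CA maps to that of R_ab by naturality of the shuffle product. *)

Set Implicit Arguments.
Unset Strict Implicit.
Unset Printing Implicit Defensive.

Import GRing.Theory.

Local Open Scope ring_scope.

(** * Moore complexes and dimension shifting *)

(** The shift x |-> 1 + x is forced by empty words: a tensor whose words are all empty has no
    letters, and the empty object is missing from Delta S. An additional factor 1 makes the source 1
    + n nonempty. The section then lands over 1 + x and splits the free cover only up to eta : x ->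
    1 + x. A tensor product with the constant module k is balanced along eta, so the shift
    disappears exactly where the vanishing of Tor is needed. The average over n! morphisms is there
    because a tensor of words determines the sequence of its letters only up to a renumbering of the
    variables; summing over all renumberings removes the choice, and evaluation then multiplies by
    n!. Product and unit of HS are chosen preimages under [HS_CA], so the bijectivity of that map
    must be established along the way. For a degreewise free B, both HS and CA map to B_ab by weak
    equivalences that are compatible with [HS_CA], which settles B; the general case follows by
    naturality along B -> A. *)

Section Moore.
Context (k : fieldType).

Definition act (X : smod k) (m n : nat) (f : dhom m n) : {linear X n -> X m} :=
  @cmap k (opcat Delta) X n m f.

Lemma act_id (X : smod k) n x : act X (did n) x = x.
Proof. exact: (@cmap_id k (opcat Delta) X n). Qed.

Lemma act_cmp (X : smod k) a b c (g : dhom b c) (f : dhom a b) x :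
  act X (dcmp g f) x = act X f (act X g x).
Proof. exact: (@cmap_cmp k (opcat Delta) X c b a f g). Qed.

Lemma act_nat (X Y : smod k) (f : ctrans X Y) m n (g : dhom m n) x :
  f m (act X g x) = act Y g (f n x).
Proof. exact: (@ctr_nat k (opcat Delta) X Y f n m g). Qed.

Lemma face_nat (X Y : smod k) (f : ctrans X Y) n (i : 'I_n.+2) x :
  f n (face X i x) = face Y i (f n.+1 x).
Proof. exact: act_nat. Qed.

Definition moore (X : smod k) (n : nat) : X n -> Prop :=
  match n return X n -> Prop with
  | 0 => fun=> True
  | m.+1 => fun x => forall i : 'I_m.+2, i != ord0 -> face X i x = 0
  end.

Definition boundary (X : smod k) (n : nat) (x : X n) : Prop :=
  exists2 y : X n.+1, moore y & face X ord0 y = x.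

Lemma moore_lin (X : smod k) n c (x y : X n) :
  moore x -> moore y -> moore (c *: x + y).
Proof.
by case: n x y => // n x y hx hy i i0; rewrite linearP hx ?hy ?scaler0 ?addr0.
Qed.

Lemma cycle_lin (X : smod k) n c (x y : X n) :
  is_cycle x -> is_cycle y -> is_cycle (c *: x + y).
Proof.
by case: n x y => // n x y hx hy i; rewrite linearP hx ?hy ?scaler0 ?addr0.
Qed.

Lemma cycle0 (X : smod k) n : is_cycle (0 : X n).
Proof. by case: n => // n i; rewrite linear0. Qed.

Lemma moore0 (X : smod k) n : moore (0 : X n).
Proof. by case: n => // n i _; rewrite linear0. Qed.

Lemma cycleB (X : smod k) n (x y : X n) :
  is_cycle x -> is_cycle y -> is_cycle (x - y).
Proof. by move=> hx hy; rewrite addrC -scaleN1r; apply: cycle_lin. Qed.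

Lemma cycleD (X : smod k) n (x y : X n) :
  is_cycle x -> is_cycle y -> is_cycle (x + y).
Proof. by move=> hx hy; rewrite -[x]scale1r; apply: cycle_lin. Qed.

Lemma mooreB (X : smod k) n (x y : X n) :
  moore x -> moore y -> moore (x - y).
Proof. by move=> hx hy; rewrite addrC -scaleN1r; apply: moore_lin. Qed.

Lemma mooreD (X : smod k) n (x y : X n) :
  moore x -> moore y -> moore (x + y).
Proof. by move=> hx hy; rewrite -[x]scale1r; apply: moore_lin. Qed.

Lemma boundary_lin (X : smod k) n c (x y : X n) :
  boundary x -> boundary y -> boundary (c *: x + y).
Proof.
move=> [u hu <-] [v hv <-]; exists (c *: u + v); first exact: moore_lin.
exact: linearP.
Qed.

Lemma boundary0 (X : smod k) n : boundary (0 : X n).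
Proof. by exists 0; [exact: moore0|rewrite linear0]. Qed.

Lemma boundaryD (X : smod k) n (x y : X n) :
  boundary x -> boundary y -> boundary (x + y).
Proof. by move=> hx hy; rewrite -[x]scale1r; apply: boundary_lin. Qed.

Lemma cycle_moore (X : smod k) n (x : X n) : is_cycle x -> moore x.
Proof. by case: n x => // n x hx i _; apply: hx. Qed.

Lemma moore_cycle (X : smod k) n (x : X n.+1) :
  moore x -> face X ord0 x = 0 -> is_cycle x.
Proof. by move=> hx h0 i; have [->|/hx] := eqVneq i ord0. Qed.

Lemma moore_map (X Y : smod k) (f : ctrans X Y) n (x : X n) :
  moore x -> moore (f n x).
Proof.
case: n x => // n x hx i i0.
by rewrite -face_nat hx // linear0.
Qed.

Lemma cycle_map (X Y : smod k) (f : ctrans X Y) n (x : X n) :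
  is_cycle x -> is_cycle (f n x).
Proof.
by case: n x => // n x hx i; rewrite -face_nat hx linear0.
Qed.

Lemma boundary_map (X Y : smod k) (f : ctrans X Y) n (x : X n) :
  boundary x -> boundary (f n x).
Proof.
move=> [y hy <-]; exists (f n.+1 y); first exact: moore_map.
by rewrite -face_nat.
Qed.

Lemma coface_coface n (i : 'I_n.+3) (j : 'I_n.+2) (i' : 'I_n.+2) (j' : 'I_n.+3) :
  (j < i)%N -> i' = i.-1 :> nat -> j' = j :> nat ->
  dcmp (coface i) (coface j) = dcmp (coface j') (coface i').
Proof.
move=> ji i'E j'E; apply: dhom_eq => a; apply: val_inj => /=.
by rewrite i'E j'E; move: ji; rewrite /bump; lia.
Qed.

Lemma face_face (X : smod k) n (i : 'I_n.+3) (j : 'I_n.+2) (i' : 'I_n.+2)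
    (j' : 'I_n.+3) x :
  (j < i)%N -> i' = i.-1 :> nat -> j' = j :> nat ->
  face X j (face X i x) = face X i' (face X j' x).
Proof.
by move=> ji e1 e2; rewrite /face -!/(act X _) -!act_cmp (coface_coface ji e1 e2).
Qed.

(** The identity d_i d_0 = d_0 d_(i+1): the Moore differential squares to zero. *)
Lemma face0_cycle (X : smod k) n (x : X n.+1) : moore x -> is_cycle (face X ord0 x).
Proof.
case: n x => // n x hx i.
rewrite -(@face_face _ _ (lift ord0 i) ord0 i ord0) ?lift0 //.
by rewrite hx ?linear0 // -val_eqE.
Qed.

Lemma cycle_class (X : smod k) n (x : X n) :
  is_cycle x -> exists z : cycle X n, cyc z = x.
Proof. by move=> hx; exists (Cycle (asboolT hx)). Qed.

Lemma cycle_is (X : smod k) n (z : cycle X n) : is_cycle (cyc z).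
Proof. by case: z => x /= /asboolP. Qed.

Lemma is_bndE (X : smod k) n (z : cycle X n) : is_bnd z <-> boundary (cyc z).
Proof. by split=> -[y hy yz]; exists y. Qed.

(** [piS] divides by a span; boundaries are already closed under linear combinations, so the span
    adds nothing. *)
Lemma span_bndE (X : smod k) n (z : cycle X n) : span (@is_bnd k X n) z <-> boundary (cyc z).
Proof.
split=> [|/is_bndE h]; last exact: (@span_in k _ (@is_bnd k X n) z h).
elim=> [|c x y /is_bndE hx _ hy]; first exact: boundary0.
exact: boundary_lin.
Qed.

Lemma pclass_eq (X : smod k) n (x y : X n) :
  is_cycle x -> is_cycle y -> pclass x = pclass y <-> boundary (x - y).
Proof.
move=> hx hy; rewrite /pclass; split=> [/qpi_eq/span_bndE|h].
  by rewrite /= !insubdK //; apply/asboolP.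
by apply/qpi_eq/span_bndE; rewrite /= !insubdK //; apply/asboolP.
Qed.

Lemma pclass_qpi (X : smod k) n (z : cycle X n) : pclass (cyc z) = qpi _ z.
Proof. by rewrite /pclass valKd. Qed.

Lemma prepr_cycle (X : smod k) n (u : piS X n) : is_cycle (prepr u).
Proof. exact: cycle_is. Qed.

Lemma preprK (X : smod k) n (u : piS X n) : pclass (prepr u) = u.
Proof. by rewrite pclass_qpi qreprK. Qed.

Lemma pi_map_class (X Y : smod k) (f : ctrans X Y) n (x : X n) :
  is_cycle x -> pi_map f (pclass x) = pclass (f n x).
Proof.
move=> /cycle_class[z <-]; rewrite pclass_qpi /pi_map qlift_pi /=.
by rewrite -pclass_qpi.
Qed.

Definition weq (X Y : smod k) (f : ctrans X Y) : Prop :=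
  forall n : nat, bijective (pi_map f (n := n)).

Definition homology_inj (X Y : smod k) (f : ctrans X Y) n : Prop :=
  forall x : X n, is_cycle x -> boundary (f n x) -> boundary x.

Definition homology_surj (X Y : smod k) (f : ctrans X Y) n : Prop :=
  forall y : Y n, is_cycle y -> exists2 x : X n, is_cycle x & boundary (y - f n x).

(** Trades quotients for statements on cycles and boundaries, the form in which all diagram chases
    below are carried out. *)
Lemma weqP (X Y : smod k) (f : ctrans X Y) :
  weq f <-> forall n, homology_inj f n /\ homology_surj f n.
Proof.
split=> [fw n|fw n].
  have [g fK gK] := fw n; split=> [x hx fx|y hy].
    have : pi_map f (pclass x) = pi_map f (pclass 0).
      rewrite !pi_map_class //; last exact: cycle0.
      apply/pclass_eq; [exact: cycle_map|exact/cycle_map/cycle0|].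
    by rewrite linear0 subr0.
    move/(can_inj fK)/(pclass_eq hx (cycle0 _ _)); by rewrite subr0.
  have hg := prepr_cycle (g (pclass y)).
  exists (prepr (g (pclass y))) => //; apply/pclass_eq => //.
    exact: cycle_map.
  by rewrite -pi_map_class // preprK gK.
have [finj fsurj] := fw n.
have fI : injective (pi_map f (n := n)).
  move=> u v; rewrite -[u]preprK -[v]preprK !pi_map_class; do ?exact: prepr_cycle.
  move/(pclass_eq (cycle_map _ (prepr_cycle _)) (cycle_map _ (prepr_cycle _))).
  rewrite -linearB /= => /finj h; apply/pclass_eq; do ?exact: prepr_cycle.
  by apply: h; apply: cycleB; apply: prepr_cycle.
have fS (v : piS Y n) : exists u, pi_map f u = v.
  have [x hx hv] := fsurj _ (prepr_cycle v).
  exists (pclass x); rewrite pi_map_class // -[RHS]preprK; apply/esym/pclass_eq => //.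
    exact: prepr_cycle.
  exact: cycle_map.
have [g gK] := choice fS.
by exists g => // u; apply: fI; rewrite gK.
Qed.

Lemma pi_map_cmp (X Y Z : smod k) (g : ctrans Y Z) (f : ctrans X Y) n u :
  pi_map (ctrans_cmp g f) u = pi_map g (pi_map (n := n) f u).
Proof.
rewrite -[u]preprK !pi_map_class //; do ?exact: prepr_cycle.
exact: cycle_map (prepr_cycle _).
Qed.

Lemma eq_pi_map (X Y : smod k) (f g : ctrans X Y) n :
  (forall x, f n x = g n x) -> pi_map f (n := n) =1 pi_map g (n := n).
Proof.
by move=> fg u; rewrite -[u]preprK !pi_map_class ?fg //; exact: prepr_cycle.
Qed.

Section TwoOfThree.
Context (X Y Z : smod k) (f : ctrans X Y) (g : ctrans Y Z) (h : ctrans X Z).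
Hypothesis gf : forall n x, g n (f n x) = h n x.

Let gfE n : pi_map h (n := n) =1 pi_map g (n := n) \o pi_map f (n := n).
Proof. by move=> u; rewrite /= -pi_map_cmp; apply: eq_pi_map => x /=; rewrite gf. Qed.

Lemma weq_comp : weq f -> weq g -> weq h.
Proof.
move=> fw gw n; apply: (@eq_bij _ _ (pi_map g (n := n) \o pi_map f (n := n))).
  exact: bij_comp.
exact: fsym.
Qed.

Lemma weq_left : weq f -> weq h -> weq g.
Proof.
move=> fw hw n; have [f' fK f'K] := fw n.
apply: (@eq_bij _ _ (pi_map h (n := n) \o f')).
  by apply: bij_comp => //; exists (pi_map f (n := n)).
by move=> v /=; rewrite gfE /= f'K.
Qed.

Lemma weq_right : weq g -> weq h -> weq f.
Proof.
move=> gw hw n; have [g' gK g'K] := gw n.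
apply: (@eq_bij _ _ (g' \o pi_map h (n := n))).
  by apply: bij_comp => //; exists (pi_map g (n := n)).
by move=> v /=; rewrite gfE /= gK.
Qed.
End TwoOfThree.

Lemma weq_retract (X Y X' Y' : smod k) (f : ctrans X Y) (f' : ctrans X' Y')
    (i : ctrans X' X) (r : ctrans X X') (j : ctrans Y' Y) (s : ctrans Y Y') :
  (forall n x, r n (i n x) = x) -> (forall n y, s n (j n y) = y) ->
  (forall n x, f n (i n x) = j n (f' n x)) ->
  (forall n x, f' n (r n x) = s n (f n x)) ->
  weq f -> weq f'.
Proof.
move=> ri sj fi fr /weqP fw; apply/weqP => n; have [finj fsurj] := fw n.
split=> [x hx hb|y hy].
  rewrite -(ri n x); apply/boundary_map/finj; first exact: cycle_map.
  by rewrite fi; apply: boundary_map.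
have [x hx hb] := fsurj _ (cycle_map j hy); exists (r n x); first exact: cycle_map.
by have := boundary_map s hb; rewrite linearB /= sj fr.
Qed.

Lemma weq_bij (X Y : smod k) (f : ctrans X Y) :
  (forall n, bijective (f n)) -> weq f.
Proof.
move=> fb; apply/weqP => n.
have inv m (x : X m) : f m x = 0 -> x = 0.
  by move=> h; apply: (bij_inj (fb m)); rewrite linear0.
have cyc_inv m (x : X m) : is_cycle (f m x) -> is_cycle x.
  case: m x => // m x hx i; apply: inv; rewrite face_nat; exact: hx.
split=> [x hx [y hy yE]|y hy].
  have [g _ gK] := fb n.+1; exists (g y).
    by move=> i i0; apply: inv; rewrite face_nat gK hy.
  by apply: (bij_inj (fb n)); rewrite face_nat gK.
have [g _ gK] := fb n; exists (g y); first by apply: cyc_inv; rewrite gK.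
by rewrite gK subrr; apply: boundary0.
Qed.

Definition exact_seq (X Y Z : smod k) (i : ctrans X Y) (p : ctrans Y Z) : Prop :=
  forall n, [/\ injective (i n), forall x, p n (i n x) = 0,
    forall y, p n y = 0 -> exists x, i n x = y & forall z, exists y, p n y = z].

(** The faces of a lift y are killed from the last one down to d_1, by subtracting s_(i-1) d_i y.
    This preserves the vanishing of the higher faces, and the image z as well because d_i z = 0. *)
Lemma moore_lift (Y Z : smod k) (p : ctrans Y Z) :
  (forall n z, exists y, p n y = z) ->
  forall n (z : Z n), moore z -> exists2 y, moore y & p n y = z.
Proof.
move=> ps [|n] z hz; first by have [y] := ps _ z; exists y.
suff H m : (m <= n.+1)%N -> exists2 y, forall i : 'I_n.+2, (n.+1 - m < i)%N -> face Y i y = 0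
    & p n.+1 y = z.
  have [y hy yz] := H _ (leqnn _); exists y => // i i0; apply: hy.
  by rewrite subnn lt0n.
elim: m => [|m IH] mn.
  by have [y yz] := ps _ z; exists y => // -[i hi]; rewrite subn0 /=; lia.
have [y hy yz] := IH (ltnW mn).
have lti : (n.+1 - m < n.+2)%N by lia.
have ltj : (n.+1 - m.+1 < n.+1)%N by lia.
pose i : 'I_n.+2 := Ordinal lti; pose j : 'I_n.+1 := Ordinal ltj.
exists (y - act Y (codegen j) (face Y i y)); last first.
  rewrite linearB /= act_nat face_nat yz hz ?linear0 ?oppr0 ?addr0 ?subr0 //.
  by rewrite -val_eqE /=; lia.
move=> l hl; rewrite linearB /=.
have [->|li] := eqVneq l i.
  rewrite {2}/face -/(act Y _) -act_cmp.
  have -> : dcmp (codegen j) (coface i) = did n.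
    by apply: dhom_eq => a; apply: val_inj; rewrite /= /bump /unbump /=; lia.
  by rewrite act_id subrr.
have {li}hl : (n.+1 - m < l)%N.
  by move: li hl; rewrite -val_eqE /=; lia.
rewrite (hy l) // sub0r.
case: n z hz m mn y hy yz lti ltj @i @j l hl {IH} => [|n] z hz m mn y hy yz lti ltj i j l hl.
  by case: l hl => /=; lia.
have ltl' : (l.-1 < n.+2)%N by move: (ltn_ord l); lia.
have lti' : (n.+2 - m < n.+2)%N by move: (ltn_ord l); lia.
have ltj' : (n.+2 - m.+1 < n.+1)%N by move: (ltn_ord l); lia.
have -> : face Y l (act Y (codegen j) (face Y i y)) =
  act Y (codegen (Ordinal ltj')) (face Y (Ordinal lti') (face Y l y)).
  rewrite /face -!/(act Y _) -!act_cmp; congr (act Y _ y).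
  apply: dhom_eq => a; apply: val_inj; rewrite /= /bump /unbump /=; lia.
by rewrite (hy l) // !linear0.
Qed.

(** * The five lemma for a ladder of short exact sequences *)

Section Ladder.
Context (U1 U V1 V X Y : smod k).
Context (f1 : ctrans U1 V1) (g : ctrans X Y) (f : ctrans U V).
Context (i : ctrans U1 X) (p : ctrans X U) (j : ctrans V1 Y) (q : ctrans Y V).
Hypotheses (ip : exact_seq i p) (jq : exact_seq j q) (gw : weq g).
Hypothesis gi : forall n x, g n (i n x) = j n (f1 n x).
Hypothesis qg : forall n x, q n (g n x) = f n (p n x).

Let p_surj n z : exists y, p n y = z. Proof. by case: (ip n). Qed.
Let q_surj n z : exists y, q n y = z. Proof. by case: (jq n). Qed.

Lemma kernel_moore (A B C : smod k) (a : ctrans A B) (b : ctrans B C) n y :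
  exact_seq a b -> moore y -> b n y = 0 -> exists2 x, moore x & a n x = y.
Proof.
move=> ab hy /(let: And4 _ _ h _ := ab n in h) [x xE]; exists x => //.
case: n x y xE hy => // n x y xE hy l l0.
by case: (ab n) => ainj _ _ _; apply: ainj; rewrite face_nat xE hy // linear0.
Qed.

Lemma kernel_cycle (A B C : smod k) (a : ctrans A B) (b : ctrans B C) n x :
  exact_seq a b -> is_cycle (a n x) -> is_cycle x.
Proof.
move=> ab; case: n x => // n x hy l.
by case: (ab n) => ainj _ _ _; apply: ainj; rewrite face_nat hy // linear0.
Qed.

(** The zig-zag behind the connecting homomorphism: z lifts to a Moore element y, and d_0 y comes
    from the kernel. *)
Lemma connecting (A B C : smod k) (a : ctrans A B) (b : ctrans B C) n (z : C n.+1) :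
  exact_seq a b -> is_cycle z -> exists y x,
  [/\ moore y, b _ y = z, is_cycle x & a n x = face B ord0 y].
Proof.
move=> ab hz; have [y hy yz] := @moore_lift _ _ b (fun n => let: And4 _ _ _ h := ab n in h)
  _ _ (cycle_moore hz).
case: (ab n) => ainj ab0 /(_ (face B ord0 y)) []; first by rewrite face_nat yz; apply: hz.
move=> x xE _; exists y, x; split=> //.
by apply: (kernel_cycle ab); rewrite xE; apply: face0_cycle.
Qed.

(** First half of the five lemma. The obstruction to lifting w to a cycle lies in degree n - 1 of
    V1; it is corrected by surjectivity of [f1] and bounded in X by injectivity of [g] there. *)
Lemma ladder_surj n : (forall m, (m < n)%N -> homology_surj f1 m) -> homology_surj f n.
Proof.
move=> f1s w hw; have /weqP gw' := gw; have [_ gs] := gw' n.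
(* Here [y] lifts [w] and [g x] corrects its boundary. In degree 0 everything is a cycle, and x = 0
   will do. *)
suff [y [x [hy qy hx]]] : exists y x, [/\ is_cycle (y - g n x), q n y = w & is_cycle (p n x)].
  have [x' hx' [b hb bE]] := gs _ hy.
  exists (p n (x + x')); first by rewrite linearD /=; apply: cycleD => //; apply: cycle_map.
  exists (q _ b); first exact: moore_map.
  by rewrite -face_nat bE !linearB /= qy !qg linearD linearD opprD addrA.
case: n w hw f1s gs => [|n] w hw f1s gs.
  by have [y yw] := q_surj w; exists y, 0; split => //; rewrite linear0.
have [y [v [hy qy hv jv]]] := connecting jq hw.
have [u hu [b hb bE]] := f1s n (leqnn _) v hv.
have [ginj _] := gw' n.
have [x hx xE] : boundary (i n u).
  apply: ginj; first exact: cycle_map.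
  exists (y - j _ b); first by apply: mooreB => //; apply: moore_map.
  by rewrite linearB /= -face_nat bE -jv gi linearB /= opprB addrCA subrr addr0.
exists (y - j _ b), x; split.
- apply: moore_cycle.
    by apply: mooreB; [apply: mooreB => //|]; apply: moore_map.
  rewrite !linearB /= -!face_nat bE xE -jv gi linearB opprB /=.
  by rewrite addrCA subrr addr0 subrr.
- by rewrite linearB /= qy; case: (jq n.+1) => _ -> _ _; rewrite subr0.
- apply: moore_cycle; first exact: moore_map.
  by rewrite -face_nat xE; case: (ip n).
Qed.

(** Second half. Injectivity of [f1] in degree n - 1 lets u lift to a cycle x; surjectivity of [f1]
    in the same degree n corrects x by an element of U1 until [g] sends it to a boundary. *)
Lemma ladder_inj n : homology_surj f1 n -> (forall m, (m < n)%N -> homology_inj f1 m) ->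
  homology_inj f n.
Proof.
move=> f1s f1i u hu [v hv vE]; have /weqP gw' := gw; have [ginj gs] := gw' n.
have [y hy yv] := moore_lift q_surj hv.
suff [x [hx xu]] : exists x, is_cycle x /\ p n x = u.
  have [v1 hv1 v1E] : exists2 v1, moore v1 & j n v1 = g n x - face Y ord0 y.
    apply: (kernel_moore jq).
      apply: mooreB; first by apply/moore_map/cycle_moore.
      exact/cycle_moore/face0_cycle.
    by rewrite linearB /= qg xu face_nat yv vE subrr.
  have cv1 : is_cycle v1.
    apply: (kernel_cycle jq); rewrite v1E.
    by apply: cycleB; [apply: cycle_map|apply: face0_cycle].
  have [a ha [b hb bE]] := f1s _ cv1.
  have [x2 hx2 x2E] : boundary (x - i n a).
    apply: ginj; first by apply: cycleB => //; apply: cycle_map.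
    exists (y + j _ b); first by apply: mooreD => //; apply: moore_map.
    rewrite linearD linearB /= gi -face_nat bE linearB /= v1E.
    by rewrite [g n x - _ - _]addrAC [LHS]addrC subrK.
  exists (p _ x2); first exact: moore_map.
  by rewrite -face_nat x2E linearB /= xu; case: (ip n) => _ -> _ _; rewrite subr0.
case: n u hu v hv vE f1s f1i ginj gs y hy yv => [|n] u hu v hv vE f1s f1i ginj gs y hy yv.
  by have [x xu] := p_surj u; exists x.
have [x [u1 [hx xu hu1 u1E]]] := connecting ip hu.
have [v1 hv1 v1E] : exists2 v1, moore v1 & j n.+1 v1 = g _ x - face Y ord0 y.
  apply: (kernel_moore jq).
    apply: mooreB; first exact/moore_map.
    exact/cycle_moore/face0_cycle.
  by rewrite linearB /= qg xu face_nat yv vE subrr.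
have [a ha aE] : boundary u1.
  apply: (f1i n) => //; exists v1 => //.
  case: (jq n) => jinj _ _ _; apply: jinj.
  rewrite face_nat v1E -gi u1E linearB /= -face_nat.
  by rewrite (face0_cycle hy) subr0.
exists (x - i _ a); split.
  apply: moore_cycle; first by apply: mooreB => //; apply: moore_map.
  by rewrite linearB /= -face_nat aE u1E subrr.
by rewrite linearB /= xu; case: (ip n.+1) => _ -> _ _; rewrite subr0.
Qed.
End Ladder.

(* Dimension shifting: the five lemma, applied to the ladder of f, deduces the
   degree n part of the claim for f from the degree n - 1 part for f1. *)
Lemma dimension_shift (P : forall U V : smod k, ctrans U V -> Prop) :
  (forall U V (f : ctrans U V), P U V f ->
     exists U1 V1 X Y (f1 : ctrans U1 V1) (g : ctrans X Y) (i : ctrans U1 X)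
       (p : ctrans X U) (j : ctrans V1 Y) (q : ctrans Y V),
     [/\ P U1 V1 f1, weq g, exact_seq i p, exact_seq j q &
       (forall n x, g n (i n x) = j n (f1 n x)) /\
       (forall n x, q n (g n x) = f n (p n x))]) ->
  forall U V (f : ctrans U V), P U V f -> weq f.
Proof.
move=> H.
(* Surjectivity comes first, in all degrees and for the whole class: injectivity in degree n uses
   surjectivity of [f1] in that same degree. *)
have Hs n : forall U V (f : ctrans U V), P U V f -> homology_surj f n.
  elim/ltn_ind: n => n IH U V f /H[U1 [V1 [X [Y [f1 [g [i [p [j [q]]]]]]]]]].
  case=> Pf1 gw ip jq [gi qg]; apply: (ladder_surj ip jq gw gi qg) => m mn.
  exact: IH.
have Hi n : forall U V (f : ctrans U V), P U V f -> homology_inj f n.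
  elim/ltn_ind: n => n IH U V f /H[U1 [V1 [X [Y [f1 [g [i [p [j [q]]]]]]]]]].
  case=> Pf1 gw ip jq [gi qg]; apply: (ladder_inj ip jq gw gi qg) => [|m mn].
    exact: Hs.
  exact: IH.
by move=> U V f Pf; apply/weqP => n; split; [apply: Hi|apply: Hs].
Qed.

Definition discrete (Y : smod k) : Prop :=
  forall m n (f g : dhom m n), act Y f =1 act Y g.

(** Every endomorphism of [n+1] acts as the identity, so y = s d y for any degeneracy s and any face
    d. *)
Lemma discrete_cycle (Y : smod k) n (y : Y n.+1) : discrete Y ->
  face Y ord_max y = 0 -> y = 0.
Proof.
move=> dY y0; rewrite -[y]act_id (dY _ _ _ (dcmp (coface ord_max) (codegen ord0))).
by rewrite act_cmp [act Y (coface _) y]y0 linear0.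
Qed.

(** A cycle x is d_0 of [h x], whose other faces vanish by d_(i+1) h = h d_i. In degree 0 the
    remaining face of [h x] is t (e x); if e x bounds, it is zero, since a discrete Y has no nonzero
    Moore element in degree 1. *)
Lemma extra_degeneracy (X Y : smod k) (e : ctrans X Y)
    (h : forall n, X n -> X n.+1) (t : Y 0%N -> X 0%N) :
  discrete Y -> (forall n, h n 0 = 0) -> t 0 = 0 ->
  (forall n x, face X ord0 (h n x) = x) ->
  (forall n (i : 'I_n.+2) x, face X (lift ord0 i) (h n.+1 x) = h n (face X i x)) ->
  (forall x, face X ord_max (h 0%N x) = t (e 0%N x)) ->
  (forall y, e 0%N (t y) = y) -> weq e.
Proof.
move=> dY h0 t0 hd hs ht et; apply/weqP => -[|n]; split=> [x hx hb|y hy].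
- exists (h _ x) => //; move=> i i0.
  have -> : i = ord_max.
    by apply: val_inj; move: i0; rewrite -val_eqE /=; case: i => -[|[]].
  rewrite ht; case: hb => y hy yE.
  by rewrite -yE (discrete_cycle dY (hy ord_max isT)) linear0 t0.
- by exists (t y) => //; rewrite et subrr; apply: boundary0.
- exists (h _ x) => // i; case: (unliftP ord0 i) => [l ->|->] // _.
  by rewrite hs hx h0.
- exists 0; first exact: cycle0.
  by rewrite (discrete_cycle dY (hy ord_max)) linear0 subr0; apply: boundary0.
Qed.
End Moore.

(** * Simplicial modules over a category *)

Section Kernel.
Context (k : fieldType) (V W : lmodType k) (f : {linear V -> W}).

Definition kerb : {pred V} := fun x => f x == 0.

Fact kerb_submod : submod_closed kerb.
Proof.
split=> [|c x y /eqP hx /eqP hy]; apply/eqP; first exact: linear0.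
by rewrite linearP hx hy scaler0 addr0.
Qed.

HB.instance Definition _ := GRing.isSubmodClosed.Build k V kerb kerb_submod.

Record kerm := Kerm { kval :> V; _ : kval \in kerb }.

HB.instance Definition _ := [isSub of kerm for kval].
HB.instance Definition _ := [Choice of kerm by <:].
HB.instance Definition _ := [SubChoice_isSubLmodule of kerm by <:].

Fact kval_linear : linear kval.
Proof. by move=> c x y; exact: (linearP (\val : kerm -> V)). Qed.
HB.instance Definition _ := GRing.isLinear.Build k kerm V _ kval kval_linear.

Lemma kval0 (x : kerm) : f (kval x) = 0.
Proof. by case: x => x /= /eqP. Qed.

Section Lift.
Context (U : lmodType k) (g : {linear U -> V}).
Hypothesis fg : forall x, f (g x) = 0.

Definition klift (x : U) : kerm := Kerm (introT eqP (fg x) : g x \in kerb).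
Fact klift_linear : linear klift.
Proof. by move=> c x y; apply: val_inj; rewrite /= linearP. Qed.
HB.instance Definition _ := GRing.isLinear.Build k U kerm _ klift klift_linear.
End Lift.
End Kernel.

Section Constructions.
Context (k : fieldType).

Section Ker.
Context (C : category) (M M' : cmod k C) (p : ctrans M M').

Fact kmap_subproof a b (f : hom a b) (x : kerm (p a)) :
  p b ((cmap M f \o @kval _ _ _ (p a)) x) = 0.
Proof. by rewrite /= ctr_nat kval0 linear0. Qed.

Definition kmap a b (f : hom a b) : {linear kerm (p a) -> kerm (p b)} :=
  klift (kmap_subproof f).

Definition cker : cmod k C.
Proof.
refine (@CMod k C (fun a => kerm (p a) : lmodType k) kmap _ _).
- by move=> a x; apply: val_inj; rewrite /= cmap_id.
- by move=> a b c g f x; apply: val_inj; rewrite /= cmap_cmp.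
Defined.

Definition cker_incl : ctrans cker M :=
  @CTrans k C cker M (fun a => @kval _ _ _ (p a)) (fun a b f x => erefl).
End Ker.

Section Slices.
Context (C D : category).

Definition evx (M : cmod k (prodcat C D)) (x : C) : cmod k D.
Proof.
refine (@CMod k D (fun d => M (x, d)) (fun a b f => @cmap k _ M (x, a) (x, b) (idm x, f)) _ _).
- by move=> d m; apply: (@cmap_id _ _ M (x, d)).
- by move=> a b c g f m; rewrite -cmap_cmp idm_cmp.
Defined.

Definition evx_trans (M M' : cmod k (prodcat C D)) (f : ctrans M M') (x : C) :
  ctrans (evx M x) (evx M' x) :=
  @CTrans k D (evx M x) (evx M' x) (fun d => f (x, d))
    (fun a b g m => @ctr_nat _ _ _ _ f (x, a) (x, b) (idm x, g) m).

Definition lev (M : cmod k (prodcat C D)) (d : D) : cmod k C.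
Proof.
refine (@CMod k C (fun x => M (x, d)) (fun a b f => @cmap k _ M (a, d) (b, d) (f, idm d)) _ _).
- by move=> x m; apply: (@cmap_id _ _ M (x, d)).
- by move=> a b c g f m; rewrite -cmap_cmp /cmp /= cmp1m.
Defined.

Definition cst (L : cmod k C) : cmod k (prodcat C D) :=
  @CMod k (prodcat C D) (fun a => L a.1) (fun a b f => cmap L f.1)
    (fun a x => cmap_id x) (fun a b c g f x => cmap_cmp g.1 f.1 x).

Definition cst_trans (L L' : cmod k C) (f : ctrans L L') : ctrans (cst L) (cst L') :=
  @CTrans k (prodcat C D) (cst L) (cst L') (fun a => f a.1)
    (fun a b g m => ctr_nat f g.1 m).
End Slices.

Section TensorFunction.
Context (C D : category) (N N' : cmod k (prodcat (opcat C) D)).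
Context (M M' : cmod k (prodcat C D)) (d d' : D).
Context (phi : forall x, {linear N (x, d) -> N' (x, d')}).
Context (psi : forall x, {linear M (x, d) -> M' (x, d')}).
Hypothesis phiN : forall (x y : C) (f : hom x y) n,
  phi x (ractl N d f n) = ractl N' d' f (phi y n).
Hypothesis psiN : forall (x y : C) (f : hom x y) m,
  psi y (lactl M d f m) = lactl M' d' f (psi x m).

Definition tenf_gen (x : C) (n : N (x, d)) (m : M (x, d)) : ten_ob N' M' d' :=
  ten (phi x n) (psi x m).

Fact tenf_balanced : balanced tenf_gen.
Proof.
have [Tl Tr Tb] := ten_balanced N' M' d'.
split=> [x m c n n'|x n c m m'|x y f n m]; rewrite /tenf_gen.
- by rewrite linearP; apply: Tl.
- by rewrite linearP; apply: Tr.
by rewrite phiN psiN; apply: Tb.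
Qed.

(** In contrast to [tens_trans], the two families are natural in C only and may change the degree.
    This is the kind of map that extra degeneracies and degreewise splittings provide. *)
Definition tenf : ten_ob N M d -> ten_ob N' M' d' := plift (balanced_respects tenf_balanced).
HB.instance Definition _ := GRing.Linear.on tenf.

Lemma tenfE x n m : tenf (@ten _ _ _ N M d x n m) = ten (phi x n) (psi x m).
Proof. exact: plift_gen. Qed.
End TensorFunction.

End Constructions.

Section SimplicialModules.
Context (k : fieldType) (C : category).
Implicit Types M N : cmod k (prodcat C (opcat Delta)).

Definition hact M (x y : C) (m n : nat) (f : hom x y) (g : dhom m n) :
  {linear M (x, n) -> M (y, m)} := @cmap k _ M (x, n) (y, m) (f, g).

Lemma hact_id M x n v : hact M (idm x) (did n) v = v.
Proof. exact: (@cmap_id k _ M (x, n)). Qed.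

Lemma hact_cmp M (x y z : C) (a b c : nat) (f' : hom y z) (f : hom x y)
    (g : dhom b c) (g' : dhom a b) v :
  hact M f' g' (hact M f g v) = hact M (cmp f' f) (dcmp g g') v.
Proof. exact/esym/(@cmap_cmp k _ M (x, c) (y, b) (z, a) (f', g') (f, g)). Qed.

Lemma hact_nat M N (e : ctrans M N) (x y : C) (m n : nat) (f : hom x y) (g : dhom m n) v :
  e (y, m) (hact M f g v) = hact N f g (e (x, n) v).
Proof. exact: (@ctr_nat k _ M N e (x, n) (y, m) (f, g)). Qed.

(** The data of [extra_degeneracy], made linear and natural in C so that they survive a tensor
    product over C. *)
Record extra M N (e : ctrans M N) := Extra {
  exh : forall (x : C) (n : nat), {linear M (x, n) -> M (x, n.+1)};
  ext : forall x : C, {linear N (x, 0%N) -> M (x, 0%N)};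
  exh_nat : forall (x y : C) (f : hom x y) n v,
    exh y n (hact M f (did n) v) = hact M f (did n.+1) (exh x n v);
  ext_nat : forall (x y : C) (f : hom x y) v,
    ext y (hact N f (did 0) v) = hact M f (did 0) (ext x v);
  ex_discrete : forall x m n (f g : dhom m n) v, hact N (idm x) f v = hact N (idm x) g v;
  exh_face0 : forall x n v, hact M (idm x) (coface ord0) (exh x n v) = v;
  exh_face : forall x n (i : 'I_n.+2) v,
    hact M (idm x) (coface (lift ord0 i)) (exh x n.+1 v) =
      exh x n (hact M (idm x) (coface i) v);
  exh_last : forall x v,
    hact M (idm x) (coface (ord_max : 'I_2)) (exh x 0%N v) = ext x (e (x, 0%N) v);
  extK : forall x v, e (x, 0%N) (ext x v) = v }.

(** The functor [n] |-> [n+1] that adjoins a new least vertex; precomposition with it is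
    decalage. *)
Definition dsucc_fun m n (f : 'I_m.+1 -> 'I_n.+1) (i : 'I_m.+2) : 'I_n.+2 :=
  if unlift ord0 i is Some j then lift ord0 (f j) else ord0.

Lemma dsucc_fun0 m n f : @dsucc_fun m n f ord0 = ord0.
Proof. by rewrite /dsucc_fun unlift_none. Qed.
Lemma dsucc_funS m n f j : @dsucc_fun m n f (lift ord0 j) = lift ord0 (f j).
Proof. by rewrite /dsucc_fun liftK. Qed.

Fact dsucc_homo m n (f : dhom m n) : {homo dsucc_fun (sval f) : i j / (i <= j)%N}.
Proof.
move=> i j; case: (unliftP ord0 i) => [i' ->|->]; last by rewrite dsucc_fun0.
case: (unliftP ord0 j) => [j' ->|->]; last by rewrite lift0.
by rewrite !dsucc_funS !lift0 !ltnS => /(svalP f).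
Qed.

Definition dsucc m n (f : dhom m n) : dhom m.+1 n.+1 := dmk (@dsucc_homo m n f).

Lemma dsucc0 m n (f : dhom m n) : sval (dsucc f) ord0 = ord0.
Proof. exact: dsucc_fun0. Qed.

Lemma dsuccS m n (f : dhom m n) j : sval (dsucc f) (lift ord0 j) = lift ord0 (sval f j).
Proof. exact: dsucc_funS. Qed.

Lemma dhom_succ_eq m n (f g : dhom m.+1 n) : sval f ord0 = sval g ord0 ->
  (forall j, sval f (lift ord0 j) = sval g (lift ord0 j)) -> f = g.
Proof.
by move=> h0 hS; apply: dhom_eq => i; case: (unliftP ord0 i) => [i' ->|->].
Qed.

Lemma dsucc_id n : dsucc (did n) = did n.+1.
Proof.
by apply: dhom_succ_eq => [|j] /=; rewrite ?dsucc_fun0 ?dsucc_funS.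
Qed.

Lemma dsucc_cmp a b c (g : dhom b c) (f : dhom a b) :
  dsucc (dcmp g f) = dcmp (dsucc g) (dsucc f).
Proof.
by apply: dhom_succ_eq => [|j] /=; rewrite ?dsucc_fun0 ?dsucc_funS.
Qed.

Definition vertex0 n : dhom 0 n := dmk (f := fun=> ord0) (fun _ _ _ => leqnn _).

Lemma dsucc_coface0 m n (f : dhom m n) :
  dcmp (dsucc f) (coface ord0) = dcmp (coface ord0) f.
Proof. by apply: dhom_eq => i /=; rewrite dsucc_funS. Qed.

Lemma dsucc_vertex0 m n (f : dhom m n) : dcmp (dsucc f) (vertex0 m.+1) = vertex0 n.+1.
Proof. by apply: dhom_eq => i /=; rewrite dsucc_fun0. Qed.

Lemma codegen0_0 n : sval (codegen (ord0 : 'I_n.+1)) ord0 = ord0.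
Proof. exact: val_inj. Qed.

Lemma codegen0_S n l : sval (codegen (ord0 : 'I_n.+1)) (lift ord0 l) = l.
Proof. by apply: val_inj; rewrite /= /unbump /bump /=; lia. Qed.

Lemma dsucc_codegen0 m n (f : dhom m n) :
  dcmp (codegen ord0) (dsucc (dsucc f)) = dcmp (dsucc f) (codegen ord0).
Proof.
apply: dhom_succ_eq => [|j]; rewrite -![sval (dcmp _ _) _]/(sval _ (sval _ _)).
  by rewrite [sval (dsucc (dsucc f)) ord0]dsucc_fun0 !codegen0_0 [RHS]dsucc_fun0.
by rewrite [sval (dsucc (dsucc f)) _]dsucc_funS !codegen0_S.
Qed.

Lemma codegen0_coface0 n : dcmp (codegen ord0) (coface ord0) = did n.
Proof. by apply: dhom_eq => i; apply: val_inj; rewrite /= /unbump /bump /=; lia. Qed.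

Lemma codegen0_vertex0 n : dcmp (codegen ord0) (vertex0 n.+1) = vertex0 n.
Proof. by apply: dhom_eq => i; apply: val_inj; rewrite /= /unbump. Qed.

Lemma coface_lift0 n (i : 'I_n.+2) : coface (lift ord0 i) = dsucc (coface i).
Proof.
apply: dhom_succ_eq => [|j] /=; rewrite ?dsucc_fun0 ?dsucc_funS; apply: val_inj => //=.
by rewrite /bump /=; lia.
Qed.

(** The faces of [Dec M] are d_1, d_2, ... of M. The forgotten face d_0 becomes the projection
    [Dec_face0], and restriction to the new vertex the contraction [Dec_vertex0]. *)
Definition Dec M : cmod k (prodcat C (opcat Delta)).
Proof.
refine (@CMod k (prodcat C (opcat Delta)) (fun a => M (a.1, a.2.+1))
  (fun a b f => @hact M a.1 b.1 b.2.+1 a.2.+1 f.1 (dsucc f.2)) _ _).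
- by move=> a v; rewrite /= dsucc_id; apply: hact_id.
- by move=> a b c g f v; rewrite hact_cmp -dsucc_cmp.
Defined.

Lemma Dec_hact M (x y : C) m n (f : hom x y) (g : dhom m n) v :
  hact (Dec M) f g v = hact M f (dsucc g) v.
Proof. by []. Qed.

Definition Dec_face0 M : ctrans (Dec M) M.
Proof.
refine (@CTrans k _ (Dec M) M (fun a => @cmap k _ M (a.1, a.2.+1) a (idm a.1, coface ord0)) _).
case=> x n [y m] [f g] v; rewrite -[cmap (Dec M) _ v]/(hact M f (dsucc g) v).
by rewrite -[cmap M _ _]/(hact M f g _) !hact_cmp cmp1m cmpm1 dsucc_coface0.
Defined.

Definition Dec_vertex0 M : ctrans (Dec M) (cst (opcat Delta) (lev M 0%N)).
Proof.
refine (@CTrans k _ (Dec M) (cst (opcat Delta) (lev M 0%N)) (fun a => @hact M a.1 a.1 0 a.2.+1 (idm a.1) (vertex0 _)) _).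
case=> x n [y m] [f g] v; rewrite -[cmap (Dec M) _ v]/(hact M f (dsucc g) v).
rewrite -[cmap (cst _ _) _ _]/(hact M f (did 0) _) !hact_cmp cmp1m cmpm1.
by rewrite dsucc_vertex0; congr (hact M f _ v); apply: dhom_eq.
Defined.

(** The degeneracy s_0 has two roles: a section of [Dec_face0], and the extra degeneracy of [Dec M].
    It commutes with C but in general not with the simplicial operators, so the decalage sequence
    splits only degreewise. *)
Definition Dec_degen M (x : C) (n : nat) : {linear M (x, n) -> M (x, n.+1)} :=
  hact M (idm x) (codegen (ord0 : 'I_n.+1)).

Lemma Dec_degen_nat M (x y : C) (f : hom x y) n v :
  Dec_degen M y n (hact M f (did n) v) = hact M f (did n.+1) (Dec_degen M x n v).
Proof.
rewrite /Dec_degen !hact_cmp cmp1m cmpm1; congr (hact M f _ v); exact: dhom_eq.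
Qed.

Lemma Dec_degenK M (x : C) n v : Dec_face0 M (x, n) (Dec_degen M x n v) = v.
Proof. by rewrite [LHS]hact_cmp cmp1m codegen0_coface0 hact_id. Qed.

Definition Dec_extra M : extra (Dec_vertex0 M).
Proof.
refine (@Extra (Dec M) (cst _ _) (Dec_vertex0 M)
  (fun x n => Dec_degen M x n.+1) (fun x => Dec_degen M x 0) _ _ _ _ _ _ _).
- by move=> x y f n v; rewrite !Dec_hact !dsucc_id Dec_degen_nat.
- by move=> x y f v; rewrite Dec_hact dsucc_id -Dec_degen_nat.
- by [].
- move=> x n v; rewrite Dec_hact [LHS]hact_cmp cmp1m.
  rewrite -[RHS]hact_id; congr (hact M _ _ v); apply: dhom_succ_eq => [|j];
    rewrite -![sval (dcmp _ _) _]/(sval _ (sval _ _)).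
    by rewrite !dsucc0 codegen0_0.
  by rewrite !dsuccS codegen0_S.
- move=> x n i v; rewrite coface_lift0 !Dec_hact [LHS]hact_cmp [RHS]hact_cmp cmp1m.
  by rewrite -dsucc_codegen0.
- move=> x v; rewrite -[Dec_vertex0 M (x, 0%N) v]/(hact M (idm x) (vertex0 1) v).
  rewrite Dec_hact [LHS]hact_cmp [RHS]hact_cmp cmp1m.
  congr (hact M _ _ v); apply: dhom_succ_eq => [|j];
    rewrite -![sval (dcmp _ _) _]/(sval _ (sval _ _)).
    by rewrite dsucc0 codegen0_0.
  by rewrite dsuccS codegen0_S; apply: val_inj; rewrite (ord1 j).
- move=> x v; rewrite -[LHS]/(hact M (idm x) (vertex0 1) (Dec_degen M x 0 v)).
  rewrite [LHS]hact_cmp cmp1m codegen0_vertex0 -[RHS]hact_id.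
  by congr (hact M _ _ v); apply: dhom_eq => i; rewrite (ord1 i).
Defined.

Definition cst_extra (L : cmod k C) :
  extra (ctrans_id (cst (opcat Delta) L)).
Proof.
refine (@Extra (cst _ L) (cst _ L) (ctrans_id (cst (opcat Delta) L))
  (fun x n => idfun) (fun x => idfun) _ _ _ _ _ _ _) => //= *; exact: cmap_id.
Defined.

End SimplicialModules.

(** * Functor tensor products *)

Section TensorBilinear.
Context (k : fieldType) (C D : category).
Context (N : cmod k (prodcat (opcat C) D)) (M : cmod k (prodcat C D)) (d : D) (x : C).
Implicit Types (u : N (x, d)) (v : M (x, d)).

Lemma tenDr u v v' : @ten _ _ _ N M d x u (v + v') = ten u v + ten u v'.
Proof.
have [_ Tr _] := ten_balanced N M d.
by rewrite -[v]scale1r [LHS]Tr !scale1r.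
Qed.

Lemma tenDl u u' v : @ten _ _ _ N M d x (u + u') v = ten u v + ten u' v.
Proof.
have [Tl _ _] := ten_balanced N M d.
by rewrite -[u]scale1r [LHS]Tl !scale1r.
Qed.

Lemma ten0r u : @ten _ _ _ N M d x u 0 = 0.
Proof. by apply: (@addrI _ (ten u 0)); rewrite -tenDr !addr0. Qed.

Lemma ten0l v : @ten _ _ _ N M d x 0 v = 0.
Proof. by apply: (@addrI _ (ten 0 v)); rewrite -tenDl !addr0. Qed.

Lemma tenZr c u v : @ten _ _ _ N M d x u (c *: v) = c *: ten u v.
Proof.
have [_ Tr _] := ten_balanced N M d.
by rewrite -[c *: v]addr0 [LHS]Tr ten0r addr0.
Qed.

Lemma tenZl c u v : @ten _ _ _ N M d x (c *: u) v = c *: ten u v.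
Proof.
have [Tl _ _] := ten_balanced N M d.
by rewrite -[c *: u]addr0 [LHS]Tl ten0l addr0.
Qed.

Lemma ten_act (y : C) (f : hom x y) (n : N (y, d)) v :
  @ten _ _ _ N M d x (ractl N d f n) v = ten n (lactl M d f v).
Proof. by have [_ _ Tb] := ten_balanced N M d; apply: Tb. Qed.
End TensorBilinear.

Section Retraction.
Context (k : fieldType) (C : category).
Context (M M' : cmod k (prodcat C (opcat Delta))) (p : ctrans M M').
Context (s : forall x n, {linear M' (x, n) -> M (x, n)}).
Hypothesis sN : forall (x y : C) (f : hom x y) n v,
  s y n (hact M' f (did n) v) = hact M f (did n) (s x n v).
Hypothesis ps : forall x n v, p (x, n) (s x n v) = v.

Fact retr_subproof x n v : p (x, n) ((idfun \- (s x n \o p (x, n))) v) = 0.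
Proof. by rewrite /= linearB /= ps subrr. Qed.

Definition retr x n : {linear M (x, n) -> cker p (x, n)} := klift (@retr_subproof x n).

Lemma retr_nat (x y : C) (f : hom x y) n v :
  retr y n (hact M f (did n) v) = hact (cker p) f (did n) (retr x n v).
Proof.
apply: val_inj; rewrite [LHS]/= [RHS]/=.
rewrite -[cmap M _ _]/(hact M f (did n) _) (hact_nat p) sN linearB /=.
by [].
Qed.

End Retraction.

Section Tensor.
Context (k : fieldType) (C : category).
Implicit Types M : cmod k (prodcat C (opcat Delta)).
Implicit Types N : cmod k (prodcat (opcat C) (opcat Delta)).

Lemma act_ten N M m n (g : dhom m n) (x : C) (u : N (x, n)) (v : M (x, n)) :
  act (tens N M) g (@ten _ _ _ N M n x u v) =
    @ten _ _ _ N M m x (@hact _ (opcat C) N x x m n (idm x) g u) (hact M (idm x) g v).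
Proof. exact: (@ten_mapE k C (opcat Delta) N M n m g x u v). Qed.

Lemma tens_trans_ten N N' M M' (p : ctrans N N') (q : ctrans M M') n (x : C)
    (u : N (x, n)) (v : M (x, n)) :
  tens_trans p q n (@ten _ _ _ N M n x u v) = @ten _ _ _ N' M' n x (p (x, n) u) (q (x, n) v).
Proof. exact: tenst_funE. Qed.

Lemma tens_trans_square N1 N2 N3 N4 M1 M2 M3 M4
    (p12 : ctrans N1 N2) (p24 : ctrans N2 N4) (p13 : ctrans N1 N3) (p34 : ctrans N3 N4)
    (q12 : ctrans M1 M2) (q24 : ctrans M2 M4) (q13 : ctrans M1 M3) (q34 : ctrans M3 M4) :
  (forall a u, p24 a (p12 a u) = p34 a (p13 a u)) ->
  (forall a v, q24 a (q12 a v) = q34 a (q13 a v)) ->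
  forall n w, tens_trans p24 q24 n (tens_trans p12 q12 n w) =
    tens_trans p34 q34 n (tens_trans p13 q13 n w).
Proof.
move=> ep eq n; apply: (ten_ext
  (f := tens_trans p24 q24 n \o tens_trans p12 q12 n)
  (g := tens_trans p34 q34 n \o tens_trans p13 q13 n)) => x u v.
rewrite [LHS]/= [RHS]/=.
by rewrite (tens_trans_ten p12) (tens_trans_ten p13) !tens_trans_ten ep eq.
Qed.

Lemma tens_trans_comp N1 N2 N3 M1 M2 M3
    (p12 : ctrans N1 N2) (p23 : ctrans N2 N3) (p13 : ctrans N1 N3)
    (q12 : ctrans M1 M2) (q23 : ctrans M2 M3) (q13 : ctrans M1 M3) :
  (forall a u, p23 a (p12 a u) = p13 a u) ->
  (forall a v, q23 a (q12 a v) = q13 a v) ->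
  forall n w, tens_trans p23 q23 n (tens_trans p12 q12 n w) = tens_trans p13 q13 n w.
Proof.
move=> ep eq n; apply: (ten_ext
  (f := tens_trans p23 q23 n \o tens_trans p12 q12 n) (g := tens_trans p13 q13 n)) => x u v.
by rewrite [LHS]/= (tens_trans_ten p12) !tens_trans_ten ep eq.
Qed.

Section Extra.
Context N N' M M' (e : ctrans N N') (e' : ctrans M M').
Context (X : extra e) (X' : extra e').

Fact tens_exh_l n (x y : C) (f : hom x y) u :
  exh X x n (ractl N n f u) = ractl N n.+1 f (exh X y n u).
Proof. exact: (@exh_nat _ (opcat C) _ _ _ X y x f n u). Qed.

Fact tens_exh_r n (x y : C) (f : hom x y) v :
  exh X' y n (lactl M n f v) = lactl M n.+1 f (exh X' x n v).
Proof. exact: (@exh_nat _ C _ _ _ X' x y f n v). Qed.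

Definition tens_exh n : tens N M n -> tens N M n.+1 :=
  tenf (@tens_exh_l n) (@tens_exh_r n).
HB.instance Definition _ n := GRing.Linear.on (@tens_exh n).

Lemma tens_exhE n x u v : tens_exh (@ten _ _ _ N M n x u v) =
  @ten _ _ _ N M n.+1 x (exh X x n u) (exh X' x n v).
Proof. exact: tenfE. Qed.

Fact tens_ext_l (x y : C) (f : hom x y) u :
  ext X x (ractl N' 0%N f u) = ractl N 0%N f (ext X y u).
Proof. exact: (@ext_nat _ (opcat C) _ _ _ X y x f u). Qed.

Fact tens_ext_r (x y : C) (f : hom x y) v :
  ext X' y (lactl M' 0%N f v) = lactl M 0%N f (ext X' x v).
Proof. exact: (@ext_nat _ C _ _ _ X' x y f v). Qed.

Definition tens_ext : tens N' M' 0%N -> tens N M 0%N := tenf tens_ext_l tens_ext_r.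
HB.instance Definition _ := GRing.Linear.on tens_ext.

Lemma tens_extE x u v : tens_ext (@ten _ _ _ N' M' 0%N x u v) =
  @ten _ _ _ N M 0%N x (ext X x u) (ext X' x v).
Proof. exact: tenfE. Qed.

(** On the diagonal the extra degeneracies of the two factors act simultaneously, so that both
    factors are contracted at once. *)
Lemma weq_tens_extra : weq (tens_trans e e').
Proof.
apply: (@extra_degeneracy _ _ _ _ tens_exh tens_ext).
- move=> m n f g; apply: (ten_ext (f := act (tens N' M') f) (g := act (tens N' M') g)) => x u v.
  rewrite /= !act_ten; congr ten; first exact: (ex_discrete X).
  exact: (ex_discrete X').
- by move=> n; rewrite linear0.
- by rewrite linear0.
- move=> n; apply: (ten_ext (f := act (tens N M) (coface ord0) \o @tens_exh n)
    (g := idfun)) => x u v.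
  rewrite -[LHS]/(act _ _ (tens_exh _)) tens_exhE act_ten; congr ten; first exact: (exh_face0 X).
  exact: (exh_face0 X').
- move=> n i; apply: (ten_ext (f := act (tens N M) (coface (lift ord0 i)) \o @tens_exh n.+1)
    (g := @tens_exh n \o act (tens N M) (coface i))) => x u v.
  rewrite -[LHS]/(act _ _ (tens_exh _)) -[RHS]/(tens_exh (act _ _ _)) tens_exhE.
  rewrite [LHS]act_ten [act _ (coface i) _]act_ten tens_exhE; congr ten.
    exact: (exh_face X).
  exact: (exh_face X').
- apply: (ten_ext (f := act (tens N M) (coface (ord_max : 'I_2)) \o @tens_exh 0)
    (g := tens_ext \o tens_trans e e' 0%N)) => x u v.
  rewrite -[LHS]/(act _ _ (tens_exh _)) -[RHS]/(tens_ext (tens_trans e e' 0%N _)).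
  rewrite (tens_exhE u v).
  rewrite (@tens_trans_ten _ _ _ _ e e' 0%N x u v).
  rewrite tens_extE.
  rewrite (@act_ten N M 0 1 _ x _ _).
  by congr ten; [apply: (exh_last X)|apply: (exh_last X')].
- apply: (ten_ext (f := tens_trans e e' 0%N \o tens_ext) (g := idfun)) => x u v.
  rewrite -[LHS]/(tens_trans e e' 0%N (tens_ext _)) tens_extE tens_trans_ten.
  by congr ten; [apply: (extK X)|apply: (extK X')].
Qed.
End Extra.

Section SplitRight.
Context N M M' (p : ctrans M M') (s : forall x n, {linear M' (x, n) -> M (x, n)}).
Hypothesis sN : forall (x y : C) (f : hom x y) n v,
  s y n (hact M' f (did n) v) = hact M f (did n) (s x n v).
Hypothesis ps : forall x n v, p (x, n) (s x n v) = v.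

(** The splitting id = i r + s p is natural in C, hence tensors with the identity of N to a
    splitting in each degree. *)
Lemma tens_exact_right :
  exact_seq (tens_trans (ctrans_id N) (cker_incl p)) (tens_trans (ctrans_id N) p).
Proof.
move=> n.
have idN (x y : C) (f : hom x y) (u : N (y, n)) :
  (idfun : {linear N (x, n) -> N (x, n)}) (ractl N n f u) = ractl N n f u by [].
pose r := @tenf _ _ _ N N M (cker p) n n (fun=> idfun) (fun x => retr ps x n) idN
  (fun x y f m => retr_nat sN ps f m).
pose t := @tenf _ _ _ N N M' M n n (fun=> idfun) (fun x => s x n) idN
  (fun x y f m => @sN x y f n m).
pose i := tens_trans (ctrans_id N) (cker_incl p) n.
pose q := tens_trans (ctrans_id N) p n.
have rE x u v : r (@ten _ _ _ N M n x u v) = @ten _ _ _ N (cker p) n x u (retr ps x n v).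
  exact: tenfE.
have tE x u v : t (@ten _ _ _ N M' n x u v) = @ten _ _ _ N M n x u (s x n v).
  exact: tenfE.
have iE x u v : i (@ten _ _ _ N (cker p) n x u v) = @ten _ _ _ N M n x u (kval v).
  exact: tens_trans_ten.
have qE x u v : q (@ten _ _ _ N M n x u v) = @ten _ _ _ N M' n x u (p (x, n) v).
  exact: tens_trans_ten.
have ri u : r (i u) = u.
  apply: (ten_ext (f := r \o i) (g := idfun)) u => x u v.
  rewrite -[LHS]/(r (i _)) iE rE; congr ten; apply: val_inj.
  by rewrite [LHS]/= kval0 linear0 subr0.
have irt u : i (r u) + t (q u) = u.
  apply: (ten_ext (f := (i \o r) \+ (t \o q)) (g := idfun)) u => x u v.
  by rewrite -[LHS]/(i (r _) + t (q _)) rE qE tE iE -tenDr /= subrK.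
have qi u : q (i u) = 0.
  apply: (ten_ext (f := q \o i) (g := \0)) u => x u v.
  by rewrite -[LHS]/(q (i _)) iE qE kval0 ten0r.
have qt u : q (t u) = u.
  apply: (ten_ext (f := q \o t) (g := idfun)) u => x u v.
  by rewrite -[LHS]/(q (t _)) tE qE ps.
split.
- exact: can_inj ri.
- exact: qi.
- move=> y qy; exists (r y); rewrite -[RHS]irt [q y]qy.
  by have -> : t 0 = 0 by [exact: linear0]; rewrite addr0.
- by move=> z; exists (t z); apply: qt.
Qed.
End SplitRight.

Section SplitLeft.
Context M N N' (p : ctrans N N') (s : forall x n, {linear N' (x, n) -> N (x, n)}).
Hypothesis sN : forall (x y : opcat C) (f : hom x y) n u,
  s y n (hact N' f (did n) u) = hact N f (did n) (s x n u).
Hypothesis ps : forall x n u, p (x, n) (s x n u) = u.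

Lemma tens_exact_left :
  exact_seq (tens_trans (cker_incl p) (ctrans_id M)) (tens_trans p (ctrans_id M)).
Proof.
move=> n.
have idM (x y : C) (f : hom x y) (v : M (x, n)) :
  (idfun : {linear M (y, n) -> M (y, n)}) (lactl M n f v) = lactl M n f v by [].
pose r := @tenf _ _ _ N (cker p) M M n n (fun x => retr ps x n) (fun=> idfun)
  (fun x y f m => @retr_nat _ (opcat C) _ _ _ _ sN ps y x f n m) idM.
pose t := @tenf _ _ _ N' N M M n n (fun x => s x n) (fun=> idfun)
  (fun x y f m => @sN y x f n m) idM.
pose i := tens_trans (cker_incl p) (ctrans_id M) n.
pose q := tens_trans p (ctrans_id M) n.
have rE x u v : r (@ten _ _ _ N M n x u v) = @ten _ _ _ (cker p) M n x (retr ps x n u) v.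
  exact: tenfE.
have tE x u v : t (@ten _ _ _ N' M n x u v) = @ten _ _ _ N M n x (s x n u) v.
  exact: tenfE.
have iE x u v : i (@ten _ _ _ (cker p) M n x u v) = @ten _ _ _ N M n x (kval u) v.
  exact: tens_trans_ten.
have qE x u v : q (@ten _ _ _ N M n x u v) = @ten _ _ _ N' M n x (p (x, n) u) v.
  exact: tens_trans_ten.
have ri u : r (i u) = u.
  apply: (ten_ext (f := r \o i) (g := idfun)) u => x u v.
  rewrite -[LHS]/(r (i _)) iE rE; congr ten; apply: val_inj.
  by rewrite [LHS]/= kval0 linear0 subr0.
have irt u : i (r u) + t (q u) = u.
  apply: (ten_ext (f := (i \o r) \+ (t \o q)) (g := idfun)) u => x u v.
  by rewrite -[LHS]/(i (r _) + t (q _)) rE qE tE iE -tenDl /= subrK.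
have qi u : q (i u) = 0.
  apply: (ten_ext (f := q \o i) (g := \0)) u => x u v.
  by rewrite -[LHS]/(q (i _)) iE qE kval0 ten0l.
have qt u : q (t u) = u.
  apply: (ten_ext (f := q \o t) (g := idfun)) u => x u v.
  by rewrite -[LHS]/(q (t _)) tE qE ps.
split.
- exact: can_inj ri.
- exact: qi.
- move=> y qy; exists (r y); rewrite -[RHS]irt [q y]qy.
  by have -> : t 0 = 0 by [exact: linear0]; rewrite addr0.
- by move=> z; exists (t z); apply: qt.
Qed.
End SplitLeft.
End Tensor.

Lemma Dec_section_nat (k : fieldType) (C : category) (M : cmod k (prodcat C (opcat Delta)))
    (x y : C) (f : hom x y) n v :
  Dec_degen M y n (hact M f (did n) v) = hact (Dec M) f (did n) (Dec_degen M x n v).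
Proof. by rewrite Dec_hact dsucc_id Dec_degen_nat. Qed.

(** * Reduction of diagonals to simplicially constant factors *)

Section Shifting.
Context (k : fieldType) (C : category).
Implicit Types M : cmod k (prodcat C (opcat Delta)).
Implicit Types N : cmod k (prodcat (opcat C) (opcat Delta)).

Definition Dec_exact_right N M :=
  @tens_exact_right k C N _ _ (Dec_face0 M) (fun x n => Dec_degen M x n)
    (fun x y f n v => @Dec_section_nat k C M x y f n v) (@Dec_degenK k C M).

Definition Dec_exact_left N M :=
  @tens_exact_left k C M _ _ (Dec_face0 N) (fun x n => Dec_degen N x n)
    (fun x y f n v => @Dec_section_nat k (opcat C) N x y f n v) (@Dec_degenK k (opcat C) N).

(** Source and target both contract onto the tensor product of the two constants, by
    [weq_tens_extra]; two out of three does the rest. *)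
Lemma weq_tens_Dec_Dec_right N M :
  weq (tens_trans (ctrans_id (Dec N)) (Dec_vertex0 M)).
Proof.
apply: (@weq_right _ _ _ _ _ (tens_trans (Dec_vertex0 N) (ctrans_id _))
  (tens_trans (Dec_vertex0 N) (Dec_vertex0 M))).
- exact: tens_trans_comp.
- exact: weq_tens_extra (Dec_extra N) (cst_extra _).
- exact: weq_tens_extra (Dec_extra N) (Dec_extra M).
Qed.

Lemma weq_tens_Dec_Dec_left N M :
  weq (tens_trans (Dec_vertex0 N) (ctrans_id (Dec M))).
Proof.
apply: (@weq_right _ _ _ _ _ (tens_trans (ctrans_id _) (Dec_vertex0 M))
  (tens_trans (Dec_vertex0 N) (Dec_vertex0 M))).
- exact: tens_trans_comp.
- exact: weq_tens_extra (cst_extra _) (Dec_extra M).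
- exact: weq_tens_extra (Dec_extra N) (Dec_extra M).
Qed.

Inductive Dec_right_class M : forall U V : smod k, ctrans U V -> Prop :=
| DecRight N : Dec_right_class M (tens_trans (ctrans_id N) (Dec_vertex0 M)).

(** M is fixed and N is shifted: for [Dec N] the claim was just shown, and the kernel of [Dec N] ->
    N is again a simplicial right module. *)
Lemma weq_tens_Dec_right N M : weq (tens_trans (ctrans_id N) (Dec_vertex0 M)).
Proof.
apply: (@dimension_shift k (Dec_right_class M)); last exact: DecRight.
move=> _ _ _ [{}N].
exists (tens (cker (Dec_face0 N)) (Dec M)), (tens (cker (Dec_face0 N)) (cst _ (lev M 0%N))).
exists (tens (Dec N) (Dec M)), (tens (Dec N) (cst _ (lev M 0%N))).
exists (tens_trans (ctrans_id _) (Dec_vertex0 M)), (tens_trans (ctrans_id _) (Dec_vertex0 M)).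
exists (tens_trans (cker_incl _) (ctrans_id _)), (tens_trans (Dec_face0 N) (ctrans_id _)).
exists (tens_trans (cker_incl _) (ctrans_id _)), (tens_trans (Dec_face0 N) (ctrans_id _)).
split.
- exact: DecRight.
- exact: weq_tens_Dec_Dec_right.
- exact: Dec_exact_left.
- exact: Dec_exact_left.
- by split; apply: tens_trans_square.
Qed.

Inductive Dec_left_class N : forall U V : smod k, ctrans U V -> Prop :=
| DecLeft M : Dec_left_class N (tens_trans (Dec_vertex0 N) (ctrans_id M)).

Lemma weq_tens_Dec_left N M : weq (tens_trans (Dec_vertex0 N) (ctrans_id M)).
Proof.
apply: (@dimension_shift k (Dec_left_class N)); last exact: DecLeft.
move=> _ _ _ [{}M].
exists (tens (Dec N) (cker (Dec_face0 M))), (tens (cst _ (lev N 0%N)) (cker (Dec_face0 M))).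
exists (tens (Dec N) (Dec M)), (tens (cst _ (lev N 0%N)) (Dec M)).
exists (tens_trans (Dec_vertex0 N) (ctrans_id _)), (tens_trans (Dec_vertex0 N) (ctrans_id _)).
exists (tens_trans (ctrans_id _) (cker_incl _)), (tens_trans (ctrans_id _) (Dec_face0 M)).
exists (tens_trans (ctrans_id _) (cker_incl _)), (tens_trans (ctrans_id _) (Dec_face0 M)).
split.
- exact: DecLeft.
- exact: weq_tens_Dec_Dec_left.
- exact: Dec_exact_right.
- exact: Dec_exact_right.
- by split; apply: tens_trans_square.
Qed.

Definition pointwise_weq M M' (f : ctrans M M') := forall x, weq (evx_trans f x).

(** Flatness is imposed on each N_n as a simplicially constant module. In this form it passes to the
    kernel of [Dec N] -> N. *)
Definition flat_levels N := forall (n : nat) M M' (f : ctrans M M'), pointwise_weq f ->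
  weq (tens_trans (ctrans_id (cst (opcat Delta) (lev N n))) f).

(** In degree n the kernel of [Dec M] -> M is a direct summand of M_(n+1), naturally in C.
    Properties of the single levels that pass to retracts therefore pass to the kernel. *)
Lemma lev_cker_Dec (C' : category) (M : cmod k (prodcat C' (opcat Delta))) n :
  exists (i : ctrans (lev (cker (Dec_face0 M)) n) (lev M n.+1))
         (r : ctrans (lev M n.+1) (lev (cker (Dec_face0 M)) n)),
    forall x v, r x (i x v) = v.
Proof.
have iN (x y : C') (f : hom x y) v : kval (cmap (lev (cker (Dec_face0 M)) n) f v) =
    cmap (lev M n.+1) f (kval v).
  by rewrite [LHS]/= dsucc_id.
exists (@CTrans k C' (lev (cker (Dec_face0 M)) n) (lev M n.+1)
  (fun x => @kval _ _ _ (Dec_face0 M (x, n))) iN).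
pose r x : {linear lev M n.+1 x -> lev (cker (Dec_face0 M)) n x} :=
  @retr k C' (Dec M) M (Dec_face0 M) (fun x n => Dec_degen M x n) (@Dec_degenK k C' M) x n.
have rN (x y : C') (f : hom x y) v : r y (cmap (lev M n.+1) f v) =
    cmap (lev (cker (Dec_face0 M)) n) f (r x v).
  rewrite -[RHS](@retr_nat k C' (Dec M) M (Dec_face0 M) (fun x n => Dec_degen M x n) (fun x y f n v => @Dec_section_nat k C' M x y f n v)
    (@Dec_degenK k C' M) x y f n); congr (r y _).
  by rewrite Dec_hact dsucc_id.
exists (@CTrans k C' (lev M n.+1) (lev (cker (Dec_face0 M)) n) r rN) => x v /=.
by apply: val_inj; rewrite /= kval0 linear0 subr0.
Qed.

Lemma flat_levels_cker N : flat_levels N -> flat_levels (cker (Dec_face0 N)).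
Proof.
move=> fN n M M' f fw; have [i [r ri]] := @lev_cker_Dec (opcat C) N n.
apply: (weq_retract
  (f := tens_trans (ctrans_id (cst (opcat Delta) (lev N n.+1))) f)
  (i := tens_trans (cst_trans _ i) (ctrans_id M)) (r := tens_trans (cst_trans _ r) (ctrans_id M))
  (j := tens_trans (cst_trans _ i) (ctrans_id M')) (s := tens_trans (cst_trans _ r) (ctrans_id M')));
  last exact: fN.
- move=> m u; rewrite (@tens_trans_comp _ _ _ _ _ _ _ _ _ _ (ctrans_id _) _ _ (ctrans_id _)) //.
    by apply: (ten_ext (g := idfun)) u => x u v; rewrite tens_trans_ten.
  by move=> a v; apply: ri.
- move=> m u; rewrite (@tens_trans_comp _ _ _ _ _ _ _ _ _ _ (ctrans_id _) _ _ (ctrans_id _)) //.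
    by apply: (ten_ext (g := idfun)) u => x u v; rewrite tens_trans_ten.
  by move=> a v; apply: ri.
- exact: tens_trans_square.
- exact: tens_trans_square.
Qed.

Section PointwiseWeq.
Context M M' (f : ctrans M M').
Hypothesis fw : pointwise_weq f.

Inductive tens_right_class : forall U V : smod k, ctrans U V -> Prop :=
| TensRight N : flat_levels N -> tens_right_class (tens_trans (ctrans_id N) f).

(** Dimension shifting in N. In the middle of the ladder [Dec N] may be replaced by the constant
    N_0, where flatness of level 0 applies. *)
Theorem weq_tens_right N : flat_levels N -> weq (tens_trans (ctrans_id N) f).
Proof.
move=> Nflat; apply: (@dimension_shift k tens_right_class); last exact: TensRight.
move=> _ _ _ [{Nflat}N Nflat].
exists (tens (cker (Dec_face0 N)) M), (tens (cker (Dec_face0 N)) M').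
exists (tens (Dec N) M), (tens (Dec N) M').
exists (tens_trans (ctrans_id _) f), (tens_trans (ctrans_id _) f).
exists (tens_trans (cker_incl _) (ctrans_id _)), (tens_trans (Dec_face0 N) (ctrans_id _)).
exists (tens_trans (cker_incl _) (ctrans_id _)), (tens_trans (Dec_face0 N) (ctrans_id _)).
split.
- exact/TensRight/flat_levels_cker.
- pose c := cst (opcat Delta) (lev N 0%N).
  apply: (@weq_right _ _ _ _ _ (tens_trans (Dec_vertex0 N) (ctrans_id M'))
    (tens_trans (Dec_vertex0 N) f)) => [n w||].
  + exact: tens_trans_comp.
  + exact: weq_tens_Dec_left.
  + apply: (@weq_comp _ _ _ _ (tens_trans (Dec_vertex0 N) (ctrans_id M))
      (tens_trans (ctrans_id c) f)) => [n w||].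
    * exact: tens_trans_comp.
    * exact: weq_tens_Dec_left.
    * exact: Nflat.
- exact: Dec_exact_left.
- exact: Dec_exact_left.
- by split; apply: tens_trans_square.
Qed.
End PointwiseWeq.

Section Acyclic.
Context N N' (e : ctrans N N').

Definition acyclic_levels M := forall n : nat,
  weq (tens_trans e (ctrans_id (cst (opcat Delta) (lev M n)))).

Lemma acyclic_levels_cker M : acyclic_levels M -> acyclic_levels (cker (Dec_face0 M)).
Proof.
move=> aM n; have [i [r ri]] := @lev_cker_Dec C M n.
apply: (weq_retract
  (f := tens_trans e (ctrans_id (cst (opcat Delta) (lev M n.+1))))
  (i := tens_trans (ctrans_id N) (cst_trans _ i)) (r := tens_trans (ctrans_id N) (cst_trans _ r))
  (j := tens_trans (ctrans_id N') (cst_trans _ i)) (s := tens_trans (ctrans_id N') (cst_trans _ r)));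
  last exact: aM.
- move=> m u; rewrite (@tens_trans_comp _ _ _ _ _ _ _ _ _ _ (ctrans_id _) _ _ (ctrans_id _)) //.
    by apply: (ten_ext (g := idfun)) u => x u v; rewrite tens_trans_ten.
  by move=> a v; apply: ri.
- move=> m u; rewrite (@tens_trans_comp _ _ _ _ _ _ _ _ _ _ (ctrans_id _) _ _ (ctrans_id _)) //.
    by apply: (ten_ext (g := idfun)) u => x u v; rewrite tens_trans_ten.
  by move=> a v; apply: ri.
- exact: tens_trans_square.
- exact: tens_trans_square.
Qed.

Inductive tens_left_class : forall U V : smod k, ctrans U V -> Prop :=
| TensLeft M : acyclic_levels M -> tens_left_class (tens_trans e (ctrans_id M)).

(** The same argument with M shifted and a map of right modules held fixed; the middle of the ladder
    reduces to the constant M_0. *)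
Theorem weq_tens_left M : acyclic_levels M -> weq (tens_trans e (ctrans_id M)).
Proof.
move=> Mac; apply: (@dimension_shift k tens_left_class); last exact: TensLeft.
move=> _ _ _ [{Mac}M Mac].
exists (tens N (cker (Dec_face0 M))), (tens N' (cker (Dec_face0 M))).
exists (tens N (Dec M)), (tens N' (Dec M)).
exists (tens_trans e (ctrans_id _)), (tens_trans e (ctrans_id _)).
exists (tens_trans (ctrans_id _) (cker_incl _)), (tens_trans (ctrans_id _) (Dec_face0 M)).
exists (tens_trans (ctrans_id _) (cker_incl _)), (tens_trans (ctrans_id _) (Dec_face0 M)).
split.
- exact/TensLeft/acyclic_levels_cker.
- pose c := cst (opcat Delta) (lev M 0%N).
  apply: (@weq_right _ _ _ _ _ (tens_trans (ctrans_id N') (Dec_vertex0 M))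
    (tens_trans e (Dec_vertex0 M))) => [n w||].
  + exact: tens_trans_comp.
  + exact: weq_tens_Dec_right.
  + apply: (@weq_comp _ _ _ _ (tens_trans (ctrans_id N) (Dec_vertex0 M))
      (tens_trans e (ctrans_id c))) => [n w||].
    * exact: tens_trans_comp.
    * exact: weq_tens_Dec_right.
    * exact: Mac.
- exact: Dec_exact_right.
- exact: Dec_exact_right.
- by split; apply: tens_trans_square.
Qed.
End Acyclic.
End Shifting.

(** * Free modules and coordinates *)

Lemma free_ind (k : fieldType) (T : Type) (P : freemod k T -> Prop) :
  P 0 -> (forall c x y, P x -> P y -> P (c *: x + y)) -> (forall t, P (fgen k t)) ->
  forall x, P x.
Proof.
move=> P0 Plin Pgen x; rewrite (fgenE x) /flift; elim/big_ind: _ => // [y z Py Pz|t _].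
  by rewrite -[y]scale1r; apply: Plin.
by rewrite -[_ *: _]addr0; apply: Plin.
Qed.

Lemma ten_ind (k : fieldType) (C D : category) (N : cmod k (prodcat (opcat C) D))
    (M : cmod k (prodcat C D)) (d : D) (P : ten_ob N M d -> Prop) :
  P 0 -> (forall c x y, P x -> P y -> P (c *: x + y)) ->
  (forall x u v, P (@ten _ _ _ N M d x u v)) -> forall w, P w.
Proof.
move=> P0 Plin Pten w; rewrite -[w]qreprK; elim/free_ind: (qrepr w).
- by rewrite linear0.
- by move=> c x y Px Py; rewrite linearP; apply: Plin.
- by case=> x [u v]; apply: Pten.
Qed.

Section Cover.
Context (k : fieldType) (X X' : smod k) (f : ctrans X X') (B : Type).
Context (Z Z' : B -> smod k) (g : forall b, ctrans (Z b) (Z' b)).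
Context (c : forall b, ctrans X (Z b)) (e : forall b, ctrans (Z b) X).
Context (c' : forall b, ctrans X' (Z' b)) (e' : forall b, ctrans (Z' b) X').
Hypothesis gc : forall b n x, g b n (c b n x) = c' b n (f n x).
Hypothesis fe : forall b n z, f n (e b n z) = e' b n (g b n z).
Hypothesis dec : forall n x, exists s : seq B, x = \sum_(b <- s) e b n (c b n x).
Hypothesis dec' : forall n x, exists s : seq B, x = \sum_(b <- s) e' b n (c' b n x).

(** The maps c and e exhibit f as a retract of the direct sum of the g b, without that sum being
    formed: each element is recovered from finitely many of its coordinates. *)
Lemma weq_cover : (forall b, weq (g b)) -> weq f.
Proof.
move=> gw; have {}gw b n : homology_inj (g b) n /\ homology_surj (g b) n.
  by have /weqP := gw b.
apply/weqP => n; split=> [x hx hb|y hy].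
  have hcx b : boundary (c b n x).
    have [gi _] := gw b n; apply: gi; first exact: cycle_map.
    by rewrite gc; apply: boundary_map.
  have [s ->] := dec x; elim/big_ind: _ => [|u v|b _]; first exact: boundary0.
    exact: boundaryD.
  exact: boundary_map.
have zex b : exists z, is_cycle z /\ boundary (c' b n y - g b n z).
  by have [_ gs] := gw b n; have [z] := gs _ (cycle_map (c' b) hy); exists z.
pose z b := sval (cid (zex b)).
have hz b : is_cycle (z b) /\ boundary (c' b n y - g b n (z b)) := svalP (cid (zex b)).
have [s yE] := dec' y; exists (\sum_(b <- s) e b n (z b)).
  elim/big_ind: _ => [|u v|b _]; [exact: cycle0|exact: cycleD|].
  by apply: cycle_map; case: (hz b).
rewrite {1}yE linear_sum -sumrB; elim/big_ind: _ => [|u v|b _]; first exact: boundary0.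
  exact: boundaryD.
rewrite fe -linearB; apply: boundary_map.
by case: (hz b).
Qed.
End Cover.

Section FreeRight.
Context (k : fieldType) (C : category) (L : C -> lmodType k).
Context (r : forall x y : C, hom x y -> {linear L y -> L x}).

(* A basis of the right C-module L: coordinates with values in the representable
   modules k[hom - (y b)], only finitely many of which are nonzero on a given element. *)
Record free_right := FreeRight {
  rf_index : Type;
  rf_ob : rf_index -> C;
  rf_gen : forall b, L (rf_ob b);
  rf_coord : forall b x, {linear L x -> freemod k (hom x (rf_ob b))};
  rf_nat : forall b (x x' : C) (f : hom x x') n,
    rf_coord b x (r f n) = flift (fun g => fgen k (cmp g f)) (rf_coord b x' n);
  rf_dec : forall x (n : L x), exists s : seq {classic rf_index},
    forall s' : seq {classic rf_index}, uniq s' -> {subset s <= s'} ->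
      n = \sum_(b <- s') flift (fun f => r f (rf_gen b)) (rf_coord b x n) }.
End FreeRight.

Section Coordinates.
Context (k : fieldType) (C D : category).
Context (N : cmod k (prodcat (opcat C) D)) (M : cmod k (prodcat C D)) (d : D).
Variable F : free_right (fun x y : C => @ractl k C D N d x y).

(** By the Yoneda isomorphism k[hom - y] (x)_C M = M(y), a coordinate of N with values in a
    representable becomes a coordinate of N (x)_C M with values in M(y). *)
Definition tcoord_gen b (x : C) (n : N (x, d)) (m : M (x, d)) : M (rf_ob (f0 := F) b, d) :=
  flift (fun g => lactl M d g m) (rf_coord b x n).

Fact tcoord_balanced b : balanced (tcoord_gen b).
Proof.
split=> [x m c n n'|x n c m m'|x y f n m]; rewrite /tcoord_gen.
- by rewrite !linearP.
- by rewrite -flift_add; congr (flift _ _); apply: funext => g; rewrite linearP.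
rewrite rf_nat; elim/free_ind: (rf_coord b y n) => [|c u v Hu Hv|g].
- by rewrite !linear0.
- by rewrite !linearP /= Hu Hv.
by rewrite !flift_gen /lactl -cmap_cmp /cmp /= cmp1m.
Qed.

Definition tcoord b : ten_ob N M d -> M (rf_ob (f0 := F) b, d) :=
  plift (balanced_respects (tcoord_balanced b)).
HB.instance Definition _ b := GRing.Linear.on (tcoord b).

Lemma tcoordE b x n m : tcoord b (@ten _ _ _ N M d x n m) = tcoord_gen b n m.
Proof. exact: plift_gen. Qed.

Definition tinj b (m : M (rf_ob (f0 := F) b, d)) : ten_ob N M d := ten (rf_gen b) m.
Fact tinj_linear b : linear (@tinj b).
Proof. by move=> c x y; rewrite /tinj tenDr tenZr. Qed.
HB.instance Definition _ b := GRing.isLinear.Build k _ _ _ (@tinj b) (@tinj_linear b).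

Definition tinj_lin b : {linear M (rf_ob (f0 := F) b, d) -> ten_ob N M d} := @tinj b.

Lemma tcoord_dec w : exists s : seq (rf_index F), w = \sum_(b <- s) tinj (tcoord b w).
Proof.
(* Admitting every larger duplicate-free list lets the lists of two summands be merged. *)
suff [s sP] : exists s : seq {classic rf_index F}, forall s' : seq {classic rf_index F},
    uniq s' -> {subset s <= s'} -> w = \sum_(b <- s') tinj (tcoord b w).
  by exists (undup s); apply: sP; [exact: undup_uniq|move=> b; rewrite mem_undup].
elim/ten_ind: w => [|c u v [s sP] [s' s'P]|x n m].
- by exists nil => s _ _; rewrite big1 // => b _; rewrite !linear0.
- exists (s ++ s') => s2 us2 sub.
  rewrite {1}(sP s2) //; last by move=> b bs; apply: sub; rewrite mem_cat bs.
  rewrite {1}(s'P s2) //; last by move=> b bs; apply: sub; rewrite mem_cat bs orbT.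
  by rewrite scaler_sumr -big_split; apply: eq_bigr => b _ /=; rewrite !linearP.
have [s sP] := rf_dec F n; exists s => s' us' sub.
rewrite {1}(sP s' us' sub).
have -> : ten (\sum_(b <- s') flift (fun f => ractl N d f (rf_gen b)) (rf_coord b x n)) m =
    \sum_(b <- s') @ten _ _ _ N M d x (flift (fun f => ractl N d f (rf_gen b)) (rf_coord b x n)) m.
  by apply: (big_morph (fun u => @ten _ _ _ N M d x u m)) => [u v|]; rewrite ?tenDl ?ten0l.
apply: eq_bigr => b _; rewrite tcoordE /tcoord_gen.
elim/free_ind: (rf_coord b x n) => [|c u v Hu Hv|g].
- by rewrite !linear0 ten0l.
- by rewrite !linearP /= -Hu -Hv tenDl tenZl.
by rewrite !flift_gen /tinj ten_act.
Qed.
End Coordinates.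

Section FreeFlat.
Context (k : fieldType) (C : category).
Context (N : cmod k (prodcat (opcat C) (opcat Delta))).
Hypothesis F : forall n : nat,
  free_right (fun x y : C => @ractl k C (opcat Delta) N n x y).

Section Level.
Variable n : nat.
Let L := cst (opcat Delta) (lev N n).
Let FL (d : nat) : free_right (fun x y : C => @ractl k C (opcat Delta) L d x y) := F n.
Context (M : cmod k (prodcat C (opcat Delta))) (b : rf_index (F n)).
Let y := rf_ob b.

Fact level_coord_nat (d d' : opcat Delta) (g : hom d d') w :
  @tcoord _ _ _ L M d' (FL d') b (cmap (tens L M) g w) =
    cmap (evx M y) g (@tcoord _ _ _ L M d (FL d) b w).
Proof.
apply: (ten_ext (f := @tcoord _ _ _ L M d' (FL d') b \o cmap (tens L M) g)
  (g := cmap (evx M y) g \o @tcoord _ _ _ L M d (FL d) b)) w => x u v.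
rewrite -[LHS]/(tcoord _ (act (tens L M) g (ten u v))).
rewrite -[RHS]/(act (evx M y) g (tcoord _ (ten u v))) act_ten !tcoordE /tcoord_gen.
have -> : @hact k (opcat C) L x x d' d (idm x) g u = u.
  exact: (@cmap_id k (opcat C) (lev N n)).
rewrite /FL /=; elim/free_ind: (rf_coord b x u) => [|c p q Hp Hq|f].
- by rewrite !linear0.
- by rewrite !linearP /= Hp Hq.
rewrite !flift_gen -[LHS]/(hact M f (did d') (hact M (idm x) g v)).
rewrite -[RHS]/(hact M (idm y) g (hact M f (did d) v)) !hact_cmp cmp1m cmpm1; congr (hact M f _ v).
exact: dhom_eq.
Qed.

Definition level_coord : ctrans (tens L M) (evx M y) :=
  @CTrans k _ (tens L M) (evx M y) (fun d => @tcoord _ _ _ L M d (FL d) b) level_coord_nat.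

Fact level_inj_nat (d d' : opcat Delta) (g : hom d d') v :
  @tinj _ _ _ L M d' (FL d') b (cmap (evx M y) g v) =
    cmap (tens L M) g (@tinj _ _ _ L M d (FL d) b v).
Proof.
have e : @hact k (opcat C) L y y d' d (idm y) g (rf_gen b) = rf_gen b.
  exact: (@cmap_id k (opcat C) (lev N n)).
by apply/esym/(etrans (@act_ten k C L M d' d g y (rf_gen b) v)); rewrite e.
Qed.

Let level_inj_fun (d : opcat Delta) : {linear M (y, d) -> ten_ob L M d} :=
  @tinj_lin _ _ _ L M d (FL d) b.

Definition level_inj : ctrans (evx M y) (tens L M) :=
  @CTrans k _ (evx M y) (tens L M) level_inj_fun level_inj_nat.
End Level.

(** In coordinates, tensoring with N_n is evaluation at the objects [rf_ob b], where f is a weak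
    equivalence. *)
Lemma free_flat : flat_levels N.
Proof.
move=> n M M' f fw.
apply: (@weq_cover k _ _ _ (rf_index (F n)) (fun b => evx M (rf_ob b)) (fun b => evx M' (rf_ob b))
  (fun b => evx_trans f (rf_ob b)) (fun b => level_coord M b) (fun b => level_inj M b)
  (fun b => level_coord M' b) (fun b => level_inj M' b)) => [b d w|b d w|d w|d w|b].
- apply: (ten_ext (f := f (rf_ob b, d) \o level_coord M b d)
    (g := level_coord M' b d \o tens_trans (ctrans_id (cst (opcat Delta) (lev N n))) f d)) w => x u v.
  rewrite -[LHS]/(f _ (tcoord _ _)) -[RHS]/(tcoord _ (tens_trans _ _ _ _)).
  rewrite tens_trans_ten !tcoordE /tcoord_gen /=.
  elim/free_ind: (rf_coord b x u) => [|c p q Hp Hq|g].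
  + by rewrite !linear0.
  + by rewrite !linearP /= Hp Hq.
  by rewrite !flift_gen; apply: (@ctr_nat _ _ _ _ f (x, d) (rf_ob b, d)).
- exact: tens_trans_ten.
- exact: (@tcoord_dec k C (opcat Delta) (cst _ (lev N n)) M d (F n) w).
- exact: (@tcoord_dec k C (opcat Delta) (cst _ (lev N n)) M' d (F n) w).
- exact: fw.
Qed.

Section Exact.
Context (M1 M M2 : cmod k (prodcat C (opcat Delta))) (i : ctrans M1 M) (p : ctrans M M2).
Hypothesis iI : forall x n, injective (i (x, n)).
Hypothesis pi0 : forall x n v, p (x, n) (i (x, n) v) = 0.
Hypothesis ker_p : forall x n v, p (x, n) v = 0 -> exists u, i (x, n) u = v.
Hypothesis pS : forall x n v, exists u, p (x, n) u = v.

Let coord_nat (A A' : cmod k (prodcat C (opcat Delta))) (q : ctrans A A') (n : nat) b w :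
  @tcoord _ _ _ N A' n (F n) b (tens_trans (ctrans_id N) q n w) =
    q (rf_ob b, n) (@tcoord _ _ _ N A n (F n) b w).
Proof.
apply: (ten_ext (f := @tcoord _ _ _ N A' n (F n) b \o tens_trans (ctrans_id N) q n)
   (g := q (rf_ob b, n) \o @tcoord _ _ _ N A n (F n) b)) w => x u v.
rewrite -[LHS]/(tcoord _ (tens_trans _ _ _ _)) -[RHS]/(q _ (tcoord _ _)).
rewrite tens_trans_ten !tcoordE /tcoord_gen.
elim/free_ind: (rf_coord b x u) => [|c y z Hy Hz|g].
- by rewrite !linear0.
- by rewrite !linearP /= Hy Hz.
by rewrite !flift_gen; apply/esym/(@ctr_nat _ _ _ _ q (x, n) (rf_ob b, n)).
Qed.

(** No natural splitting of the sequence is at hand; exactness is checked coordinate by coordinate,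
    each coordinate being an evaluation at an object. *)
Lemma tens_exact_free :
  exact_seq (tens_trans (ctrans_id N) i) (tens_trans (ctrans_id N) p).
Proof.
move=> n; split.
- apply: raddf_inj => w w0; have [s ->] := tcoord_dec (F n) w; apply: big1 => b _.
  have : i (rf_ob b, n) (tcoord (F := F n) b w) = 0 by rewrite -coord_nat w0 linear0.
  by rewrite -(linear0 (i (rf_ob b, n : opcat Delta))) => /iI ->; rewrite linear0.
- move=> w; apply: (ten_ext (f := tens_trans (ctrans_id N) p n \o tens_trans (ctrans_id N) i n)
    (g := \0)) w => x u v.
  rewrite -[LHS]/(tens_trans _ _ _ (tens_trans _ _ _ _)) (tens_trans_ten (ctrans_id N) i).
  by rewrite tens_trans_ten pi0 ten0r.
- move=> w w0.
  have vex b : exists v, i (rf_ob b, n) v = tcoord (F := F n) b w.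
    by apply: ker_p; rewrite -coord_nat w0 linear0.
  pose v b := sval (cid (vex b)).
  have vE b : i (rf_ob b, n) (v b) = tcoord (F := F n) b w := svalP (cid (vex b)).
  have [s wE] := tcoord_dec (F n) w.
  exists (\sum_(b <- s) tinj (F := F n) (b := b) (v b)).
  rewrite [RHS]wE linear_sum; apply: eq_bigr => b _; rewrite -vE.
  exact: tens_trans_ten.
elim/ten_ind => [|c u v [u' <-] [v' <-]|x u v]; first by exists 0; rewrite linear0.
  by exists (c *: u' + v'); rewrite linearP.
by have [v' <-] := pS v; exists (ten u v'); apply: tens_trans_ten.
Qed.
End Exact.
End FreeFlat.

(** * The nerve of the under-categories is free in each degree *)

Section NerveFree.
Context (k : fieldType) (C : category).

Section Root.
Context (x : C) (p : nat) (s : @usimp C x p).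

(** A simplex of the under-category of x amounts to its leg x -> [uob s ord0] and a chain in C. The
    chain is encoded as a simplex under its own first object, with identity as leg there. These
    chains index the basis of the nerve. *)
Definition uroot_simp : @usimp C (uob s ord0) p :=
  @USimp C (uob s ord0) p (uob s) (fun i => @uarr C x p s ord0 i (leq0n i)) (fun i j h => uarr s h)
    (fun i h => uarr_id s h) (fun i j l hij hjl hil => uarr_cmp s hij hjl hil)
    (fun i j h => @uarr_cmp C x p s ord0 i j (leq0n i) h (leq0n j)).

Definition uroot : {y : C & @usimp C y p} := existT _ (uob s ord0) uroot_simp.

Lemma uroot_act : usimp_act (uleg s ord0) (did p) uroot_simp = s.
Proof.
apply: (@usimp_eq C x p (usimp_act (uleg s ord0) (did p) uroot_simp) s erefl) => [i|i j h] /=.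
  exact: uarr_leg.
by congr uarr; apply: bool_irrelevance.
Qed.
End Root.

Lemma act_uroot (x y : C) (p : nat) (f : hom y x) (s : @usimp C x p) :
  uroot_simp (usimp_act f (did p) s) = uroot_simp s.
Proof.
apply: (@usimp_eq C _ p (uroot_simp (usimp_act f (did p) s)) (uroot_simp s) erefl)
  => [i|i j h] /=; congr uarr; exact: bool_irrelevance.
Qed.

Definition ucoord_gen p (b : {y : C & @usimp C y p}) (x : C) (s : @usimp C x p) :
    freemod k (hom x (projT1 b)) :=
  if pselect (uroot s = b) is left e then
    fgen k (eq_rect (uroot s) (fun b => hom x (projT1 b)) (uleg s ord0) b e)
  else 0.

Lemma ucoord_gen_id p (x : C) (s : @usimp C x p) :
  ucoord_gen (uroot s) s = fgen k (uleg s ord0).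
Proof.
rewrite /ucoord_gen; case: pselect => // e.
by rewrite (Prop_irrelevance e erefl).
Qed.

Lemma ucoord_gen_neq p b (x : C) (s : @usimp C x p) : uroot s <> b -> ucoord_gen b s = 0.
Proof. by rewrite /ucoord_gen; case: pselect. Qed.

Lemma ucoord_gen_act p b (x y : C) (f : hom y x) (s : @usimp C x p) :
  ucoord_gen b (usimp_act f (did p) s) = flift (fun g => fgen k (cmp g f)) (ucoord_gen b s).
Proof.
have e : uroot (usimp_act f (did p) s) = uroot s by rewrite /uroot act_uroot.
have [sb|nsb] := pselect (uroot s = b); last first.
  by rewrite !ucoord_gen_neq ?linear0 // e.
rewrite -sb ucoord_gen_id flift_gen /ucoord_gen; case: pselect => // e'.
(* Any proof of the equality gives the same transport. This one is a [congr1], whose elimination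
   computes. *)
congr fgen; rewrite (Prop_irrelevance e' (congr1 (existT _ (uob s ord0)) (act_uroot f s))).
by move: (act_uroot f s); rewrite /uroot; case: _ /.
Qed.

Definition ucoord p b (x : C) : {linear nerve k C (x, p) -> freemod k (hom x (projT1 b))} :=
  flift (@ucoord_gen p b x).

Lemma ractl_nerve p (x x' : C) (f : hom x x') (s : @usimp C x' p) :
  ractl (nerve k C) p f (fgen k s) = fgen k (usimp_act f (did p) s).
Proof. exact: (@nerve_mapE k C (x', p) (x, p) (f, did p) s). Qed.

Lemma ucoord_nat p b (x x' : C) (f : hom x x') n :
  ucoord (p := p) b x (ractl (nerve k C) p f n) =
    flift (fun g => fgen k (cmp g f)) (ucoord b x' n).
Proof.
elim/free_ind: n => [|c u v Hu Hv|s].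
- by rewrite (linear0 (ractl (nerve k C) p f)) !linear0.
- by rewrite (linearP (ractl (nerve k C) p f)) !linearP /= Hu Hv.
have ucE y t : ucoord b y (fgen k t) = ucoord_gen b t by exact: flift_gen.
by rewrite ractl_nerve !ucE -ucoord_gen_act.
Qed.

Lemma ucoord_dec p (x : C) (n : nerve k C (x, p)) :
  exists s : seq {classic {y : C & @usimp C y p}},
    forall s' : seq {classic {y : C & @usimp C y p}}, uniq s' -> {subset s <= s'} ->
      n = \sum_(b <- s') flift (fun f => ractl (nerve k C) p f (fgen k (projT2 b))) (ucoord b x n).
Proof.
elim/free_ind: n => [|c u v [s sP] [s' s'P]|t].
- by exists nil => s _ _; rewrite big1 // => b _; rewrite !linear0.
- exists (s ++ s') => s2 us2 sub.
  rewrite {1}(sP s2) //; last by move=> b bs; apply: sub; rewrite mem_cat bs.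
  rewrite {1}(s'P s2) //; last by move=> b bs; apply: sub; rewrite mem_cat bs orbT.
  by rewrite scaler_sumr -big_split; apply: eq_bigr => b _ /=; rewrite !linearP.
exists [:: uroot t] => s' us' sub.
have ts' : (uroot t : {classic _}) \in s' by apply: sub; rewrite inE.
rewrite (bigD1_seq _ ts') //= big1 ?addr0 => [|b bt]; rewrite /ucoord flift_gen.
  by rewrite ucoord_gen_id flift_gen ractl_nerve uroot_act.
by rewrite ucoord_gen_neq ?linear0 // => e; rewrite e eqxx in bt.
Qed.

Definition nerve_free (p : nat) :
  free_right (fun x y : C => @ractl k C (opcat Delta) (nerve k C) p x y) :=
  @FreeRight k C _ _ {y : C & @usimp C y p} (fun b => projT1 b) (fun b => fgen k (projT2 b))
    (@ucoord p) (@ucoord_nat p) (@ucoord_dec p).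

End NerveFree.

Lemma existT_inj (T : Type) (P : T -> Type) (a : T) (u v : P a) :
  existT P a u = existT P a v -> u = v.
Proof.
move=> e; have := projT2_eq e.
by rewrite (Prop_irrelevance (projT1_eq e) erefl).
Qed.

(** Each arrow is packed with its endpoints, which avoids transports when the objects agree only
    after a case analysis. *)
Lemma usimp_eqT (C : category) (x : C) (p : nat) (s t : @usimp C x p) :
  (forall i, existT (fun y => hom x y) (uob s i) (uleg s i) =
             existT (fun y => hom x y) (uob t i) (uleg t i)) ->
  (forall (i j : 'I_p.+1) (h : (i <= j)%N),
     existT (fun y : C * C => hom y.1 y.2) (uob s i, uob s j) (uarr s h) =
     existT (fun y : C * C => hom y.1 y.2) (uob t i, uob t j) (uarr t h)) ->
  s = t.
Proof.
move=> el ea; have e : uob s = uob t by apply: funext => i; case: (el i).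
case: s t e el ea => ob l a a1 a2 a3 [ob' l' a' a1' a2' a3'] /= e; subst ob' => /= el ea.
apply: (@usimp_eq C x p (USimp a1 a2 a3) (USimp a1' a2' a3') erefl) => [i|i j h] /=.
  exact/existT_inj/el.
exact: (existT_inj (ea i j h)).
Qed.

(** * The extra degeneracy of the under-categories *)

Section Prepend.
Context (C : category) (x : C).

(** The order with a new least element [None]. Matching on an option makes the objects and arrows of
    the prepended simplex reduce, unlike a comparison of ordinals. *)
Definition ole p (a b : option 'I_p) : bool :=
  match a, b with Some i, Some j => (i <= j)%N | Some _, None => false | None, _ => true end.

Lemma ole_unlift p (i j : 'I_p.+1) : (i <= j)%N -> ole (unlift ord0 i) (unlift ord0 j).
Proof.
case: (unliftP ord0 i) => [i' ->|->]; case: (unliftP ord0 j) => [j' ->|->];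
  by rewrite ?liftK ?unlift_none ?lift0.
Qed.

Section Simplex.
Context (p : nat) (s : @usimp C x p).

Definition pre_ob (a : option 'I_p.+1) : C := if a is Some i then uob s i else x.
Definition pre_leg (a : option 'I_p.+1) : hom x (pre_ob a) :=
  if a is Some i then uleg s i else idm x.
Definition pre_arr (a b : option 'I_p.+1) : ole a b -> hom (pre_ob a) (pre_ob b) :=
  match a, b with
  | Some i, Some j => fun h => uarr s h
  | Some i, None => fun h => False_rect _ (notF h)
  | None, Some j => fun=> uleg s j
  | None, None => fun=> idm x
  end.

Fact pre_arr_id a (h : ole a a) : pre_arr h = idm (pre_ob a).
Proof. by case: a h => [i|] h //=; apply: uarr_id. Qed.

Fact pre_arr_cmp a b c (hab : ole a b) (hbc : ole b c) (hac : ole a c) :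
  cmp (pre_arr hbc) (pre_arr hab) = pre_arr hac.
Proof.
case: a b c hab hbc hac => [i|] [j|] [l|] hij hjl hil //=; rewrite ?cmp1m ?cmpm1 //.
- exact: uarr_cmp.
- exact: uarr_leg.
Qed.

Fact pre_arr_leg a b (h : ole a b) : cmp (pre_arr h) (pre_leg a) = pre_leg b.
Proof.
by case: a b h => [i|] [j|] h //=; rewrite ?cmp1m ?cmpm1 //; apply: uarr_leg.
Qed.

(* The extra degeneracy of the nerve of the under-category of x: it prepends the
   initial object. *)
Definition upre : @usimp C x p.+1 :=
  @USimp C x p.+1 (fun i => pre_ob (unlift ord0 i)) (fun i => pre_leg (unlift ord0 i))
    (fun i j h => pre_arr (ole_unlift h)) (fun i h => pre_arr_id _)
    (fun i j l hij hjl hil => pre_arr_cmp _ _ _) (fun i j h => pre_arr_leg _).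
End Simplex.

Lemma upre_face0 p (s : @usimp C x p) :
  usimp_act (idm x) (coface ord0) (upre s) = s.
Proof.
apply: usimp_eqT => [i|i j h] /=; first by rewrite cmpm1 liftK.
by move: (ole_unlift _); rewrite !liftK => h' /=; rewrite (bool_irrelevance h h').
Qed.

(** For f = [coface i] this is d_(i+1) h = h d_i, by [coface_lift0]. *)
Lemma upre_dsucc p q (s : @usimp C x p) (f : dhom q p) :
  usimp_act (idm x) (dsucc f) (upre s) = upre (usimp_act (idm x) f s).
Proof.
have E (i : 'I_q.+2) : unlift ord0 (dsucc_fun (sval f) i) = omap (sval f) (unlift ord0 i).
  by case: (unliftP ord0 i) => [j ->|->]; rewrite ?dsucc_funS ?dsucc_fun0 ?liftK ?unlift_none.
apply: usimp_eqT => [i|i j h] /=.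
  by rewrite cmpm1 E; case: (unlift ord0 i) => //= j; rewrite cmpm1.
move: (ole_unlift _) (ole_unlift _); rewrite !E.
case: (unlift ord0 i) (unlift ord0 j) => [i'|] [j'|] //= h1 h2.
- by congr existT; congr uarr; apply: bool_irrelevance.
- by rewrite cmpm1.
Qed.

Lemma upre_last (s : @usimp C x 0) :
  usimp_act (idm x) (coface (ord_max : 'I_2)) (upre s) = usimp_const x 0.
Proof.
have E (i : 'I_1) : unlift ord0 (lift (ord_max : 'I_2) i) = None.
  by rewrite (ord1 i) -[RHS](unlift_none (ord0 : 'I_2)); congr unlift; apply: val_inj.
apply: usimp_eqT => [i|i j h] /=; first by rewrite E /= cmpm1.
by move: (ole_unlift _); rewrite !E.
Qed.
End Prepend.

(** * Twisted sections and syzygies *)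

Section FreeCover.
Context (k : fieldType) (C : category) (L : cmod k C).

Definition pidx (x : C) : Type := {y : C & (hom y x * L y)%type}.
Definition pelt (x y : C) (f : hom y x) (m : L y) : pidx x := existT _ y (f, m).

Definition pmap (x x' : C) (g : hom x x') : {linear freemod k (pidx x) -> freemod k (pidx x')} :=
  flift (fun t => fgen k (pelt (cmp g (projT2 t).1) (projT2 t).2)).

Lemma pmapE (x x' y : C) (g : hom x x') (f : hom y x) m :
  pmap g (fgen k (pelt f m)) = fgen k (pelt (cmp g f) m).
Proof. exact: flift_gen. Qed.

(* Free on the underlying sets of L, so that no basis of L has to be chosen. *)
Definition free_cover : cmod k C.
Proof.
refine (@CMod k C (fun x => freemod k (pidx x)) pmap _ _).
- move=> x v; apply: (free_ext (f := pmap (idm x)) (g := idfun)) => -[y [f m]].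
  by rewrite pmapE cmp1m.
- move=> x y z g f v; apply: (free_ext (f := pmap (cmp g f)) (g := pmap g \o pmap f)) => -[w [h m]].
  by rewrite -[RHS]/(pmap g (pmap f _)) !pmapE cmpA.
Defined.

Definition pev (x : C) : {linear free_cover x -> L x} :=
  flift (fun t => cmap L (projT2 t).1 (projT2 t).2).

Lemma pevE (x y : C) (f : hom y x) m : pev x (fgen k (pelt f m)) = cmap L f m.
Proof. exact: flift_gen. Qed.

Definition cover_map : ctrans free_cover L.
Proof.
refine (@CTrans k C free_cover L pev _) => x y g v.
apply: (free_ext (f := pev y \o pmap g) (g := cmap L g \o pev x)) => -[w [h m]].
by rewrite -[LHS]/(pev y (pmap g _)) -[RHS]/(cmap L g (pev x _)) pmapE !pevE cmap_cmp.
Defined.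
End FreeCover.

Record pointed_endo (C : category) := PointedEndo {
  eo : C -> C;
  em : forall x y, hom x y -> hom (eo x) (eo y);
  em_id : forall x, em (idm x) = idm (eo x);
  em_cmp : forall x y z (g : hom y z) (f : hom x y), em (cmp g f) = cmp (em g) (em f);
  eta : forall x, hom x (eo x);
  eta_nat : forall x y (f : hom x y), cmp (em f) (eta x) = cmp (eta y) f }.

Section Twisted.
Context (k : fieldType) (C : category) (F : pointed_endo C).

(* A section of the free cover up to eta; for F = id it shows that L is projective. *)
Record twisted_section (L : cmod k C) := TwistedSection {
  ts : forall x, {linear L x -> free_cover L (eo F x)};
  ts_nat : forall x y (f : hom x y) m, ts y (cmap L f m) = cmap (free_cover L) (em F f) (ts x m);
  ts_ev : forall x m, cover_map L (eo F x) (ts x m) = cmap L (eta F x) m }.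

Section Syzygy.
Context (L : cmod k C) (s : twisted_section L).
Let syz := cker (cover_map L).

(* The endomorphism eta - s ev of the free cover, seen as a map to the syzygies, equals
   eta on the syzygies.  It lifts to their free cover because its source is free. *)
Fact tretr_subproof x v : cover_map L (eo F x)
  ((cmap (free_cover L) (eta F x) \- (ts s x \o cover_map L x)) v) = 0.
Proof.
rewrite -[LHS]/(cover_map L _ (cmap _ (eta F x) v - ts s x (cover_map L x v))).
by rewrite linearB ts_ev (@ctr_nat _ _ _ _ (cover_map L) _ _ (eta F x) v) subrr.
Qed.

Definition tretr x : {linear free_cover L x -> syz (eo F x)} := klift (@tretr_subproof x).

Lemma tretr_nat x y (f : hom x y) v :
  tretr y (cmap (free_cover L) f v) = cmap syz (em F f) (tretr x v).
Proof.
apply: val_inj; rewrite -[LHS]/(cmap (free_cover L) (eta F y) (cmap (free_cover L) f v) -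
  ts s y (cover_map L y (cmap (free_cover L) f v))).
rewrite -[RHS]/(cmap (free_cover L) (em F f) (cmap (free_cover L) (eta F x) v -
  ts s x (cover_map L x v))).
by rewrite linearB (@ctr_nat _ _ _ _ (cover_map L) _ _ f v) ts_nat -!cmap_cmp eta_nat.
Qed.

Definition syz_section_free x : {linear free_cover L x -> free_cover syz (eo F x)} :=
  flift (fun t => fgen k (pelt (em F (projT2 t).1)
    (tretr _ (fgen k (pelt (idm (projT1 t)) (projT2 t).2))))).

Lemma syz_section_freeE x y (f : hom y x) m :
  syz_section_free x (fgen k (pelt f m)) =
    fgen k (pelt (em F f) (tretr y (fgen k (pelt (idm y) m)))).
Proof. exact: flift_gen. Qed.

Definition syz_section : twisted_section syz.
Proof.
refine (@TwistedSection syz (fun x => syz_section_free x \o @kval _ _ _ (cover_map L x)) _ _).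
- move=> x y f m; rewrite -[LHS]/(syz_section_free y (cmap (free_cover L) f (kval m))).
  rewrite -[RHS]/(cmap (free_cover syz) _ (syz_section_free x (kval m))).
  apply: (free_ext (f := syz_section_free y \o cmap (free_cover L) f)
    (g := cmap (free_cover syz) (em F f) \o syz_section_free x)) => -[w [h v]].
  rewrite -[LHS]/(syz_section_free y (pmap L f _)) -[RHS]/(pmap syz _ (syz_section_free x _)).
  by rewrite pmapE !syz_section_freeE pmapE em_cmp.
- move=> x m; rewrite -[LHS]/(pev syz _ (syz_section_free x (kval m))).
  have -> : pev syz _ (syz_section_free x (kval m)) = tretr x (kval m).
    apply: (free_ext (f := pev syz _ \o syz_section_free x) (g := tretr x)) => -[w [h v]].
    rewrite -[LHS]/(pev syz _ (syz_section_free x _)) syz_section_freeE pevE -tretr_nat.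
    by rewrite -[cmap _ h _]/(pmap L h _) pmapE cmpm1.
  apply: val_inj; rewrite -[LHS]/(cmap (free_cover L) (eta F x) (kval m) -
    ts s x (cover_map L x (kval m))).
  by rewrite kval0 linear0 subr0.
Defined.
End Syzygy.

Local Notation N0 := (rconst k C).

Section Shift.
Context (L L' : cmod k C) (phi : forall x, {linear L x -> L' (eo F x)}).
Hypothesis phiN : forall x y (f : hom x y) m,
  phi y (cmap L f m) = cmap L' (em F f) (phi x m).
Context (d : opcat Delta).
Local Notation M := (cst (opcat Delta) L).
Local Notation M' := (cst (opcat Delta) L').

Definition shift_gen (x : C) (c : N0 (x, d)) (m : M (x, d)) : ten_ob N0 M' d :=
  @ten _ _ _ N0 M' d (eo F x) c (phi x m).

Fact shift_balanced : balanced shift_gen.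
Proof.
split=> [x m c n n'|x n c m m'|x y f n m]; rewrite /shift_gen.
- by rewrite tenDl tenZl.
- by rewrite linearP tenDr tenZr.
rewrite -[lactl _ d f m]/(cmap L f m) phiN.
exact: (@ten_act k C (opcat Delta) N0 M' d (eo F x) (eo F y) (em F f) n (phi x m)).
Qed.

(** A scalar attached to x may be read at [eo F x] because the right module is constant. Hence a
    family that is natural only along F still induces a map. *)
Definition shift : ten_ob N0 M d -> ten_ob N0 M' d := plift (balanced_respects shift_balanced).
HB.instance Definition _ := GRing.Linear.on shift.

Lemma shiftE x c m : shift (@ten _ _ _ N0 M d x c m) = @ten _ _ _ N0 M' d (eo F x) c (phi x m).
Proof. exact: plift_gen. Qed.
End Shift.

(* Balancing over the constant module makes the shift along eta the identity of the
   tensor product, so that eta - s ev and s become a splitting. *)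
Lemma const_exact (L : cmod k C) : twisted_section L ->
  exact_seq (tens_trans (ctrans_id N0) (cst_trans (opcat Delta) (cker_incl (cover_map L))))
            (tens_trans (ctrans_id N0) (cst_trans (opcat Delta) (cover_map L))).
Proof.
move=> s n.
pose K := cst (opcat Delta) (cker (cover_map L)).
pose P := cst (opcat Delta) (free_cover L).
pose M := cst (opcat Delta) L.
pose i := tens_trans (ctrans_id N0) (cst_trans (opcat Delta) (cker_incl (cover_map L))) n.
pose q := tens_trans (ctrans_id N0) (cst_trans (opcat Delta) (cover_map L)) n.
pose r := shift (d := n) (@tretr_nat L s).
pose t := shift (d := n) (@ts_nat L s).
have iE x c v : i (@ten _ _ _ N0 K n x c v) = @ten _ _ _ N0 P n x c (kval v).
  exact: tens_trans_ten.
have qE x c v : q (@ten _ _ _ N0 P n x c v) = @ten _ _ _ N0 M n x c (cover_map L x v).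
  exact: tens_trans_ten.
have rE x c v : r (@ten _ _ _ N0 P n x c v) = @ten _ _ _ N0 K n (eo F x) c (tretr s x v).
  exact: shiftE.
have tE x c v : t (@ten _ _ _ N0 M n x c v) = @ten _ _ _ N0 P n (eo F x) c (ts s x v).
  exact: shiftE.
have etaE (L' : cmod k C) x c v :
    @ten _ _ _ N0 (cst (opcat Delta) L') n (eo F x) c (cmap L' (eta F x) v) =
    @ten _ _ _ N0 (cst (opcat Delta) L') n x c v.
  exact/esym/(@ten_act k C (opcat Delta) N0 (cst (opcat Delta) L') n x (eo F x) (eta F x) c v).
have ri u : r (i u) = u.
  apply: (ten_ext (f := shift (d := n) (@tretr_nat L s) \o i) (g := idfun)) u => x c v.
  rewrite -[LHS]/(r (i _)) iE rE -[RHS]etaE; congr ten; apply: val_inj.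
  rewrite -[LHS]/(cmap (free_cover L) (eta F x) (kval v) - ts s x (cover_map L x (kval v))).
  by rewrite kval0 linear0 subr0.
have irt u : i (r u) + t (q u) = u.
  apply: (ten_ext (f := (i \o shift (d := n) (@tretr_nat L s)) \+ (shift (d := n) (@ts_nat L s) \o q))
    (g := idfun)) u => x c v.
  rewrite -[LHS]/(i (r _) + t (q _)) rE qE tE iE -tenDr -[RHS]etaE; congr ten.
  exact: subrK.
split.
- exact: can_inj ri.
- move=> u; apply: (ten_ext (f := q \o i) (g := \0)) u => x c v.
  by rewrite -[LHS]/(q (i _)) iE qE kval0 ten0r.
- move=> u qu; exists (r u); rewrite -[RHS]irt [q u]qu.
  by have -> : t 0 = 0 by [exact: linear0]; rewrite addr0.
elim/ten_ind => [|c u v [u' <-] [v' <-]|x u v]; first by exists 0; rewrite linear0.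
  by exists (c *: u' + v'); rewrite linearP.
exists (@ten _ _ _ N0 P n x u (fgen k (pelt (idm x) v))).
rewrite -[LHS]/(q _) qE; congr ten; rewrite -[LHS]/(pev L x _) pevE; exact: cmap_id.
Qed.

Section CoverContraction.
Context (L : cmod k C).
Local Notation N := (nerve k C).
Local Notation P := (cst (opcat Delta) (free_cover L)).

Section Degree.
Variable n : nat.

(** The tensor product of the nerve with the free cover is a sum of copies of k[N(y | C)], one for
    each m in L y, and each is contracted by prepending y. As [upre] is not natural in the root, s
    is first pulled back along f from x to y. *)
Definition contr_elt (x y : C) (f : hom y x) (m : L y) : {linear N (x, n) -> tens N P n.+1} :=
  flift (fun s => @ten _ _ _ N P n.+1 y (fgen k (upre (usimp_act f (did n) s)))
                    (fgen k (pelt (idm y) m))).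

Lemma contr_eltE (x y : C) (f : hom y x) (m : L y) s :
  contr_elt f m (fgen k s) = @ten _ _ _ N P n.+1 y (fgen k (upre (usimp_act f (did n) s)))
    (fgen k (pelt (idm y) m)).
Proof. exact: flift_gen. Qed.

Definition contr_gen (x : C) (u : N (x, n)) (v : P (x, n)) : tens N P n.+1 :=
  flift (fun t => contr_elt (projT2 t).1 (projT2 t).2 u) v.

Fact contr_balanced : balanced contr_gen.
Proof.
split=> [x v c u u'|x u c v v'|x y f u v]; rewrite /contr_gen.
- by rewrite -flift_add; congr (flift _ v); apply: funext => t; rewrite linearP.
- by rewrite linearP.
elim/free_ind: v => [|c v v' Hv Hv'|[w [g m]]].
- by rewrite !linear0.
- by rewrite !linearP /= Hv Hv'.
rewrite -[lactl P n f _]/(pmap L f _) pmapE !flift_gen.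
rewrite -[LHS]/(contr_elt g m (ractl N n f u)) -[RHS]/(contr_elt (cmp f g) m u).
elim/free_ind: u => [|c u u' Hu Hu'|s].
- by rewrite !linear0.
- by rewrite !linearP /= Hu Hu'.
have e : usimp_act g (did n) (usimp_act f (did n) s) = usimp_act (cmp f g) (did n) s.
  by apply: (@usimp_eq C w n (usimp_act g (did n) (usimp_act f (did n) s))
    (usimp_act (cmp f g) (did n) s) erefl) => [i|i j h] /=; rewrite ?cmpA //;
    congr uarr; apply: bool_irrelevance.
apply: etrans (congr1 _ (ractl_nerve k f s)) _; apply: etrans (contr_eltE g m _) _.
by rewrite e; apply/esym/contr_eltE.
Qed.

Definition contr : tens N P n -> tens N P n.+1 := plift (balanced_respects contr_balanced).
HB.instance Definition _ := GRing.Linear.on contr.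

Lemma contrE (x y : C) (s : @usimp C x n) (f : hom y x) (m : L y) :
  contr (@ten _ _ _ N P n x (fgen k s) (fgen k (pelt f m))) =
    @ten _ _ _ N P n.+1 y (fgen k (upre (usimp_act f (did n) s))) (fgen k (pelt (idm y) m)).
Proof. by rewrite /contr plift_gen /ten_lift /contr_gen /contr_elt /= !flift_gen. Qed.
End Degree.

Definition contr0_elt (x : C) (t : pidx L x) : tens N P 0%N :=
  @ten _ _ _ N P 0%N (projT1 t) (fgen k (@usimp_const C (projT1 t) 0))
    (fgen k (pelt (idm (projT1 t)) (projT2 t).2)).

Definition contr0_gen (x : C) (c : N0 (x, 0%N)) (v : P (x, 0%N)) : tens N P 0%N :=
  (c : k) *: flift (@contr0_elt x) v.

Fact contr0_balanced : @balanced k C (opcat Delta) N0 P 0%N _ contr0_gen.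
Proof.
split=> [x v c u u'|x u c v v'|x y f u v]; rewrite /contr0_gen.
- by rewrite scalerDl scalerA.
- by rewrite linearP scalerDr !scalerA mulrC.
congr (_ *: _); elim/free_ind: v => [|c v v' Hv Hv'|[w [g m]]].
- by rewrite !linear0.
- by rewrite !linearP /= Hv Hv'.
by rewrite -[lactl P _ f _]/(pmap L f _) pmapE !flift_gen.
Qed.

Definition contr0 : tens N0 P 0%N -> tens N P 0%N := plift (balanced_respects contr0_balanced).
HB.instance Definition _ := GRing.Linear.on contr0.

Lemma contr0E (x y : C) c (f : hom y x) (m : L y) :
  contr0 (@ten _ _ _ N0 P 0%N x c (fgen k (pelt f m))) =
    c *: @ten _ _ _ N P 0%N y (fgen k (@usimp_const C y 0)) (fgen k (pelt (idm y) m)).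
Proof. by rewrite /contr0 plift_gen /ten_lift /contr0_gen /= flift_gen. Qed.

Lemma cover_ext n (W : lmodType k) (f g : {linear ten_ob N P n -> W}) :
  (forall (x y : C) (s : @usimp C x n) (h : hom y x) m,
    f (@ten _ _ _ N P n x (fgen k s) (fgen k (pelt h m))) =
    g (@ten _ _ _ N P n x (fgen k s) (fgen k (pelt h m)))) -> f =1 g.
Proof.
move=> fg; apply: ten_ext => x u v.
elim/free_ind: u => [|c u u' Hu Hu'|s]; first by rewrite ten0l !linear0.
  by rewrite tenDl tenZl !linearP /= Hu Hu'.
elim/free_ind: v => [|c v v' Hv Hv'|[y [h m]]]; first by rewrite ten0r !linear0.
  by rewrite tenDr tenZr !linearP /= Hv Hv'.
exact: fg.
Qed.

Lemma act_cover m n (g : dhom m n) (x : C) (s : @usimp C x n) v :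
  act (tens N P) g (@ten _ _ _ N P n x (fgen k s) v) =
    @ten _ _ _ N P m x (fgen k (usimp_act (idm x) g s)) v.
Proof.
rewrite act_ten; congr ten; last exact: (@cmap_id k C (free_cover L)).
exact: (@nerve_mapE k C (x, n) (x, m) (idm x, g)).
Qed.

Lemma ten_shift n (x y : C) (s : @usimp C x n) (f : hom y x) m :
  @ten _ _ _ N P n y (fgen k (usimp_act f (did n) s)) (fgen k (pelt (idm y) m)) =
  @ten _ _ _ N P n x (fgen k s) (fgen k (pelt f m)).
Proof.
rewrite -ractl_nerve ten_act; congr ten.
by rewrite -[LHS]/(pmap L f _) pmapE cmpm1.
Qed.

Lemma usimp_act2 (x y : C) (a b : nat) (g : dhom a b) (f : hom y x) (s : @usimp C x b) :
  usimp_act (idm y) g (usimp_act f (did b) s) = usimp_act f (did a) (usimp_act (idm x) g s).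
Proof.
apply: (@usimp_eq C y a (usimp_act (idm y) g (usimp_act f (did b) s))
  (usimp_act f (did a) (usimp_act (idm x) g s)) erefl) => [i|i j h] /=.
  by rewrite !cmpm1.
by congr uarr; apply: bool_irrelevance.
Qed.

Lemma weq_cover_contraction : weq (tens_trans (augm k C) (ctrans_id P)).
Proof.
apply: (@extra_degeneracy _ _ _ _ contr contr0).
- move=> m n f g; apply: (ten_ext (f := act (tens N0 P) f) (g := act (tens N0 P) g)) => x u v.
  by rewrite !act_ten.
- by move=> n; rewrite linear0.
- by rewrite linear0.
- move=> n; apply: (cover_ext (f := act (tens N P) (coface ord0) \o @contr n)
    (g := idfun)) => x y s h m.
  by rewrite -[LHS]/(act _ _ (contr _)) contrE act_cover upre_face0 ten_shift.
- move=> n i; apply: (cover_ext (f := act (tens N P) (coface (lift ord0 i)) \o @contr n.+1)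
    (g := @contr n \o act (tens N P) (coface i))) => x y s h m.
  rewrite -[LHS]/(act _ _ (contr _)) -[RHS]/(contr (act _ _ _)) contrE !act_cover contrE.
  by rewrite coface_lift0 upre_dsucc usimp_act2.
- apply: (cover_ext (f := act (tens N P) (coface (ord_max : 'I_2)) \o @contr 0)
    (g := contr0 \o tens_trans (augm k C) (ctrans_id P) 0%N)) => x y s h m.
  rewrite -[LHS]/(act _ _ (contr _)) -[RHS]/(contr0 (tens_trans _ _ _ _)) contrE.
  rewrite act_cover upre_last (tens_trans_ten (augm k C)).
  have -> : augm k C (x, 0%N : opcat Delta) (fgen k s) = 1 by exact: flift_gen.
  by rewrite contr0E scale1r.
- apply: (ten_ext (f := tens_trans (augm k C) (ctrans_id P) 0%N \o contr0)
    (g := idfun)) => x c v.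
  rewrite -[LHS]/(tens_trans _ _ _ (contr0 _)).
  elim/free_ind: v => [|a v v' Hv Hv'|[y [h m]]]; first by rewrite ten0r !linear0.
    by rewrite tenDr tenZr !linearP /= Hv Hv'.
  rewrite contr0E linearZ.
  rewrite (@tens_trans_ten k C N N0 P P (augm k C) (ctrans_id P) 0%N y).
  have -> : augm k C (y, 0%N : opcat Delta) (fgen k (usimp_const y 0)) = 1 by exact: flift_gen.
  have e : @ten _ _ _ N0 P 0%N y c (fgen k (pelt (idm y) m)) =
      @ten _ _ _ N0 P 0%N x c (fgen k (pelt h m)).
    apply: etrans (@ten_act k C (opcat Delta) N0 P 0%N y x h c (fgen k (pelt (idm y) m))) _.
    by rewrite -[lactl P _ h _]/(pmap L h _) pmapE cmpm1.
  rewrite -[RHS]e; apply/esym.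
  apply: etrans (@tenZl k C (opcat Delta) N0 P 0%N y c 1 (fgen k (pelt (idm y) m))).
  by congr ten; apply/esym/mulr1.
Qed.
End CoverContraction.

Inductive twisted_class : forall U V : smod k, ctrans U V -> Prop :=
| TwistedClass L : twisted_section L ->
    twisted_class (tens_trans (augm k C) (ctrans_id (cst (opcat Delta) L))).

(** Dimension shifting along the syzygies. The row over the nerve is exact because the nerve is free
    in each degree, the row over k because of the twisted section. *)
Theorem weq_augm_twisted L : twisted_section L ->
  weq (tens_trans (augm k C) (ctrans_id (cst (opcat Delta) L))).
Proof.
move=> s; apply: (@dimension_shift k twisted_class); last exact: TwistedClass.
move=> _ _ _ [{s}L s].
exists (tens (nerve k C) (cst _ (cker (cover_map L)))), (tens N0 (cst _ (cker (cover_map L)))).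
exists (tens (nerve k C) (cst _ (free_cover L))), (tens N0 (cst _ (free_cover L))).
exists (tens_trans (augm k C) (ctrans_id _)), (tens_trans (augm k C) (ctrans_id _)).
exists (tens_trans (ctrans_id _) (cst_trans _ (cker_incl (cover_map L)))).
exists (tens_trans (ctrans_id _) (cst_trans _ (cover_map L))).
exists (tens_trans (ctrans_id _) (cst_trans _ (cker_incl (cover_map L)))).
exists (tens_trans (ctrans_id _) (cst_trans _ (cover_map L))).
split.
- exact/TwistedClass/syz_section.
- exact: weq_cover_contraction.
- apply: tens_exact_free => [n|x n|x n v|x n v v0|x n v].
  + exact: nerve_free.
  + exact: val_inj.
  + exact: kval0.
  + by exists (Kerm (introT eqP v0 : v \in kerb _)).
  exists (fgen k (pelt (idm x) v)); rewrite -[LHS]/(pev L x _) pevE; exact: cmap_id.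
- exact: const_exact.
- by split; apply: tens_trans_square.
Qed.
End Twisted.

(** * Tensor powers *)

Section LinearSection.
Context (k : fieldType) (U : lmodType k).

Definition psection (G : set (U * freemod k U)) : Prop :=
  [/\ forall c u v w z, G (u, w) -> G (v, z) -> G (c *: u + v, c *: w + z),
      forall u w, G (u, w) -> flift id w = u & forall w, G (0, w) -> w = 0].

Lemma psection_fun G u w z : psection G -> G (u, w) -> G (u, z) -> w = z.
Proof.
case=> Glin _ G0 Gw Gz; apply/eqP; rewrite -subr_eq0; apply/eqP/G0.
have := Glin (-1) u u z w Gz Gw.
by rewrite !scaleN1r addNr addrC.
Qed.

(* A maximal partial linear section of the surjection k[U] -> U is total. *)
Lemma linear_section : exists f : {linear U -> freemod k U}, forall u, flift id (f u) = u.
Proof.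
have [|G [hG Gmax]] := @Zorn_bigcup (U * freemod k U)%type psection.
  move=> F Fsec Ftot; split=> [c u v w z [G FG Gw] [H FH Hz]|u w [G FG Gw]|w [G FG Gw]].
  - case: (Ftot _ _ FG FH) => s; [exists H|exists G] => //.
      by case: (Fsec _ FH) => Hlin _ _; apply: Hlin => //; apply: s.
    by case: (Fsec _ FG) => Glin _ _; apply: Glin => //; apply: s.
  - by case: (Fsec _ FG) => _ h _; apply: h.
  - by case: (Fsec _ FG) => _ _ h; apply: h.
have [Glin Gsec G0w] := hG.
(* Since the empty graph satisfies [psection], this has to come from maximality. *)
have G0 : G (0, 0).
  apply: contrapT => nG0; case: (Gmax (G `|` [set (0, 0)])%classic).
    by split=> [x Gx|/(_ (0, 0))h]; [left|apply: nG0; apply: h; right].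
  split=> [c u v w z|u w|w].
  - case=> [Gw|[-> ->]] [Gz|[-> ->]].
    + by left; apply: Glin.
    (* Scaling without (0, 0) at hand: c u = (c - 1) u + u. *)
    + left; have := Glin (c - 1) _ _ _ _ Gw Gw.
      by rewrite !scalerBl !scale1r !subrK !addr0.
    + by left; rewrite !scaler0 !add0r.
    + by right; rewrite !scaler0 !addr0.
  - by case=> [/Gsec//|[-> ->]]; rewrite linear0.
  - by case=> [/G0w//|[]].
have dom u : exists w, G (u, w).
  apply: contrapT => nGu.
  (* G is extended to u by the tautological lift, the generator of k[U] given by u itself. *)
  pose H := [set x : U * freemod k U | exists c d e,
    [/\ G (d, e), x.1 = c *: u + d & x.2 = c *: fgen k u + e]]%classic.
  case: (Gmax H).
    split=> [[v w] Gvw|/(_ (u, fgen k u)) h].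
      by exists 0, v, w; rewrite !scale0r !add0r.
    by apply: nGu; exists (fgen k u); apply: h; exists 1, 0, 0; rewrite !scale1r !addr0.
  split=> [a v v' w w'|v w|w].
  - move=> [c [d [e [Gde /= -> ->]]]] [c' [d' [e' [Gde' /= -> ->]]]].
    exists (a * c + c'), (a *: d + d'), (a *: e + e'); split; first exact: Glin.
      by rewrite /= scalerDl scalerDr scalerA addrACA.
    by rewrite /= scalerDl scalerDr scalerA addrACA.
  - move=> [c [d [e [Gde /= -> ->]]]]; rewrite linearP /= (Gsec _ _ Gde).
    by have -> : flift id (fgen k u) = u by exact: flift_gen.
  - move=> [c [d [e [Gde /= ud ->]]]]; have [c0|c0] := eqVneq c 0.
      by move: ud Gde; rewrite c0 !scale0r !add0r => <- /G0w.
    case: nGu; exists ((- c^-1) *: e); have := Glin (- c^-1) _ _ _ _ Gde G0.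
    rewrite !addr0; congr (G (_, _)); move: ud => /esym/eqP; rewrite addrC addr_eq0 => /eqP ->.
    by rewrite scalerN scaleNr opprK scalerA mulVf // scale1r.
have [f fG] := choice dom.
have flin : linear f.
  move=> c u v; apply: (psection_fun hG (fG _)); exact: Glin.
pose fl : {linear U -> freemod k U} :=
  HB.pack f (GRing.isLinear.Build k U (freemod k U) _ f flin).
exists fl => u.
exact: Gsec (fG u).
Qed.
End LinearSection.

Definition unitcat : category :=
  @Category unit (fun _ _ => unit) (fun _ => tt) (fun _ _ _ _ _ => tt)
    (fun _ _ f => match f with tt => erefl end) (fun _ _ f => match f with tt => erefl end)
    (fun _ _ _ _ _ _ _ => erefl).

Section Inflate.
Context (k : fieldType).

Definition inflate (C : category) (X : smod k) : cmod k (prodcat C (opcat Delta)) :=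
  @CMod k (prodcat C (opcat Delta)) (fun a => X a.2) (fun a b f => cmap X f.2)
    (fun a x => cmap_id x) (fun a b c g f x => cmap_cmp g.2 f.2 x).

Definition inflate_trans (C : category) (X Y : smod k) (f : ctrans X Y) :
  ctrans (inflate C X) (inflate C Y) :=
  @CTrans k _ (inflate C X) (inflate C Y) (fun a => f a.2) (fun a b g x => ctr_nat f g.2 x).

(** Over a field, a vector space U is a retract of k[U] by [linear_section]. All elements of U serve
    as generators, and the coordinates are the coefficients of the section. *)
Lemma inflate_flat (X : smod k) : flat_levels (C := unitcat) (inflate (opcat unitcat) X).
Proof.
apply: free_flat => n; pose U := X n; have [f fK] := cid (@linear_section k U).
pose L (x : unitcat) : lmodType k := inflate (opcat unitcat) X (x, n : opcat Delta).
have rE (x y : unitcat) (g : hom x y) u :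
    ractl (inflate (opcat unitcat) X) (n : opcat Delta) g u = u.
  exact: (@cmap_id k (opcat Delta) X n).
have cl (b : U) : linear (fun u : U => mcoeff (b : {classic U}) (f u) *: fgen k tt).
  by move=> c u v; rewrite linearP mcoeffD mcoeffZ scalerDl scalerA.
pose coord (b : U) (x : unitcat) : {linear L x -> freemod k unit} :=
  HB.pack (fun u : U => mcoeff (b : {classic U}) (f u) *: fgen k tt)
    (GRing.isLinear.Build k U (freemod k unit) _ _ (cl b)).
apply: (@FreeRight k unitcat L (fun x y => @ractl k unitcat (opcat Delta) (inflate (opcat unitcat) X) n x y)
  U (fun=> tt) (fun b => b) coord) => [b x x' g u|x u].
  rewrite rE /= linearZ /=; congr (_ *: _).
  by apply/esym/(@flift_gen k unit (freemod k unit)).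
exists (msupp (f u)) => s us sub.
have E b : flift (fun g => ractl (inflate (opcat unitcat) X) (n : opcat Delta) g b) (coord b x u) =
    mcoeff (b : {classic U}) (f u) *: b.
  rewrite /= linearZ /=; congr (_ *: _); rewrite -[RHS](rE x tt tt).
  by apply: (@flift_gen k unit U).
under eq_bigr do rewrite E.
rewrite -[LHS]fK /flift [RHS](bigID (mem (msupp (f u)))) /= [X in _ + X]big1 ?addr0; last first.
  by move=> b bs; rewrite mcoeff_outdom // scale0r.
rewrite -[RHS]big_filter; apply: perm_big; apply: uniq_perm.
- exact: fset_uniq.
- exact: filter_uniq.
by move=> b; rewrite mem_filter; have [/sub ->|] := boolP (b \in msupp (f u)).
Qed.
End Inflate.

(** * Tensor products over the field *)

Section OrdinaryTensor.
Context (k : fieldType).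

Definition otens (X Y : smod k) : smod k :=
  tens (C := unitcat) (inflate (opcat unitcat) X) (inflate unitcat Y).

Definition oten (X Y : smod k) (n : nat) (x : X n) (y : Y n) : otens X Y n :=
  @ten k unitcat (opcat Delta) (inflate (opcat unitcat) X) (inflate unitcat Y) n tt x y.

Definition otens_trans (X X' Y Y' : smod k) (f : ctrans X X') (g : ctrans Y Y') :
  ctrans (otens X Y) (otens X' Y') :=
  @tens_trans k unitcat _ _ _ _ _ (inflate_trans (opcat unitcat) f) (inflate_trans unitcat g).

Lemma otens_transE (X X' Y Y' : smod k) (f : ctrans X X') (g : ctrans Y Y') n x y :
  otens_trans f g n (oten x y) = oten (f n x) (g n y).
Proof. exact: tens_trans_ten. Qed.

Lemma otens_ext (X Y : smod k) n (W : lmodType k) (f g : {linear otens X Y n -> W}) :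
  (forall x y, f (oten x y) = g (oten x y)) -> f =1 g.
Proof. by move=> fg; apply: ten_ext => -[]; apply: fg. Qed.

Lemma act_oten (X Y : smod k) m n (g : dhom m n) x y :
  act (otens X Y) g (oten x y) = oten (act X g x) (act Y g y).
Proof. exact: act_ten. Qed.

Section Lift.
Context (X Y : smod k) (n : nat) (W : lmodType k) (F : X n -> Y n -> W).
Hypothesis Fl : forall y, linear (F^~ y).
Hypothesis Fr : forall x, linear (F x).

Fact otens_balanced : @balanced k unitcat (opcat Delta) (inflate (opcat unitcat) X)
  (inflate unitcat Y) n W (fun=> F).
Proof.
split=> [x m|x u|x y f u v]; [exact: Fl|exact: Fr|].
have -> : ractl (inflate (opcat unitcat) X) (n : opcat Delta) f u = u.
  exact: (@cmap_id k (opcat Delta) X n).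
have -> : lactl (inflate unitcat Y) (n : opcat Delta) f v = v.
  exact: (@cmap_id k (opcat Delta) Y n).
by [].
Qed.

Definition otens_lift : {linear otens X Y n -> W} := plift (balanced_respects otens_balanced).

Lemma otens_liftE x y : otens_lift (oten x y) = F x y.
Proof. exact: plift_gen. Qed.
End Lift.

Lemma oten_linl (X Y : smod k) n (y : Y n) : linear (fun x : X n => oten x y).
Proof. by move=> c x x'; rewrite /oten tenDl tenZl. Qed.

Lemma oten_linr (X Y : smod k) n (x : X n) : linear (@oten X Y n x).
Proof. by move=> c y y'; rewrite /oten tenDr tenZr. Qed.

Section Swap.
Context (X Y : smod k).

Definition swap_fun n : {linear otens X Y n -> otens Y X n} :=
  otens_lift (fun y => @oten_linr Y X n y) (fun x => @oten_linl Y X n x).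

Fact swap_nat (m n : opcat Delta) (g : hom m n) w :
  swap_fun n (cmap (otens X Y) g w) = cmap (otens Y X) g (swap_fun m w).
Proof.
apply: (otens_ext (f := swap_fun n \o cmap (otens X Y) g)
  (g := cmap (otens Y X) g \o swap_fun m)) => x y.
rewrite -[LHS]/(swap_fun n (act _ g (oten x y))) -[RHS]/(act _ g (swap_fun m (oten x y))).
by rewrite act_oten /swap_fun !otens_liftE act_oten.
Qed.

Definition swap : ctrans (otens X Y) (otens Y X) :=
  @CTrans k _ (otens X Y) (otens Y X) swap_fun swap_nat.

Lemma swapE n x y : swap n (oten x y) = oten y x.
Proof. exact: otens_liftE. Qed.
End Swap.

Lemma swapK (X Y : smod k) n : cancel (swap X Y n) (swap Y X n).
Proof.
move=> w; apply: (otens_ext (f := swap Y X n \o swap X Y n) (g := idfun)) => x y.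
by rewrite -[LHS]/(swap _ _ _ (swap _ _ _ _)) !swapE.
Qed.

Lemma weq_swap (X Y : smod k) : weq (swap X Y).
Proof. by apply: weq_bij => n; exists (swap Y X n); apply: swapK. Qed.

Lemma weq_otens_right (X Y Y' : smod k) (g : ctrans Y Y') :
  weq g -> weq (otens_trans (ctrans_id X) g).
Proof.
move=> gw; have {}gw : pointwise_weq (inflate_trans unitcat g).
  by move=> x; apply/weqP => n; move/weqP: gw => /(_ n).
have idw : weq (ctrans_id (otens X Y)) by apply: weq_bij => n; exists id.
apply: (weq_comp _ idw (weq_tens_right gw (@inflate_flat k X))) => n w.
apply: (ten_ext (f := tens_trans (ctrans_id _) (inflate_trans unitcat g) n)
  (g := otens_trans (ctrans_id X) g n)) => -[] x y.
by rewrite [LHS]tens_trans_ten [RHS]tens_trans_ten.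
Qed.

(** The second factor is varied by [weq_otens_right], the first one after conjugation with the
    swap. *)
Lemma weq_otens (X X' Y Y' : smod k) (f : ctrans X X') (g : ctrans Y Y') :
  weq f -> weq g -> weq (otens_trans f g).
Proof.
move=> fw gw; apply: (@weq_comp _ _ _ _ (otens_trans (ctrans_id X) g)
  (otens_trans f (ctrans_id Y'))) => [n w||].
- apply: (otens_ext (f := otens_trans f (ctrans_id Y') n \o otens_trans (ctrans_id X) g n)
    (g := otens_trans f g n)) => x y.
  by rewrite -[LHS]/(otens_trans _ _ _ (otens_trans _ _ _ _)) !otens_transE.
- exact: weq_otens_right.
apply: (@weq_right _ _ _ _ _ (swap _ _)
  (ctrans_cmp (otens_trans (ctrans_id Y') f) (swap X Y'))) => [n w||].
- apply: (otens_ext (f := swap _ _ n \o otens_trans f (ctrans_id Y') n)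
    (g := otens_trans (ctrans_id Y') f n \o swap _ _ n)) => x y.
  rewrite -[LHS]/(swap _ _ _ (otens_trans _ _ _ _)) -[RHS]/(otens_trans _ _ _ (swap _ _ _ _)).
  by rewrite otens_transE !swapE otens_transE.
- exact: weq_swap.
- apply: (@weq_comp _ _ _ _ (swap X Y') (otens_trans (ctrans_id Y') f)) => //.
  + exact: weq_swap.
  + exact: weq_otens_right.
Qed.
End OrdinaryTensor.

Section TensorPowers.
Context (k : fieldType).

Definition cons_fun (V : Type) n (v : V) (b : 'I_n -> V) (i : 'I_n.+1) : V :=
  if unlift ord0 i is Some j then b j else v.

Lemma cons_fun0 (V : Type) n (v : V) (b : 'I_n -> V) : cons_fun v b ord0 = v.
Proof. by rewrite /cons_fun unlift_none. Qed.
Lemma cons_funS (V : Type) n (v : V) (b : 'I_n -> V) j : cons_fun v b (lift ord0 j) = b j.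
Proof. by rewrite /cons_fun liftK. Qed.

Lemma cons_fun_map (V W : Type) n (f : V -> W) (v : V) (b : 'I_n -> V) :
  (fun i => f (cons_fun v b i)) = cons_fun (f v) (fun j => f (b j)).
Proof.
by apply: funext => i; case: (unliftP ord0 i) => [j ->|->]; rewrite ?cons_funS ?cons_fun0.
Qed.

Lemma cons_fun_eta (V : Type) n (b : 'I_n.+1 -> V) :
  cons_fun (b ord0) (fun j => b (lift ord0 j)) = b.
Proof.
by apply: funext => i; case: (unliftP ord0 i) => [j ->|->]; rewrite ?cons_funS ?cons_fun0.
Qed.

Lemma cons_upd (V : Type) n (v : V) (b : 'I_n -> V) i x :
  cons_fun v (upd b i x) = upd (cons_fun v b) (lift ord0 i) x.
Proof.
apply: funext => j; rewrite /upd; case: (unliftP ord0 j) => [l ->|->].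
  by rewrite !cons_funS (inj_eq lift_inj).
by rewrite !cons_fun0.
Qed.

Lemma cons_upd0 (V : Type) n (v x : V) (b : 'I_n -> V) :
  upd (cons_fun v b) ord0 x = cons_fun x b.
Proof.
apply: funext => j; rewrite /upd; case: (unliftP ord0 j) => [l ->|->].
  by rewrite !cons_funS eq_sym (negPf (neq_lift _ _)).
by rewrite eqxx cons_fun0.
Qed.

Section Cons.
Context (V : lmodType k) (n : nat).

Fact tcons_multilinear (v : V) : multilinear (fun b : 'I_n -> V => tensor (cons_fun v b)).
Proof. by move=> b i c x y; rewrite !cons_upd; apply: tensor_multilinear. Qed.

Definition tcons (v : V) : {linear tpow V n -> tpow V n.+1} :=
  plift (multilinear_respects (tcons_multilinear v)).

Lemma tconsE v b : tcons v (tensor b) = tensor (cons_fun v b).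
Proof. exact: plift_gen. Qed.

Lemma tcons_linl (t : tpow V n) : linear (fun v => tcons v t).
Proof.
move=> c x y; apply: (pres_ext (f := tcons (c *: x + y)) (g := c \*: tcons x \+ tcons y)) => b.
rewrite -[LHS]/(tcons _ (tensor b)) -[RHS]/(c *: tcons x (tensor b) + tcons y (tensor b)).
rewrite !tconsE; have := tensor_multilinear (cons_fun (0 : V) b) ord0 c x y.
by rewrite !cons_upd0.
Qed.
End Cons.

Definition tpows (A : salg k) (n : nat) : smod k := evx (bsymp A) (n : DeltaSp).
Definition tpows_trans (A B : salg k) (f : atrans A B) n : ctrans (tpows A n) (tpows B n) :=
  evx_trans (bsymp_trans f) (n : DeltaSp).

Lemma act_tpows (A : salg k) n p q (g : dhom p q) (b : 'I_n -> A q) :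
  act (tpows A n) g (tensor b) = tensor (fun j => amap A (g : @hom (opcat Delta) q p) (b j)).
Proof.
rewrite [LHS]bsym_map_tensor; congr tensor; apply: funext => j.
by rewrite sword_mk big_seq1.
Qed.

Section ConsTrans.
Context (A : salg k) (n : nat).
Local Notation X := (calg_mod A).

Definition tconss_fun (p : nat) : {linear otens X (tpows A n) p -> tpows A n.+1 p} :=
  otens_lift (X := X) (Y := tpows A n) (F := fun (v : A p) (t : tpow (A p) n) => tcons n v t)
    (fun t => tcons_linl t) (fun v => linearP (tcons n v)).

Lemma tconss_funE p (v : A p) (b : 'I_n -> A p) :
  tconss_fun p (oten (X := X) (Y := tpows A n) v (tensor b)) = tensor (cons_fun v b).
Proof. by rewrite /tconss_fun otens_liftE tconsE. Qed.

Lemma oten_tensor_ext p (W : lmodType k) (f g : {linear otens X (tpows A n) p -> W}) :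
  (forall v b, f (oten (X := X) (Y := tpows A n) v (tensor b)) =
               g (oten (X := X) (Y := tpows A n) v (tensor b))) -> f =1 g.
Proof.
move=> fg; apply: otens_ext => x y.
pose l : {linear tpows A n p -> otens X (tpows A n) p} :=
  HB.pack (@oten k X (tpows A n) p x)
    (GRing.isLinear.Build k _ _ _ (@oten k X (tpows A n) p x) (@oten_linr k X (tpows A n) p x)).
by apply: (pres_ext (f := f \o l) (g := g \o l)) => b; apply: fg.
Qed.

Fact tconss_nat (p q : opcat Delta) (g : hom p q) w :
  tconss_fun q (cmap (otens X (tpows A n)) g w) = cmap (tpows A n.+1) g (tconss_fun p w).
Proof.
apply: (oten_tensor_ext (f := tconss_fun q \o cmap (otens X (tpows A n)) g)
  (g := cmap (tpows A n.+1) g \o tconss_fun p)) => v b.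
rewrite -[LHS]/(tconss_fun q (act _ g (oten _ _))) -[RHS]/(act _ g (tconss_fun p (oten _ _))).
rewrite tconss_funE act_oten act_tpows act_tpows.
by rewrite tconss_funE (cons_fun_map (amap A g)).
Qed.

Definition tconss : ctrans (otens X (tpows A n)) (tpows A n.+1) :=
  @CTrans k _ (otens X (tpows A n)) (tpows A n.+1) tconss_fun tconss_nat.

Fact tuncons_multilinear p : multilinear (fun b : 'I_n.+1 -> A p =>
  oten (X := X) (Y := tpows A n) (b ord0) (tensor (fun j => b (lift ord0 j)))).
Proof.
move=> b i c x y; case: (unliftP ord0 i) => [l ->|->].
  have E z : (fun j => upd b (lift ord0 l) z (lift ord0 j)) = upd (fun j => b (lift ord0 j)) l z.
    by apply: funext => j; rewrite /upd (inj_eq lift_inj).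
  rewrite !E tensor_multilinear /upd (negPf (neq_lift _ _)); exact: oten_linr.
have E z : (fun j => upd b ord0 z (lift ord0 j)) = (fun j => b (lift ord0 j)).
  by apply: funext => j; rewrite /upd eq_sym (negPf (neq_lift _ _)).
by rewrite !E /upd eqxx; apply: oten_linl.
Qed.

Definition tuncons p : {linear tpows A n.+1 p -> otens X (tpows A n) p} :=
  plift (multilinear_respects (@tuncons_multilinear p)).

Lemma tunconsE p b : tuncons p (tensor b) =
  oten (X := X) (Y := tpows A n) (b ord0) (tensor (fun j => b (lift ord0 j))).
Proof. exact: plift_gen. Qed.

Lemma weq_tconss : weq tconss.
Proof.
apply: weq_bij => p; exists (tuncons p) => w.
  apply: (oten_tensor_ext (f := tuncons p \o tconss p) (g := idfun)) => v b.
  rewrite -[LHS]/(tuncons p (tconss_fun p _)) tconss_funE tunconsE cons_fun0.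
  by congr (@oten k X (tpows A n) p v (tensor _)); apply: funext => j; rewrite cons_funS.
apply: (pres_ext (f := tconss p \o tuncons p) (g := idfun)) => b.
rewrite -[LHS]/(tconss_fun p (tuncons p (tensor b))) tunconsE tconss_funE.
by rewrite cons_fun_eta.
Qed.
End ConsTrans.

Lemma tpows_transE (A B : salg k) (f : atrans A B) n p (b : 'I_n -> A p) :
  tpows_trans f n p (tensor b) = tensor (fun j => f p (b j)).
Proof. exact: plift_gen. Qed.

(** Induction on n through the isomorphism of A (x) A^n with A^(n+1). For n = 0 both powers are
    spanned by the empty tensor, and multilinearity over ['I_0] is vacuous. *)
Theorem weq_tpows (A B : salg k) (f : atrans A B) n :
  weak_equivalence f -> weq (tpows_trans f n).
Proof.
move=> fw; elim: n => [|n IH].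
  apply: weq_bij => p.
  have h : multilinear (fun b : 'I_0 -> B p => @tensor k (A p) 0 (fun=> 0)) by move=> b [].
  pose g : {linear tpows B 0 p -> tpows A 0 p} := plift (multilinear_respects h).
  have gE b : g (tensor b) = tensor (fun=> 0) by exact: plift_gen.
  have tE b : tpows_trans f 0 p (tensor b) = tensor (fun j => f p (b j)).
    exact: (@tpows_transE A B f 0%N p b).
  exists g => w.
    apply: (pres_ext (f := g \o tpows_trans f 0 p) (g := idfun)) => b.
    apply: etrans (congr1 g (tE b)) _; apply: etrans (gE _) _.
    by congr tensor; apply: funext => -[].
  apply: (pres_ext (f := tpows_trans f 0 p \o g) (g := idfun)) => b.
  apply: etrans (congr1 (tpows_trans f 0 p) (gE b)) _; apply: etrans (tE _) _.
  by congr tensor; apply: funext => -[].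
apply: (@weq_left _ _ _ _ (tconss A n) _
  (ctrans_cmp (tconss B n) (otens_trans (atrans_mod f) (tpows_trans f n)))) => [p w||].
- apply: (oten_tensor_ext (f := tpows_trans f n.+1 p \o tconss A n p)
    (g := tconss B n p \o otens_trans (atrans_mod f) (tpows_trans f n) p)) => v b.
  rewrite -[LHS]/(tpows_trans f n.+1 p (tconss_fun A n p _)) tconss_funE tpows_transE.
  rewrite -[RHS]/(tconss_fun B n p (otens_trans _ _ _ _)) otens_transE tpows_transE.
  by rewrite tconss_funE (cons_fun_map (f p)).
- exact: weq_tconss.
apply: (@weq_comp _ _ _ _ (otens_trans (atrans_mod f) (tpows_trans f n)) (tconss B n)) => //.
- exact: weq_otens.
- exact: weq_tconss.
Qed.
End TensorPowers.

(** * Free algebras *)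

Section WordAlgebra.
Context (k : fieldType) (E : Type).

Definition wmul : freemod k (seq E) -> freemod k (seq E) -> freemod k (seq E) :=
  flift2 (fun u v => fgen k (u ++ v)).

Lemma wmul_gen u v : wmul (fgen k u) (fgen k v) = fgen k (u ++ v).
Proof. exact: flift2_gen. Qed.

Lemma wmulPl c x y z : wmul (c *: x + y) z = c *: wmul x z + wmul y z.
Proof. exact: flift2_linl. Qed.
Lemma wmulPr c x y z : wmul z (c *: x + y) = c *: wmul z x + wmul z y.
Proof. exact: flift2_linr. Qed.

Lemma wmulDl : left_distributive wmul +%R.
Proof. by move=> x y z; have := wmulPl 1 x y z; rewrite !scale1r. Qed.
Lemma wmulDr : right_distributive wmul +%R.
Proof. by move=> x y z; have := wmulPr 1 y z x; rewrite !scale1r. Qed.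
Lemma wmul0x x : wmul 0 x = 0.
Proof. by apply: (@addrI _ (wmul 0 x)); rewrite -wmulDl !addr0. Qed.
Lemma wmulx0 x : wmul x 0 = 0.
Proof. by apply: (@addrI _ (wmul x 0)); rewrite -wmulDr !addr0. Qed.
Lemma wmulZl c x y : wmul (c *: x) y = c *: wmul x y.
Proof. by rewrite -[c *: x]addr0 wmulPl wmul0x addr0. Qed.
Lemma wmulZr c x y : wmul x (c *: y) = c *: wmul x y.
Proof. by rewrite -[c *: y]addr0 wmulPr wmulx0 addr0. Qed.

Lemma wmulA : associative wmul.
Proof.
move=> x y z; elim/free_ind: x => [|c x x' Hx Hx'|u]; first by rewrite !wmul0x.
  by rewrite !wmulPl Hx Hx'.
elim/free_ind: y => [|c y y' Hy Hy'|v]; first by rewrite wmul0x wmulx0 wmul0x.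
  by rewrite wmulPl !wmulPr Hy Hy' wmulPl.
elim/free_ind: z => [|c z z' Hz Hz'|w]; first by rewrite !wmulx0.
  by rewrite !wmulPr Hz Hz'.
by rewrite !wmul_gen catA.
Qed.

Lemma wmul1x : left_id (fgen k [::]) wmul.
Proof.
elim/free_ind => [|c x x' Hx Hx'|u]; first by rewrite wmulx0.
  by rewrite wmulPr Hx Hx'.
by rewrite wmul_gen.
Qed.

Lemma wmulx1 : right_id (fgen k [::]) wmul.
Proof.
elim/free_ind => [|c x x' Hx Hx'|u]; first by rewrite wmul0x.
  by rewrite wmulPl Hx Hx'.
by rewrite wmul_gen cats0.
Qed.

(** A concrete tensor algebra against which the universal property in [free_on] is tested. *)
Definition word_algebra : algebra k :=
  @Algebra k (freemod k (seq E)) wmul (fgen k [::]) wmulA wmul1x wmulx1 wmulDl wmulDr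
    wmulZl wmulZr.
End WordAlgebra.

Section FreeAlgebra.
Context (k : fieldType) (A : algebra k) (G : A -> Prop).
Local Notation E := {x | G x}.

Definition word (w : seq E) : A := \prod_(g <- w) sval g.

Lemma word_nil : word [::] = 1. Proof. exact: big_nil. Qed.
Lemma word_cons g w : word (g :: w) = sval g * word w. Proof. exact: big_cons. Qed.
Lemma word_cat u v : word (u ++ v) = word u * word v. Proof. exact: big_cat. Qed.
Lemma word_flatten s : word (flatten s) = \prod_(w <- s) word w.
Proof. by elim: s => [|w s IH]; rewrite ?big_nil ?word_nil //= word_cat IH big_cons. Qed.

Lemma word_linM : {morph (flift word : word_algebra k E -> A) : x y / x * y}.
Proof.
move=> x y; rewrite -[x * y]/(wmul x y); elim/free_ind: x => [|c x x' Hx Hx'|u].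
- by rewrite wmul0x linear0 mul0r.
- by rewrite wmulPl !linearP /= Hx Hx' mulrDl alg_scaleAl.
elim/free_ind: y => [|c y y' Hy Hy'|v].
- by rewrite wmulx0 linear0 mulr0.
- by rewrite wmulPr !linearP /= Hy Hy' mulrDr alg_scaleAr.
by rewrite wmul_gen !flift_gen word_cat.
Qed.

Lemma word_lin1 : (flift word : word_algebra k E -> A) 1 = 1.
Proof. by rewrite -word_nil; apply: flift_gen. Qed.

(** The map to [word_algebra] given by the universal property provides the coordinates; uniqueness
    of endomorphisms of A shows that words span. *)
Lemma free_words : free_on G -> exists co : {linear A -> freemod k (seq E)},
  (forall a, flift word (co a) = a) /\ (forall w, co (word w) = fgen k w).
Proof.
move=> hG.
(* [free_on] extends the restriction to G of a function defined on all of A, hence the value 0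
   outside G. *)
pose h (x : A) : word_algebra k E :=
  if pselect (G x) is left g then fgen k [:: exist _ x g] else 0.
have [f [fh _]] := hG (word_algebra k E) h.
have fE (g : E) : f (sval g) = fgen k [:: g].
  case: g => x gx; rewrite fh //= /h; case: pselect => // gx'.
  by rewrite (Prop_irrelevance gx gx').
exists f; split=> [a|w]; last first.
  elim: w => [|g w IH]; first by rewrite word_nil ahom1.
  by rewrite word_cons ahomM fE IH -[LHS]/(wmul _ _) wmul_gen.
(* The identity and [flift word \o f] are endomorphisms that agree on G, so both equal F. *)
have [F [_ Fu]] := hG A id.
pose l : {linear A -> A} := (flift word : {linear freemod k (seq E) -> A}) \o f.
have l1 : l 1 = 1 by rewrite -[LHS]/(flift word (f 1)) ahom1; apply: word_lin1.
have lM : {morph l : x y / x * y}.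
  by move=> x y; rewrite -[LHS]/(flift word (f (x * y))) ahomM; apply: word_linM.
have lG x : G x -> l x = x.
  move=> gx; rewrite -[LHS]/(flift word (f (sval (exist _ x gx)))) fE.
  by rewrite flift_gen word_cons word_nil mulr1.
rewrite -[LHS]/(AlgHom l1 lM a) (Fu (AlgHom l1 lM) lG).
by rewrite -(Fu (@AlgHom k A A idfun erefl (fun _ _ => erefl))).
Qed.
End FreeAlgebra.

Section WordBasis.
Context (k : fieldType) (A : algebra k) (W : Type) (word : W -> A).
Context (co : {linear A -> freemod k W}).
Hypothesis coK : forall a, flift word (co a) = a.
Hypothesis co_word : forall w, co (word w) = fgen k w.

Section Extend.
Context (n : nat) (V : lmodType k) (f : ('I_n -> W) -> V).

(** The multilinear extension of a function on words: the entries of a at the positions in r are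
    expanded one after the other, and w records the words chosen so far, with a default
    elsewhere. *)
Fixpoint mextend (r : seq 'I_n) (w : 'I_n -> W) (a : 'I_n -> freemod k W) : V :=
  if r is i :: r' then flift (fun e => mextend r' (upd w i e) a) (a i) else f w.

Lemma mextend_notin r w a i x : i \notin r -> mextend r w (upd a i x) = mextend r w a.
Proof.
elim: r w => //= j r IH w; rewrite inE negb_or => /andP[ij ir].
have -> : upd a i x j = a j by rewrite /upd eq_sym (negPf ij).
congr (flift _ _); by apply: funext => e; apply: IH.
Qed.

Lemma mextend_linear r w a i c x y : uniq r -> i \in r ->
  mextend r w (upd a i (c *: x + y)) = c *: mextend r w (upd a i x) + mextend r w (upd a i y).
Proof.
elim: r w => //= j r IH w /andP[jr ur]; rewrite inE; have [ej _|ij /= ir] := eqVneq i j.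
  rewrite -ej in jr *.
  have E z : flift (fun e => mextend r (upd w i e) (upd a i z)) (upd a i z i) =
      flift (fun e => mextend r (upd w i e) a) z.
    have -> : upd a i z i = z by rewrite /upd eqxx.
    by congr (flift _ _); apply: funext => e; apply: mextend_notin.
  by rewrite !E linearP.
have E z : upd a i z j = a j by rewrite /upd eq_sym (negPf ij).
rewrite !E -flift_add; congr (flift _ _); apply: funext => e; exact: IH.
Qed.

Lemma mextend_gen r w (u : 'I_n -> W) : (forall i, i \notin r -> w i = u i) ->
  mextend r w (fun i => fgen k (u i)) = f u.
Proof.
elim: r w => [|i r IH] w h /=; first by congr f; apply: funext => i; apply: h.
rewrite flift_gen; apply: IH => j jr; rewrite /upd; case: eqVneq => [->//|ji].
by apply: h; rewrite inE negb_or ji.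
Qed.

Fact extend_multilinear (w : 'I_n -> W) :
  multilinear (fun a : 'I_n -> A => mextend (enum 'I_n) w (fun i => co (a i))).
Proof.
move=> a i c x y.
have E z : (fun j => co (upd a i z j)) = upd (fun j => co (a j)) i (co z).
  by apply: funext => j; rewrite /upd; case: eqP.
by rewrite !E linearP mextend_linear ?enum_uniq ?mem_enum.
Qed.
End Extend.

Lemma word_lift n (V : lmodType k) (f : ('I_n -> W) -> V) :
  inhabited W ->
  exists g : {linear tpow A n -> V}, forall u, g (tensor (fun i => word (u i))) = f u.
Proof.
move=> [w]; exists (plift (multilinear_respects (extend_multilinear f (fun=> w)))) => u.
apply: etrans (plift_gen _ _) _.
have -> : (fun i => co (word (u i))) = (fun i => fgen k (u i)).
  by apply: funext => i; rewrite co_word.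
by apply: mextend_gen => i; rewrite mem_enum.
Qed.

Lemma word_ext n (V : lmodType k) (f g : {linear tpow A n -> V}) :
  (forall u, f (tensor (fun i => word (u i))) = g (tensor (fun i => word (u i)))) -> f =1 g.
Proof.
move=> fg; apply: pres_ext => a.
(* The list r holds the positions whose entry may fail to be a word; expanding the entries one by
   one empties it. *)
suff H (r : seq 'I_n) : forall a : 'I_n -> A, (forall i, i \notin r -> exists u, a i = word u) ->
    f (tensor a) = g (tensor a).
  by apply: (H (enum 'I_n)) => i; rewrite mem_enum.
elim: r => [|i r IH] {}a ha.
  have aw i : exists u, a i = word u by apply: ha.
  have [u uE] := choice aw.
  by have -> : a = (fun i => word (u i)) by apply: funext.
have aE : a = upd a i (flift word (co (a i))).
  by apply: funext => j; rewrite coK /upd; case: eqP => // ->.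
rewrite aE; elim/free_ind: (co (a i)) => [|c x y Hx Hy|w].
- have t0 : tensor (upd a i 0) = 0.
    have := tensor_multilinear a i (-1) 0 0.
    by rewrite scaler0 addr0 scaleN1r addNr.
  by rewrite linear0 t0 !linear0.
- by rewrite linearP tensor_multilinear !linearP /= Hx Hy.
rewrite flift_gen; apply: IH => j jr; rewrite /upd.
have [_|ji] := eqVneq j i; first by exists w.
by apply: ha; rewrite inE negb_or ji.
Qed.
End WordBasis.

(** * The symmetric bar construction of a free algebra *)

Section SymmetricMorphisms.

Definition flat_word n x (f : shom n x) : seq 'I_n := flatten (sval f).

Lemma flat_wordE n x (f : shom n x) : flat_word f = flatten [seq sword f j | j <- enum 'I_x].
Proof.
rewrite /flat_word; congr flatten; apply: (@eq_from_nth _ [::]).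
  by rewrite size_tuple size_map size_enum_ord.
move=> i; rewrite size_tuple => ix; rewrite (nth_map (Ordinal ix)) ?size_enum_ord //.
by rewrite /sword (tnth_nth [::]) nth_enum_ord.
Qed.

Lemma perm_flat_word n x (f : shom n x) : perm_eq (flat_word f) (enum 'I_n).
Proof.
apply/allP => i _; apply/eqP; rewrite [RHS]count_uniq_mem ?enum_uniq // mem_enum.
by have /forallP/(_ i)/eqP := svalP f.
Qed.

Lemma uniq_flat_word n x (f : shom n x) : uniq (flat_word f).
Proof. by rewrite (perm_uniq (perm_flat_word f)) enum_uniq. Qed.

Lemma mem_flat_word n x (f : shom n x) i : i \in flat_word f.
Proof. by rewrite (perm_mem (perm_flat_word f)) mem_enum. Qed.

Lemma size_flat_word n x (f : shom n x) : size (flat_word f) = n.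
Proof. by rewrite (perm_size (perm_flat_word f)) size_enum_ord. Qed.

Fact permhom_subproof n (s : {perm 'I_n}) i : (\sum_(j < n) count_mem i [:: s j])%N = 1%N.
Proof.
rewrite (bigD1 ((s^-1)%g i)) //= permKV eqxx big1 // => j ji.
by case: eqP => // e; rewrite -e permK eqxx in ji.
Qed.
Definition permhom n (s : {perm 'I_n}) : shom n n := smk (permhom_subproof s).

Lemma sword_permhom n x (f : shom n x) (s : {perm 'I_n}) j :
  sword (scmp f (permhom s)) j = map s (sword f j).
Proof.
rewrite sword_mk /ssubst; elim: (sword f j) => //= i w ->.
by rewrite sword_mk.
Qed.

Lemma permhomM n x (f : shom n x) (s t : {perm 'I_n}) :
  scmp (scmp f (permhom s)) (permhom t) = scmp f (permhom (s * t)%g).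
Proof.
apply: shom_eq => j; rewrite !sword_permhom -map_comp; apply: eq_map => i /=.
by rewrite permM.
Qed.

Context (E : Type).

Definition lword n x (f : shom n x) (g : 'I_n -> E) (j : 'I_x) : seq E := map g (sword f j).

Lemma lword_cmp n x y (h : shom x y) (f : shom n x) (g : 'I_n -> E) j :
  lword (scmp h f) g j = flatten (map (lword f g) (sword h j)).
Proof. by rewrite /lword sword_mk /ssubst map_flatten -map_comp. Qed.

(** The words are concatenated, n is the total length, and the variables 0, ..., n - 1 are cut
    according to the lengths of the words. If all words are empty, n = 0. *)
Lemma lword_exists x (u : 'I_x -> seq E) :
  exists n (f : shom n x) (g : 'I_n -> E), forall j, lword f g j = u j.
Proof.
pose s := flatten [seq u j | j <- enum 'I_x]; pose n := size s.
pose sh := shape [seq u j | j <- enum 'I_x].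
pose F (j : 'I_x) : seq 'I_n := nth [::] (reshape sh (enum 'I_n)) j.
have sz : size (enum 'I_n) = sumn sh by rewrite size_enum_ord /n /s size_flatten.
have szr : size (reshape sh (enum 'I_n)) = x.
  by rewrite size_reshape size_map size_map size_enum_ord.
have hF i : (\sum_j count_mem i (F j))%N = 1%N.
  have -> : (\sum_j count_mem i (F j))%N = count_mem i (flatten (reshape sh (enum 'I_n))).
    rewrite count_flatten sumnE big_map (big_nth [::]) szr big_mkord.
    by apply: eq_bigr.
  by rewrite reshapeKr ?sz // count_uniq_mem ?enum_uniq // mem_enum.
exists n, (smk hF), (tnth (in_tuple s)) => j.
rewrite /lword sword_mk /F -(nth_map _ [::]) ?szr // map_reshape map_tnth_enum.
rewrite /sh flattenK (nth_map j) ?size_enum_ord //; congr u.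
by apply: val_inj; rewrite /= nth_enum_ord.
Qed.

Lemma lword_size n n' x (f : shom n x) (f' : shom n' x) (g : 'I_n -> E) (g' : 'I_n' -> E) :
  (forall j, lword f g j = lword f' g' j) -> n = n'.
Proof.
move=> e; rewrite -(size_flat_word f) -(size_flat_word f') !flat_wordE !size_flatten.
congr sumn; rewrite /shape -!map_comp; apply: eq_map => j /=.
by have := congr1 size (e j); rewrite !size_map.
Qed.

(** A presentation of a family of words by a morphism and letters is unique up to renumbering of the
    variables. *)
Lemma lword_eq n x (f f' : shom n x) (g g' : 'I_n -> E) :
  (forall j, lword f g j = lword f' g' j) ->
  exists t : {perm 'I_n}, f = scmp f' (permhom t) /\ g' = g \o t.
Proof.
move=> e; pose w := flat_word f; pose w' := flat_word f'.
have wsz : size w = size w' by rewrite !size_flat_word.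
(* Each variable goes to the one that occupies the same position in the other flattened word. *)
pose tau a := nth a w (index a w').
have tw : map tau w' = w.
  case: n f f' g g' e @w @w' wsz @tau => [|n] f f' g g' e w w' wsz tau.
    have /size0nil-> : size w = 0%N by exact: size_flat_word.
    by have /size0nil-> : size w' = 0%N by exact: size_flat_word.
  apply: (@eq_from_nth _ ord0); rewrite size_map // => i iw.
  rewrite (nth_map ord0) // /tau index_uniq ?uniq_flat_word //.
  by apply: set_nth_default; rewrite wsz.
have tinj : injective tau.
  apply/injectiveP/dinjectiveP => a b _ _ ab.
  move: (mem_flat_word f' a) (mem_flat_word f' b).
  rewrite -/w' => aw bw; have ia := aw; have ib := bw.
  rewrite -index_mem -wsz in ia; rewrite -index_mem -wsz in ib.
  move: ab; rewrite /tau (set_nth_default b) // => /eqP.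
  rewrite nth_uniq ?uniq_flat_word // => /eqP /(congr1 (nth a w')).
  by rewrite !nth_index.
exists (perm tinj).
have shE j : size (sword f j) = size (sword f' j).
  by have := congr1 size (e j); rewrite !size_map.
have fE j : sword f j = map tau (sword f' j).
  have : [seq sword f j | j <- enum 'I_x] = [seq map tau (sword f' j) | j <- enum 'I_x].
    apply: eq_from_flatten_shape; last first.
      by rewrite /shape -!map_comp; apply: eq_map => l /=; rewrite size_map shE.
    rewrite -flat_wordE -/w -tw /w' flat_wordE map_flatten -map_comp.
    by congr flatten; apply: eq_map.
  by move/eq_in_map => ->; rewrite ?mem_enum.
split.
  apply: shom_eq => j; rewrite sword_permhom fE; apply: eq_map => i.
  by rewrite permE.
apply: funext => a /=; rewrite permE.
have : map g (map tau w') = map g' w'.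
  rewrite tw /w /w' !flat_wordE !map_flatten -!map_comp; congr flatten.
  by apply: eq_map => j /=; apply: e.
by rewrite -map_comp => /eq_in_map/(_ a (mem_flat_word f' a)).
Qed.
End SymmetricMorphisms.

Definition ssucc a b (f : shom a b) : shom (1 + a) (1 + b) := ssum (sid 1) f.

Lemma ssucc_id a : ssucc (sid a) = sid (1 + a).
Proof. exact: ssum_id. Qed.

Lemma ssucc_cmp a b c (g : shom b c) (f : shom a b) :
  ssucc (scmp g f) = scmp (ssucc g) (ssucc f).
Proof. by rewrite /ssucc -ssum_cmp scmp1m. Qed.

(** The empty word in front means that x -> 1 + x inserts the factor 1 on tensors. *)
Definition eta1_word x (j : 'I_(1 + x)) : seq 'I_x :=
  match fintype.split j with inl _ => [::] | inr l => [:: l] end.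

Lemma eta1_wordl x l : eta1_word (lshift x l) = [::].
Proof. by rewrite /eta1_word -[lshift _ _]/(unsplit (inl l)) unsplitK. Qed.
Lemma eta1_wordr x l : @eta1_word x (rshift 1 l) = [:: l].
Proof. by rewrite /eta1_word -[rshift _ _]/(unsplit (inr l)) unsplitK. Qed.

Fact eta1_subproof x i : (\sum_j count_mem i (@eta1_word x j))%N = 1%N.
Proof.
rewrite big_split_ord /= big1 ?add0n => [|j _]; last by rewrite eta1_wordl.
by under eq_bigr do rewrite eta1_wordr; apply: sid_subproof.
Qed.
Definition eta1 x : shom x (1 + x) := smk (@eta1_subproof x).

Lemma eta1l x l : sword (eta1 x) (lshift x l) = [::].
Proof. by rewrite sword_mk eta1_wordl. Qed.
Lemma eta1r x l : sword (eta1 x) (rshift 1 l) = [:: l].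
Proof. by rewrite sword_mk eta1_wordr. Qed.

Lemma ssucc_wordl a b (f : shom a b) l : sword (ssucc f) (lshift b l) = [:: lshift a l].
Proof.
by rewrite ssumE /ssum_word -[lshift b l]/(unsplit (inl l)) unsplitK sword_mk.
Qed.

Lemma ssucc_wordr a b (f : shom a b) l :
  sword (ssucc f) (rshift 1 l) = map (@rshift 1 a) (sword f l).
Proof. by rewrite ssumE /ssum_word -[rshift 1 l]/(unsplit (inr l)) unsplitK. Qed.

Lemma eta1_nat a b (f : shom a b) : scmp (ssucc f) (eta1 a) = scmp (eta1 b) f.
Proof.
apply: shom_eq => j; rewrite [LHS]sword_mk [RHS]sword_mk; case: (split_ordP j) => l ->.
  by rewrite ssucc_wordl eta1l /ssubst /= eta1l.
rewrite ssucc_wordr eta1r /ssubst /= cats0 -map_comp.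
have -> : [seq (sword (eta1 a) \o @rshift 1 a) i | i <- sword f l] = [seq [:: i] | i <- sword f l].
  by apply: eq_map => i /=; rewrite eta1r.
exact: flatten_seq1.
Qed.

Section Average.
Context (k : fieldType) (char0 : [pchar k]%R =i pred0).
Context (R : salg k) (d : opcat Delta).
Local Notation A := (R d).

Definition bact (a b : nat) (f : shom a b) : {linear tpow A a -> tpow A b} :=
  @bsym_map k (opcat Delta) R (a, d) (b, d) (f, idm d).

Lemma bactE a b (f : shom a b) x :
  bact f (tensor x) = tensor (fun j => \prod_(i <- sword f j) x i).
Proof.
apply: etrans (@bsym_map_tensor k (opcat Delta) R (a, d) (b, d) (f, idm d) x) _.
congr tensor; apply: funext => j.
by apply: eq_bigr => i _; apply: amap_id.
Qed.

Definition tunit n (b : 'I_n -> A) : tpow A (1 + n) := tensor (cat_fun (fun _ : 'I_1 => (1 : A)) b).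

Lemma cat_funl (V : lmodType k) m n (a : 'I_m -> V) (b : 'I_n -> V) l : cat_fun a b (lshift n l) = a l.
Proof. by rewrite /cat_fun -[lshift _ _]/(unsplit (inl l)) unsplitK. Qed.
Lemma cat_funr (V : lmodType k) m n (a : 'I_m -> V) (b : 'I_n -> V) l : cat_fun a b (rshift m l) = b l.
Proof. by rewrite /cat_fun -[rshift _ _]/(unsplit (inr l)) unsplitK. Qed.

Lemma bact_tunit a b (f : shom a b) x :
  bact (ssucc f) (tunit x) = tunit (fun j => \prod_(i <- sword f j) x i).
Proof.
rewrite bactE; congr tensor; apply: funext => j; case: (split_ordP j) => l ->.
  by rewrite ssucc_wordl big_seq1 !cat_funl.
rewrite ssucc_wordr cat_funr big_map; apply: eq_bigr => i _; exact: cat_funr.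
Qed.

Lemma bact_eta n x : bact (eta1 n) (tensor x) = tunit x.
Proof.
rewrite bactE; congr tensor; apply: funext => j.
case: (split_ordP j) => l ->; first by rewrite eta1l big_nil cat_funl.
by rewrite eta1r big_seq1 cat_funr.
Qed.

(** The part of the free cover at 1 + x with sources of the form 1 + n. Such sources are nonempty,
    so the same construction serves Delta S and Delta S_+. *)
Definition qidx (x : nat) : Type := {n : nat & (shom (1 + n) (1 + x) * tpow A (1 + n))%type}.
Definition qelt x n (f : shom (1 + n) (1 + x)) (m : tpow A (1 + n)) : qidx x := existT _ n (f, m).

Definition qmap x y (h : shom x y) : {linear freemod k (qidx x) -> freemod k (qidx y)} :=
  flift (fun t => fgen k (qelt (scmp (ssucc h) (projT2 t).1) (projT2 t).2)).

Lemma qmapE x y (h : shom x y) n (f : shom (1 + n) (1 + x)) m :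
  qmap h (fgen k (qelt f m)) = fgen k (qelt (scmp (ssucc h) f) m).
Proof. exact: flift_gen. Qed.

Definition qev x : {linear freemod k (qidx x) -> tpow A (1 + x)} :=
  flift (fun t => bact (projT2 t).1 (projT2 t).2).

Lemma qevE x n (f : shom (1 + n) (1 + x)) m : qev x (fgen k (qelt f m)) = bact f m.
Proof. exact: flift_gen. Qed.

Section Letters.
Context (E : Type) (letter : E -> A).

(* Averaging over the automorphisms of the source removes the choice of f and g, see
   average_eq; this is where characteristic 0 is used. *)
Definition average n x (f : shom n x) (g : 'I_n -> E) : freemod k (qidx x) :=
  (n`!%:R)^-1 *: \sum_(s : {perm 'I_n})
    fgen k (qelt (ssucc (scmp f (permhom s))) (tunit (fun i => letter (g ((s^-1)%g i))))).

(** Two presentations differ by a permutation t, which is absorbed by the reindexing s |-> t s. *)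
Lemma average_eq n n' x (f : shom n x) (f' : shom n' x) g g' :
  (forall j, lword f g j = lword f' g' j) -> average f g = average f' g'.
Proof.
move=> e; have nn' := lword_size e; subst n'.
have [t [-> ->]] := lword_eq e; congr (_ *: _).
rewrite [RHS](reindex_inj (mulgI t)); apply: eq_bigr => s _.
rewrite permhomM; congr (fgen k (qelt _ (tunit _))); apply: funext => i /=.
by rewrite invMg permM permKV.
Qed.

Lemma qmap_average x y (h : shom x y) n (f : shom n x) g :
  qmap h (average f g) = average (scmp h f) g.
Proof.
rewrite /average linearZ linear_sum /=; congr (_ *: _); apply: eq_bigr => s _.
by rewrite qmapE -ssucc_cmp scmpA.
Qed.

(** All n! summands evaluate to the same tensor, because the letters are renumbered inversely to the
    variables. *)
Lemma qev_average n x (f : shom n x) g :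
  qev x (average f g) = tunit (fun j => \prod_(e <- lword f g j) letter e).
Proof.
rewrite /average linearZ linear_sum /=.
rewrite (eq_bigr (fun=> tunit (fun j => \prod_(e <- lword f g j) letter e))); last first.
  move=> s _; rewrite qevE bact_tunit; congr tunit; apply: funext => j.
  rewrite sword_permhom /lword !big_map; apply: eq_bigr => i _.
  by rewrite permK.
rewrite sumr_const card_Sn -scaler_nat scalerA mulVf ?scale1r //.
by have /pcharf0P -> := char0; rewrite -lt0n fact_gt0.
Qed.
End Letters.

Context (G : A -> Prop) (hG : free_on G).
Local Notation E := {x | G x}.

(** Tensors of words form a basis of the tensor power of a free algebra, so the section may be
    prescribed on them. It is natural because [scmp h f] presents the concatenated words whenever f
    presents the words. *)
Lemma average_section : exists s : forall x, {linear tpow A x -> freemod k (qidx x)},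
  (forall x y (h : shom x y) m, s y (bact h m) = qmap h (s x m)) /\
  (forall x m, qev x (s x m) = bact (eta1 x) m).
Proof.
have [co [coK co_word]] := free_words hG.
(* The value must agree for all presentations at once, including the number n of variables, which
   occurs in the type of the average. *)
have avg_ex x (u : 'I_x -> seq E) : exists v : freemod k (qidx x),
    forall n (f : shom n x) (g : 'I_n -> E), (forall j, lword f g j = u j) ->
      v = average (@sval A G) f g.
  have [n [f [g fg]]] := lword_exists u; exists (average (@sval A G) f g) => n' f' g' fg'.
  by apply: average_eq => j; rewrite fg fg'.
pose avg x u := sval (cid (@avg_ex x u)).
have avgE x n (f : shom n x) (g : 'I_n -> E) : avg x (lword f g) = average (@sval A G) f g.
  by apply: (svalP (cid (@avg_ex x (lword f g)))).
have W : inhabited (seq E) by exists; exact: [::].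
have sex x := cid (@word_lift k A _ _ co co_word x _ (avg x) W).
pose s x := sval (sex x).
have sE x u : s x (tensor (fun i => word (u i))) = avg x u := svalP (sex x) u.
have sE' x n (f : shom n x) (g : 'I_n -> E) u : (forall j, lword f g j = u j) ->
    s x (tensor (fun i => word (u i))) = average (@sval A G) f g.
  by move=> e; rewrite sE -avgE; congr avg; apply: funext => j; rewrite e.
exists s; split=> [x y h m|x m].
- apply: (word_ext coK (f := s y \o bact h) (g := qmap h \o s x)) => u.
  have [n [f [g fg]]] := lword_exists u.
  rewrite -[LHS]/(s y (bact h (tensor _))) -[RHS]/(qmap h (s x _)) (sE' x n f g) //.
  rewrite bactE qmap_average.
  have -> : (fun j => \prod_(i <- sword h j) word (u i)) =
      (fun j => word (flatten (map u (sword h j)))).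
    by apply: funext => j; rewrite word_flatten big_map.
  apply: sE' => j; rewrite lword_cmp; congr flatten; apply: eq_map => i; exact: fg.
apply: (word_ext coK (f := qev x \o s x) (g := bact (eta1 x))) => u.
have [n [f [g fg]]] := lword_exists u.
rewrite -[LHS]/(qev x (s x _)) (sE' x n f g) // qev_average bact_eta.
by congr tunit; apply: funext => j; rewrite fg.
Qed.
End Average.

Definition shiftp : pointed_endo DeltaSp :=
  @PointedEndo DeltaSp (fun x => (1 + x)%N) (fun x y f => ssucc f) ssucc_id
    (fun x y z g f => ssucc_cmp g f) eta1 (fun x y f => eta1_nat f).

(** Object x of [DeltaS] has x.+1 elements, and 1 + x.+1 is convertible to (S x).+1; so the shift is
    the successor on objects. *)
Definition shifts : pointed_endo DeltaS :=
  @PointedEndo DeltaS S (fun x y f => @ssucc x.+1 y.+1 f) (fun x => ssucc_id x.+1)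
    (fun x y z g f => ssucc_cmp g f) (fun x => eta1 x.+1) (fun x y f => eta1_nat f).

Section TwistedSections.
Context (k : fieldType) (char0 : [pchar k]%R =i pred0).
Context (R : salg k) (d : opcat Delta) (G : R d -> Prop) (hG : free_on G).

Lemma bsymp_twisted : inhabited (twisted_section shiftp (lev (bsymp R) d)).
Proof.
have [s [sN sE]] := average_section char0 hG.
pose L := lev (bsymp R) d.
pose rel (x : DeltaSp) : {linear freemod k (qidx R d x) -> free_cover L (1 + x)%N} :=
  flift (fun t => fgen k (@pelt k DeltaSp L (1 + x)%N (1 + projT1 t)%N (projT2 t).1 (projT2 t).2)).
have relE (x : DeltaSp) n f m : rel x (fgen k (@qelt k R d x n f m)) =
    fgen k (@pelt k DeltaSp L (1 + x)%N (1 + n)%N f m) by exact: flift_gen.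
exists; refine (@TwistedSection k DeltaSp shiftp L (fun x => rel x \o s x) _ _).
- move=> x y f m; rewrite -[LHS]/(rel y (s y (bact R d f m))) sN.
  pose pf := @pmap k DeltaSp L (1 + x)%N (1 + y)%N (ssucc f).
  rewrite -[RHS]/(pf (rel x (s x m))).
  apply: (free_ext (f := rel y \o qmap R d f) (g := pf \o rel x)) => -[n [g v]].
  rewrite -[LHS]/(rel y (qmap R d f (fgen k (qelt g v)))) -[RHS]/(pf (rel x (fgen k (qelt g v)))).
  by rewrite qmapE !relE pmapE.
- move=> x m; rewrite -[RHS]/(bact R d (eta1 x) m) -sE.
  apply: (free_ext (f := pev L (1 + x)%N \o rel x) (g := qev R d x)) => -[n [g v]].
  rewrite -[LHS]/(pev L _ (rel x (fgen k (qelt g v)))) -[RHS]/(qev R d x (fgen k (qelt g v))).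
  rewrite relE; apply: etrans (@pevE k DeltaSp L (1 + x)%N (1 + n)%N g v) _.
  exact/esym/(@qevE k R d x n g v).
Qed.

Lemma bsym_twisted : inhabited (twisted_section shifts (lev (bsym R) d)).
Proof.
have [s [sN sE]] := average_section char0 hG.
pose L := lev (bsym R) d.
pose rel (x : DeltaS) : {linear freemod k (qidx R d x.+1) -> free_cover L x.+1} :=
  flift (fun t => fgen k (@pelt k DeltaS L x.+1 (projT1 t) (projT2 t).1 (projT2 t).2)).
have relE (x : DeltaS) n f m : rel x (fgen k (@qelt k R d x.+1 n f m)) =
    fgen k (@pelt k DeltaS L x.+1 n f m) by exact: flift_gen.
exists; refine (@TwistedSection k DeltaS shifts L (fun x => rel x \o s x.+1) _ _).
- move=> x y f m; rewrite -[LHS]/(rel y (s y.+1 (@bact k R d x.+1 y.+1 f m))) sN.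
  pose pf := @pmap k DeltaS L x.+1 y.+1 (@ssucc x.+1 y.+1 f).
  rewrite -[RHS]/(pf (rel x (s x.+1 m))).
  apply: (free_ext (f := rel y \o qmap R d f) (g := pf \o rel x)) => -[n [g v]].
  rewrite -[LHS]/(rel y (qmap R d f (fgen k (qelt g v)))) -[RHS]/(pf (rel x (fgen k (qelt g v)))).
  by rewrite qmapE !relE pmapE.
- move=> x m; rewrite -[RHS]/(bact R d (eta1 x.+1) m) -sE.
  apply: (free_ext (f := pev L x.+1 \o rel x) (g := qev R d x.+1)) => -[n [g v]].
  rewrite -[LHS]/(pev L _ (rel x (fgen k (qelt g v)))) -[RHS]/(qev R d x.+1 (fgen k (qelt g v))).
  rewrite relE; apply: etrans (@pevE k DeltaS L x.+1 n g v) _.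
  exact/esym/(@qevE k R d x.+1 n g v).
Qed.
End TwistedSections.

(** * Coinvariants of the symmetric bar construction *)

Section Coinvariants.
Context (k : fieldType) (A : salg k) (d : opcat Delta).

Fact wordhom_subproof n (w : seq 'I_n) : (forall i, count_mem i w = 1%N) ->
  forall i, (\sum_(j < 1) count_mem i w)%N = 1%N.
Proof. by move=> h i; rewrite big_ord1. Qed.
Definition wordhom n (w : seq 'I_n) (h : forall i, count_mem i w = 1%N) : shom n 1 :=
  smk (wordhom_subproof h).

Section Universal.
Context (V : lmodType k) (t : forall n, {linear tpow (A d) n.+1 -> V}).
Hypothesis tN : forall x y (f : shom x.+1 y.+1) m, t y (bact A d f m) = t x m.

Lemma word_product n (w : seq 'I_n.+1) (b : 'I_n.+1 -> A d) :
  (forall i, count_mem i w = 1%N) ->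
  t 0 (tensor (fun=> \prod_(i <- w) b i)) = t n (tensor b).
Proof.
move=> h; rewrite -(tN (wordhom h)) bactE; congr (t 0 (tensor _)).
by apply: funext => j; rewrite sword_mk.
Qed.

Definition coinv_gen (b : A d) : V := t 0 (tensor (fun=> b)).

Lemma coinv_gen_linear : linear coinv_gen.
Proof.
move=> c x y; rewrite /coinv_gen.
have E z : (fun _ : 'I_1 => z) = upd (fun=> 0 : A d) ord0 z.
  by apply: funext => j; rewrite /upd (ord1 j) eqxx.
by rewrite (E (c *: x + y)) tensor_multilinear linearP (E x) (E y).
Qed.
HB.instance Definition _ := GRing.isLinear.Build k (A d) V _ coinv_gen coinv_gen_linear.

(** Both u x y v and u y x v are images of the single tensor u (x) x (x) y (x) v, under the words
    0123 and 0213. *)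
Lemma coinv_gen_comm z : comm_rel z -> coinv_gen z = 0.
Proof.
case=> u x y v; rewrite mulrBr mulrBl linearB /=; apply/eqP; rewrite subr_eq0; apply/eqP.
pose b : 'I_4 -> A d := cons_fun u (cons_fun x (cons_fun y (fun _ : 'I_1 => v))).
pose i0 : 'I_4 := ord0; pose i1 : 'I_4 := lift ord0 ord0.
pose i2 : 'I_4 := lift ord0 (lift ord0 ord0).
pose i3 : 'I_4 := lift ord0 (lift ord0 (lift ord0 ord0)).
have h1 i : count_mem i [:: i0; i1; i2; i3] = 1%N.
  by case: i => -[|[|[|[|]]]].
have h2 i : count_mem i [:: i0; i2; i1; i3] = 1%N.
  by case: i => -[|[|[|[|]]]].
have := word_product b h1; rewrite -(word_product b h2) !big_cons !big_nil !mulr1.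
by rewrite /b /i3 /i2 /i1 /i0 !cons_funS !cons_fun0 !mulrA.
Qed.

Lemma coinvariants : exists g : {linear ab (A d) -> V}, forall n m, t n m = g (mult_ab m).
Proof.
pose g : {linear ab (A d) -> V} := qlift (f := coinv_gen) coinv_gen_comm.
exists g => n; apply: (pres_ext (f := t n) (g := g \o @mult_ab k A d n.+1)) => b.
rewrite -[RHS]/(g (mult_ab (tensor b))) mult_ab_tensor /prod_ab.
have -> : g (ab_pi (\prod_(i < n.+1) b i)) = coinv_gen (\prod_(i < n.+1) b i).
  exact: qlift_pi.
rewrite /coinv_gen -(word_product b (w := index_enum 'I_n.+1)) // => i.
by rewrite count_uniq_mem ?index_enum_uniq // mem_index_enum.
Qed.
End Universal.
End Coinvariants.

Section Abelianization.
Context (k : fieldType) (A : salg k).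

Lemma mult_ab1 (d : opcat Delta) (b : A d) : mult_ab (tensor (fun _ : 'I_1 => b)) = ab_pi b.
Proof. by rewrite mult_ab_tensor /prod_ab big_ord1. Qed.

Lemma mult_ab_bact (d : opcat Delta) (x y : nat) (f : shom x y) m :
  mult_ab (bact A d f m) = mult_ab m.
Proof. exact: (@mult_ab_bsym k A d x y f m). Qed.

Lemma bsym_ab_funE (d : opcat Delta) (x : DeltaS) (c : rconst k DeltaS (x, d)) (m : bsym A (x, d)) :
  bsym_ab A d (@ten _ _ _ (rconst k DeltaS) (bsym A) d x c m) = (c : k) *: mult_ab m.
Proof. exact: plift_gen. Qed.

Lemma weq_bsym_ab : weq (bsym_ab A).
Proof.
apply: weq_bij => d; pose N0 := rconst k DeltaS; pose M := bsym A.
have tlin n : linear (fun m : tpow (A d) n.+1 => @ten k DeltaS (opcat Delta) N0 M d n 1 m).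
  by move=> c x y; rewrite tenDr tenZr.
pose t n : {linear tpow (A d) n.+1 -> ctens M d} :=
  HB.pack (fun m : tpow (A d) n.+1 => @ten k DeltaS (opcat Delta) N0 M d n 1 m)
    (GRing.isLinear.Build k _ _ _ _ (tlin n)).
have [|g gE] := @coinvariants k A d (ctens M d) t.
  move=> x y f m; apply/esym; exact: (@ten_act k DeltaS (opcat Delta) N0 M d x y f 1 m).
exists g => w.
  apply: (ten_ext (f := g \o bsym_ab A d) (g := idfun)) => x c m.
  rewrite -[LHS]/(g (bsym_ab A d _)) bsym_ab_funE linearZ /=.
  rewrite -(gE x m); apply/esym.
  apply: etrans (@tenZl k DeltaS (opcat Delta) N0 M d x c 1 m).
  by congr ten; apply/esym/mulr1.
rewrite -[w]qreprK -[qpi _ _]/(ab_pi _) -mult_ab1 -(gE 0%N).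
by apply: etrans (@bsym_ab_funE d 0%N 1 _) _; rewrite scale1r.
Qed.

Section Component.
Variable d : opcat Delta.

Definition bsymp_ab_gen (x : DeltaSp) (c : rconst k DeltaSp (x, d))
    (m : bsymp A (x, d)) : calg_mod (abC A) d :=
  (c : k) *: mult_ab m.

Fact bsymp_ab_balanced :
  @balanced k DeltaSp _ (rconst k DeltaSp) (bsymp A) d _ bsymp_ab_gen.
Proof.
split=> [x m c n n'|x n c m m'|x y f n m]; rewrite /bsymp_ab_gen.
- by rewrite scalerDl scalerA.
- by rewrite linearP scalerDr !scalerA mulrC.
- by congr (_ *: _); exact/esym/(@mult_ab_bsym k A d x y f).
Qed.

Definition bsymp_ab_fun : ctens (bsymp A) d -> calg_mod (abC A) d :=
  plift (balanced_respects bsymp_ab_balanced).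
HB.instance Definition _ := GRing.Linear.on bsymp_ab_fun.

Lemma bsymp_ab_funE (x : DeltaSp) (c : rconst k DeltaSp (x, d)) (m : bsymp A (x, d)) :
  bsymp_ab_fun (@ten _ _ _ (rconst k DeltaSp) (bsymp A) d x c m) = (c : k) *: mult_ab m.
Proof. exact: plift_gen. Qed.
End Component.

Lemma mult_ab_map (d d' : opcat Delta) (g : hom d d') (y : DeltaSp) (m : bsymp A (y, d)) :
  mult_ab (cmap (bsymp A) ((idm y, g) : @hom (prodcat DeltaSp _) (y, d) (y, d')) m) =
    ab_map_fun (amap A g) (mult_ab m).
Proof.
move: m; apply: (pres_ext (f := @mult_ab k A d' _ \o
    @bsym_map k _ A (y, d) (y, d') (@idm DeltaSp y, g))
  (g := ab_map_fun (amap A g) \o @mult_ab k A d _)) => b /=.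
rewrite bsym_map_tensor !mult_ab_tensor /prod_ab ab_map_pi.
rewrite (big_morph (amap A g) (@ahomM _ _ _ _) (@ahom1 _ _ _ _)).
congr ab_pi; apply: eq_bigr => i _.
by rewrite sword_mk big_seq1.
Qed.

Fact bsymp_ab_nat d d' (g : hom d d') x :
  bsymp_ab_fun (cmap (ctens (bsymp A)) g x) =
    cmap (calg_mod (abC A)) g (bsymp_ab_fun x).
Proof.
apply: (ten_ext (f := @bsymp_ab_fun d' \o cmap (ctens (bsymp A)) g)
  (g := cmap (calg_mod (abC A)) g \o @bsymp_ab_fun d)) => y n m.
rewrite -[LHS]/(bsymp_ab_fun (ten_map g _)) -[RHS]/(ab_map_fun (amap A g) (bsymp_ab_fun _)).
rewrite ten_mapE /ten_map_gen !bsymp_ab_funE linearZ; congr (_ *: _).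
exact: mult_ab_map.
Qed.

Definition bsymp_ab : ctrans (ctens (bsymp A)) (calg_mod (abC A)) :=
  @CTrans k _ (ctens (bsymp A)) (calg_mod (abC A)) bsymp_ab_fun bsymp_ab_nat.

Lemma weq_bsymp_ab : weq bsymp_ab.
Proof.
apply: weq_bij => d; pose N0 := rconst k DeltaSp; pose M := bsymp A.
have tlin n : linear (fun m : tpow (A d) n.+1 => @ten k DeltaSp (opcat Delta) N0 M d n.+1 1 m).
  by move=> c x y; rewrite tenDr tenZr.
pose t n : {linear tpow (A d) n.+1 -> ctens M d} :=
  HB.pack (fun m : tpow (A d) n.+1 => @ten k DeltaSp (opcat Delta) N0 M d n.+1 1 m)
    (GRing.isLinear.Build k _ _ _ _ (tlin n)).
have [|g gE] := @coinvariants k A d (ctens M d) t.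
  move=> x y f m; apply/esym; exact: (@ten_act k DeltaSp (opcat Delta) N0 M d x.+1 y.+1 f 1 m).
exists g => w.
  apply: (ten_ext (f := g \o bsymp_ab d) (g := idfun)) => x c m.
  rewrite -[LHS]/(g (bsymp_ab_fun _)) bsymp_ab_funE linearZ /=.
  (* [coinvariants] concerns nonempty objects only, while x may be 0; balancing along [eta1] moves
     to x.+1. *)
  rewrite -(mult_ab_bact (eta1 x) m) -(gE x); apply/esym.
  apply: etrans (@ten_act k DeltaSp (opcat Delta) N0 M d x x.+1 (eta1 x) c m) _.
  apply: etrans (@tenZl k DeltaSp (opcat Delta) N0 M d x.+1 c 1 (bact A d (eta1 x) m)).
  by congr ten; apply/esym/mulr1.
rewrite -[w]qreprK -[qpi _ _]/(ab_pi _) -mult_ab1 -(gE 0%N).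
by apply: etrans (@bsymp_ab_funE d 1%N 1 _) _; rewrite scale1r.
Qed.
End Abelianization.

(** * Invariance and acyclicity of the symmetric bar construction *)

Section WeakEquivalences.
Context (k : fieldType).

Lemma weq_dtens_trans (C : category) (M M' : cmod k (prodcat C (opcat Delta)))
    (f : ctrans M M') : pointwise_weq f -> weq (dtens_trans f).
Proof. by move=> fw; apply: weq_tens_right => //; apply: free_flat => n; apply: nerve_free. Qed.

Lemma weq_dtens_bsymp (A B : salg k) (f : atrans A B) :
  weak_equivalence f -> weq (dtens_trans (bsymp_trans f)).
Proof. by move=> fw; apply: weq_dtens_trans => x; apply: weq_tpows. Qed.

Lemma weq_dtens_bsym (A B : salg k) (f : atrans A B) :
  weak_equivalence f -> weq (dtens_trans (bsym_trans f)).
Proof.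
move=> fw; apply: weq_dtens_trans => x.
by have := @weq_tpows k A B f x.+1 fw; move/weqP => h; apply/weqP => n; apply: h.
Qed.

Hypothesis char0 : [pchar k]%R =i pred0.
Context (R : salg k) (Rfree : semi_free R).

Lemma weq_bsym_augm : weq (dtens_ctens (bsym R)).
Proof.
apply: weq_tens_left => n; have [G [hG _]] := Rfree.
have [s] := bsym_twisted char0 (hG n); exact: weq_augm_twisted s.
Qed.

Lemma weq_bsymp_augm : weq (dtens_ctens (bsymp R)).
Proof.
apply: weq_tens_left => n; have [G [hG _]] := Rfree.
have [s] := bsymp_twisted char0 (hG n); exact: weq_augm_twisted s.
Qed.

Lemma weq_bsym_HR : weq (ctrans_cmp (bsym_ab R) (dtens_ctens (bsym R))).
Proof. by apply: weq_comp weq_bsym_augm (weq_bsym_ab R). Qed.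

Lemma weq_bsymp_HR : weq (ctrans_cmp (bsymp_ab R) (dtens_ctens (bsymp R))).
Proof. by apply: weq_comp weq_bsymp_augm (weq_bsymp_ab R). Qed.
End WeakEquivalences.

(** * Shuffle products *)

Section Counting.

(** The first coordinate of the lattice path at vertex v, written as a sum so that it splits along
    single steps. *)
Definition cnt n (S : {set 'I_n}) (v : nat) : nat := \sum_(j < n) ((j \in S) && (j < v))%N.

Lemma cntE n (S : {set 'I_n}) v : #|[set j in S | (j < v)%N]| = cnt S v.
Proof.
by rewrite /cnt -sum1dep_card big_mkcond; apply: eq_bigr => j _; case: (_ && _).
Qed.

Lemma inversionsE n (S : {set 'I_n}) :
  inversions S = (\sum_(s < n) \sum_(t < n) [&& s \in S, t \notin S & (t < s)%N])%N.
Proof.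
rewrite /inversions -sum1dep_card pair_big big_mkcond /=.
by apply: eq_bigr => -[s t] _ /=; case: [&& _, _ & _].
Qed.

Lemma cnt_le n (S : {set 'I_n}) u v : (u <= v)%N -> (cnt S u <= cnt S v)%N.
Proof.
move=> uv; apply: leq_sum => j _; case: (j \in S) => //=.
by case: (ltnP j u) => // ju; rewrite (leq_trans ju uv).
Qed.

Lemma cnt_full n (S : {set 'I_n}) : cnt S n = #|S|.
Proof.
by rewrite -cntE; congr #|pred_of_set _|; apply/setP => j; rewrite inE ltn_ord andbT.
Qed.

Lemma cntS n (S : {set 'I_n}) (i : 'I_n) : cnt S i.+1 = (cnt S i + (i \in S))%N.
Proof.
rewrite /cnt (bigD1 i) //= [in RHS](bigD1 i) //= ltnn ltnSn andbF andbT add0n addnC.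
congr (_ + _)%N; apply: eq_bigr => j ji; congr ((_ && _) : nat).
by rewrite ltnS leq_eqVlt val_eqE (negPf ji).
Qed.

Fact tsteps_subproof n p (S : {set 'I_n}) (i : 'I_n.+1) : (minn (cnt S i) p < p.+1)%N.
Proof. by rewrite ltnS geq_minr. Qed.

Fact tsteps_homo n p (S : {set 'I_n}) :
  {homo (fun i => Ordinal (@tsteps_subproof n p S i)) : i i' / (i <= i')%N}.
Proof. by move=> i i' /= ii'; have := cnt_le S ii'; lia. Qed.

(* steps, truncated at p so as to be defined for all S. *)
Definition tsteps n p (S : {set 'I_n}) : dhom n p := dmk (@tsteps_homo n p S).

Lemma cnt_bound n (S : {set 'I_n}) (i : 'I_n.+1) : (cnt S i <= #|S|)%N.
Proof. by rewrite -cnt_full; apply: cnt_le; rewrite -ltnS. Qed.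

Lemma tstepsE n p (S : {set 'I_n}) (i : 'I_n.+1) : #|S| = p -> sval (tsteps p S) i = cnt S i :> nat.
Proof. by move=> Sp; have := cnt_bound S i; rewrite Sp /= => /minn_idPl. Qed.

Lemma stepsE n p (S : {set 'I_n}) (hS : #|S| = p) : steps hS = tsteps p S.
Proof.
apply: dhom_eq => i; apply: val_inj; rewrite -[RHS]/(nat_of_ord (sval (tsteps p S) i)).
by rewrite tstepsE //= cntE.
Qed.

Section Swap.
Context n (a b : 'I_n) (ab : b = a.+1 :> nat).
Local Notation t := (tperm a b).

Definition swap_set (S : {set 'I_n}) : {set 'I_n} := [set j | t j \in S].

Lemma swap_setK : involutive swap_set.
Proof. by move=> S; apply/setP => j; rewrite !inE tpermK. Qed.

Lemma swap_setC (S : {set 'I_n}) : ~: swap_set S = swap_set (~: S).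
Proof. by apply/setP => j; rewrite !inE. Qed.

(** Exchanging the consecutive steps a and b moves only the vertex between them, whose number is
    b. *)
Lemma cnt_swap (S : {set 'I_n}) v : v != b :> nat -> cnt (swap_set S) v = cnt S v.
Proof.
move=> vb; rewrite /cnt (reindex_inj (@perm_inj _ t)); apply: eq_bigr => j _.
rewrite inE tpermK; congr ((_ && _) : nat).
by case: tpermP => [->|->|//]; move: vb ab; lia.
Qed.

Lemma card_swap (S : {set 'I_n}) : #|swap_set S| = #|S|.
Proof. by rewrite -!cnt_full cnt_swap //; have := ltn_ord b; lia. Qed.

(** The transposition of neighbours preserves the order of every other pair, and turns the pair of a
    and b into an inversion. *)
Lemma inversions_swap (S : {set 'I_n}) : a \in S -> b \notin S -> inversions (swap_set S) = (inversions S).+1.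
Proof.
move=> aS bS; rewrite !inversionsE !pair_big /=.
have tinj : injective (fun y : 'I_n * 'I_n => (t y.1, t y.2)).
  by move=> [s u] [s' u'] /= [/perm_inj-> /perm_inj->].
rewrite (reindex_inj tinj) /=.
rewrite (bigD1 (a, b)) //= [in RHS](bigD1 (a, b)) //= !inE !tpermK tpermL tpermR aS bS /=.
have -> : (a < b)%N by lia.
have -> : (b < a)%N = false by lia.
rewrite add1n add0n; congr _.+1; apply: eq_bigr => -[s u] /= su; rewrite !inE !tpermK.
case: (boolP (s \in S)) => // sS; case: (boolP (u \in S)) => // uS /=; congr nat_of_bool.
have sb : s != b by apply: contraTneq sS => ->.
have ua : u != a by apply: contraNneq uS => ->.
move: su; rewrite xpair_eqE => su.
case: tpermP => [ub|ub|ub1 ub2]; case: tpermP => [sa|sb'|sa1 sa2];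
  move: su sb ua ab; rewrite ?ub ?sa ?sb' ?eqxx //=; rewrite -?val_eqE /=; lia.
Qed.
End Swap.

Section AddFirst.
Context n (S : {set 'I_n}).

Definition add_first : {set 'I_n.+1} := [set j | if unlift ord0 j is Some l then l \in S else true].
Definition skip_first : {set 'I_n.+1} := [set j | if unlift ord0 j is Some l then l \in S else false].

Lemma add_first0 : ord0 \in add_first. Proof. by rewrite inE unlift_none. Qed.
Lemma add_firstS j : (lift ord0 j \in add_first) = (j \in S). Proof. by rewrite inE liftK. Qed.
Lemma skip_first0 : (ord0 \in skip_first) = false. Proof. by rewrite inE unlift_none. Qed.
Lemma skip_firstS j : (lift ord0 j \in skip_first) = (j \in S). Proof. by rewrite inE liftK. Qed.

Lemma cnt_add v : cnt add_first v.+1 = (cnt S v).+1.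
Proof.
rewrite /cnt big_ord_recl add_first0 /= add1n; congr _.+1.
by apply: eq_bigr => j _; rewrite add_firstS.
Qed.

Lemma cnt_skip v : cnt skip_first v.+1 = cnt S v.
Proof.
rewrite /cnt big_ord_recl skip_first0 /= add0n.
by apply: eq_bigr => j _; rewrite skip_firstS.
Qed.

Lemma card_add : #|add_first| = #|S|.+1. Proof. by rewrite -!cnt_full cnt_add. Qed.
Lemma card_skip : #|skip_first| = #|S|. Proof. by rewrite -!cnt_full cnt_skip. Qed.

Lemma inversions_add : inversions add_first = inversions S.
Proof.
rewrite !inversionsE big_ord_recl big1 ?add0n => [|t _]; last by rewrite ltn0 !andbF.
apply: eq_bigr => s _; rewrite big_ord_recl add_first0 /= andbF add0n.
by apply: eq_bigr => u _; rewrite !add_firstS.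
Qed.

(** The new first step lies outside the set and precedes all its elements, so each of them gains one
    inversion. This is the source of the sign (-1)^p in [face0_shuffle_r]. *)
Lemma inversions_skip : inversions skip_first = (#|S| + inversions S)%N.
Proof.
rewrite !inversionsE big_ord_recl big1 ?add0n => [|t _]; last by rewrite skip_first0.
rewrite -sum1_card [X in (X + _)%N]big_mkcond -big_split; apply: eq_bigr => s _.
rewrite big_ord_recl skip_first0 skip_firstS /= andbT; congr (_ + _)%N.
by apply: eq_bigr => u _; rewrite !skip_firstS.
Qed.
End AddFirst.

Lemma add_firstC n (S : {set 'I_n}) : ~: add_first S = skip_first (~: S).
Proof.
by apply/setP => j; rewrite !inE; case: (unlift _ _) => [l|] //; rewrite inE.
Qed.
Lemma skip_firstC n (S : {set 'I_n}) : ~: skip_first S = add_first (~: S).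
Proof.
by apply/setP => j; rewrite !inE; case: (unlift _ _) => [l|] //; rewrite inE.
Qed.

Definition drop_first n (S : {set 'I_n.+1}) : {set 'I_n} := [set j | lift ord0 j \in S].

Lemma add_firstK n (S : {set 'I_n.+1}) : ord0 \in S -> add_first (drop_first S) = S.
Proof.
by move=> S0; apply/setP => j; case: (unliftP ord0 j) => [l ->|->];
  rewrite ?add_firstS ?add_first0 ?S0 // inE.
Qed.
Lemma skip_firstK n (S : {set 'I_n.+1}) : ord0 \notin S -> skip_first (drop_first S) = S.
Proof.
by move=> S0; apply/setP => j; case: (unliftP ord0 j) => [l ->|->];
  rewrite ?skip_firstS ?skip_first0 ?(negPf S0) // inE.
Qed.
Lemma drop_add n (S : {set 'I_n}) : drop_first (add_first S) = S.
Proof. by apply/setP => j; rewrite inE add_firstS. Qed.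
Lemma drop_skip n (S : {set 'I_n}) : drop_first (skip_first S) = S.
Proof. by apply/setP => j; rewrite inE skip_firstS. Qed.
End Counting.

Section Shuffle.
Context (k : fieldType).

Record simplicial_product (X : smod k) (mul : forall n : nat, X n -> X n -> X n) : Prop :=
  SimplicialProduct {
    sp_linl : forall n (y : X n), linear (mul n ^~ y);
    sp_linr : forall n (x : X n), linear (mul n x);
    sp_act : forall m n (f : dhom m n) x y,
      act X f (mul n x y) = mul m (act X f x) (act X f y) }.

Section Product.
Context (X : smod k) (mul : forall n : nat, X n -> X n -> X n).
Hypothesis mulP : simplicial_product mul.

Lemma sp_0l n (y : X n) : mul 0 y = 0.
Proof.
have := sp_linl mulP y (-1) 0 0; rewrite scaler0 addr0 scaleN1r addNr.
by [].
Qed.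

Lemma sp_0r n (x : X n) : mul x 0 = 0.
Proof.
have := sp_linr mulP x (-1) 0 0; rewrite scaler0 addr0 scaleN1r addNr.
by [].
Qed.

Definition shuffle_term n p q (x : X p) (y : X q) (S : {set 'I_n}) : X n :=
  (-1) ^+ inversions S *: mul (act X (tsteps p S) x) (act X (tsteps q (~: S)) y).

(** The degree n is a parameter of its own, which avoids casts between p.+1 + q, p + q.+1 and (p +
    q).+1. *)
Definition gshuffle n p q (x : X p) (y : X q) : X n :=
  \sum_(S : {set 'I_n} | #|S| == p) shuffle_term x y S.

Lemma shuffleE p q (x : X p) (y : X q) : shuffle mul x y = gshuffle (p + q) x y.
Proof.
rewrite /gshuffle (big_sub [pred S : {set 'I_(p + q)} | #|S| == p]) /shuffle.
apply: eq_bigr => S _; rewrite /shuffle_term.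
by rewrite stepsE stepsE.
Qed.

Lemma gshuffle_linl n p q c (x x' : X p) (y : X q) :
  gshuffle n (c *: x + x') y = c *: gshuffle n x y + gshuffle n x' y.
Proof.
rewrite /gshuffle scaler_sumr -big_split; apply: eq_bigr => S _.
rewrite /shuffle_term linearP (sp_linl mulP) scalerDr !scalerA.
by rewrite mulrC.
Qed.

Lemma gshuffle_linr n p q c (x : X p) (y y' : X q) :
  gshuffle n x (c *: y + y') = c *: gshuffle n x y + gshuffle n x y'.
Proof.
rewrite /gshuffle scaler_sumr -big_split; apply: eq_bigr => S _.
rewrite /shuffle_term linearP (sp_linr mulP) scalerDr !scalerA.
by rewrite mulrC.
Qed.

(** A map that misses the value j factors through [coface j]. *)
Lemma act_miss n p (f : dhom n p.+1) (j : 'I_p.+2) (x : X p.+1) :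
  (forall a, sval f a != j) -> face X j x = 0 -> act X f x = 0.
Proof.
move=> fj xj; have jp : (j.-1 < p.+1)%N by have := ltn_ord j; lia.
have -> : f = dcmp (coface j) (dcmp (codegen (Ordinal jp)) f).
  apply: dhom_eq => a; apply: val_inj; have := fj a; rewrite -val_eqE /= /bump /unbump /=.
  lia.
by rewrite act_cmp [act X (coface j) x]xj linear0.
Qed.

Lemma face_term n p q (x : X p) (y : X q) (S : {set 'I_n.+1}) (i : 'I_n.+2) :
  face X i (shuffle_term x y S) = (-1) ^+ inversions S *:
    mul (act X (dcmp (tsteps p S) (coface i)) x) (act X (dcmp (tsteps q (~: S)) (coface i)) y).
Proof. by rewrite linearZ /= [face X i _](sp_act mulP) -!act_cmp. Qed.

(* If the steps before and after the vertex i both lie in S (or i is an end of the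
   path), the path without i skips a value in the direction of S. *)
Lemma act_straight n p (x : X p) (S : {set 'I_n.+1}) (i : 'I_n.+2) : #|S| = p ->
  (forall j : 'I_n.+1, j = i.-1 :> nat -> (0 < i)%N -> j \in S) ->
  (forall j : 'I_n.+1, j = i :> nat -> j \in S) ->
  moore x -> (i == ord0 -> is_cycle x) ->
  act X (dcmp (tsteps p S) (coface i)) x = 0.
Proof.
move=> Sp Sl Sr hm hc.
have cl : (0 < i)%N -> cnt S i = (cnt S i.-1).+1.
  move=> i0; have ip : (i.-1 < n.+1)%N by have := ltn_ord i; lia.
  have := cntS S (Ordinal ip); rewrite Sl //= addn1 prednK //.
have cr : (i < n.+1)%N -> cnt S i.+1 = (cnt S i).+1.
  by move=> ip; have := cntS S (Ordinal ip); rewrite Sr //= addn1.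
have p0 : (0 < p)%N.
  rewrite -Sp; have := cnt_bound S ord_max; have := cnt_le S (leqnn n.+1).
  have := ltn_ord i; case: (ltnP i n.+1) => ii _ _.
    by have := cr ii; have := @cnt_le _ S i.+1 n.+1 ii; rewrite cnt_full; lia.
  have i0 : (0 < i)%N by lia.
  by have := cl i0; have := @cnt_le _ S i n.+1; rewrite cnt_full; have := ltn_ord i; lia.
case: p p0 x Sp hm hc => // p _ x Sp hm hc.
have jp : (cnt S i < p.+2)%N by have := cnt_bound S i; rewrite Sp.
apply: (@act_miss _ _ _ (Ordinal jp)) => [a|].
  rewrite -val_eqE -[val (sval _ _)]/(nat_of_ord (sval (tsteps p.+1 S) (lift i a))) tstepsE //=.
  rewrite /bump; case: (leqP i a) => ia; rewrite ?add1n ?add0n.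
    have ii : (i < n.+1)%N by have := ltn_ord a; lia.
    have ia' : (i.+1 <= a.+1)%N by [].
    by have := cr ii; have := cnt_le S ia'; lia.
  have i0 : (0 < i)%N by lia.
  have ia' : (a <= i.-1)%N by lia.
  by have := cl i0; have := cnt_le S ia'; lia.
have [i0|i0] := eqVneq i ord0; first by apply: (hc _); rewrite i0.
apply: hm; rewrite -val_eqE /=; have : (0 < i)%N by rewrite lt0n.
by move/cl; lia.
Qed.

(** The face d_i forgets the vertex between the two exchanged steps, so both paths have the same
    face, with opposite signs. *)
Lemma shuffle_term_swap n p q (x : X p) (y : X q) (S : {set 'I_n.+1}) (i : 'I_n.+2)
    (a b : 'I_n.+1) : #|S| = p -> #|~: S| = q -> a \in S -> b \notin S ->
  i = b :> nat -> b = a.+1 :> nat ->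
  face X i (shuffle_term x y (swap_set a b S)) = - face X i (shuffle_term x y S).
Proof.
move=> Sp Sq aS bS ib ab; rewrite !face_term inversions_swap // exprS mulN1r scaleNr.
have tE r (T : {set 'I_n.+1}) : #|T| = r ->
    dcmp (tsteps r (swap_set a b T)) (coface i) = dcmp (tsteps r T) (coface i).
  move=> Tr; apply: dhom_eq => v; apply: val_inj.
  rewrite -[LHS]/(nat_of_ord (sval (tsteps r (swap_set a b T)) (lift i v))).
  rewrite -[RHS]/(nat_of_ord (sval (tsteps r T) (lift i v))).
  rewrite !tstepsE ?card_swap // cnt_swap //.
  by rewrite /= /bump -ib; lia.
by rewrite swap_setC !tE.
Qed.

Lemma card_setC n p q (S : {set 'I_n}) : (p + q = n)%N -> #|S| = p -> #|~: S| = q.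
Proof. by move=> pq Sp; have := cardsC S; rewrite card_ord Sp; lia. Qed.

(** A path either ends or goes straight at vertex i, and then its term vanishes by [act_straight],
    or it turns there, and then its term cancels against that of the path with the two adjacent
    steps exchanged. *)
Lemma face_shuffle n p q (x : X p) (y : X q) (i : 'I_n.+2) : (p + q = n.+1)%N ->
  moore x -> moore y -> (i == ord0 -> is_cycle x /\ is_cycle y) ->
  face X i (gshuffle n.+1 x y) = 0.
Proof.
move=> pq hx hy hc; rewrite /gshuffle linear_sum /=.
have straightS (S : {set 'I_n.+1}) : #|S| = p ->
    (forall j : 'I_n.+1, j = i.-1 :> nat -> (0 < i)%N -> j \in S) ->
    (forall j : 'I_n.+1, j = i :> nat -> j \in S) -> face X i (shuffle_term x y S) = 0.
  move=> Sp Sl Sr; rewrite face_term (act_straight Sp Sl Sr) ?sp_0l ?scaler0 //.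
  by case/hc.
have straightC (S : {set 'I_n.+1}) : #|S| = p ->
    (forall j : 'I_n.+1, j = i.-1 :> nat -> (0 < i)%N -> j \notin S) ->
    (forall j : 'I_n.+1, j = i :> nat -> j \notin S) -> face X i (shuffle_term x y S) = 0.
  move=> Sp Sl Sr; rewrite face_term (@act_straight _ q y) ?sp_0r ?scaler0 //.
  - exact: card_setC Sp.
  - by move=> j ji i0; rewrite inE Sl.
  - by move=> j ji; rewrite inE Sr.
  - by case/hc.
have [i0|i0] := posnP i.
  apply: big1 => S /eqP Sp; have [S0|S0] := boolP (ord0 \in S).
    apply: straightS => // [j _|j ji]; first by rewrite i0.
    by have -> : j = ord0 by apply: val_inj; rewrite /= ji i0.
  apply: straightC => // [j _|j ji]; first by rewrite i0.
  by have -> : j = ord0 by apply: val_inj; rewrite /= ji i0.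
have ap : (i.-1 < n.+1)%N by have := ltn_ord i; lia.
pose a := Ordinal ap.
have aE (j : 'I_n.+1) : j = i.-1 :> nat -> j = a by move=> ji; apply: val_inj.
have [bp|ni] := ltnP i n.+1; last first.
  have nj (j : 'I_n.+1) : j = i :> nat -> false by move=> ji; have := ltn_ord j; lia.
  apply: big1 => S /eqP Sp; have [aS|aS] := boolP (a \in S).
    by apply: straightS => // [j /aE -> //|j /nj].
  by apply: straightC => // [j /aE -> //|j /nj].
pose b := Ordinal bp.
have bE (j : 'I_n.+1) : j = i :> nat -> j = b by move=> ji; apply: val_inj.
have ab : b = a.+1 :> nat by rewrite /= prednK.
(* The straight paths are split off first; among those that turn, the exchange matches the ones with
   a in S with the others. *)
rewrite (bigID (fun S : {set 'I_n.+1} => (a \in S) == (b \in S))) /= big1 ?add0r; last first.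
  move=> S /andP[/eqP Sp /eqP e]; have [aS|aS] := boolP (a \in S).
    by apply: straightS => // [j /aE -> //|j /bE ->]; rewrite -e.
  by apply: straightC => // [j /aE -> //|j /bE ->]; rewrite -e.
rewrite (bigID (fun S : {set 'I_n.+1} => a \in S)) /=; apply/eqP; rewrite addrC addr_eq0; apply/eqP.
rewrite -sumrN (reindex_inj (can_inj (@swap_setK _ a b))) /=.
apply: eq_big => [S|S].
  rewrite card_swap // !inE tpermL tpermR.
  by case: (a \in S); case: (b \in S); rewrite ?andbF ?andbT.
rewrite card_swap // !inE tpermL tpermR => /andP[/andP[/eqP Sp ne] bS].
have aS : a \in S by move: ne bS; case: (a \in S); case: (b \in S).
by rewrite (shuffle_term_swap _ _ _ _ aS bS) //; apply: card_setC Sp.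
Qed.

(** A path that starts in the direction of y contributes a multiple of d_0 y and vanishes; the
    others are the shorter paths with a step prepended. With [face0_shuffle_r] this is the Leibniz
    rule when one factor is a cycle. *)
Lemma face0_shuffle_l n p q (x : X p.+1) (y : X q) : (p + q = n)%N ->
  is_cycle y -> face X ord0 (gshuffle n.+1 x y) = gshuffle n (face X ord0 x) y.
Proof.
move=> pq hy; rewrite /gshuffle linear_sum /=.
rewrite (bigID (fun S : {set 'I_n.+1} => ord0 \in S)) /= [X in _ + X]big1 ?addr0; last first.
  move=> S /andP[/eqP Sp S0]; rewrite face_term (@act_straight _ q y) ?sp_0r ?scaler0 //.
  - by apply: card_setC Sp; lia.
  - by move=> j j0; rewrite inE; have -> : j = ord0 by apply: val_inj.
  - exact: cycle_moore.
rewrite (reindex_onto (@add_first n) (@drop_first n)) /=; last first.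
  by move=> S /andP[_ S0]; apply: add_firstK.
apply: eq_big => [S|S /andP[/andP[Sp _] _]].
  by rewrite card_add eqSS add_first0 drop_add eqxx !andbT.
have {}Sp : #|S| = p by apply/eqP; rewrite -eqSS -card_add.
rewrite face_term inversions_add add_firstC; congr (_ *: mul _ _).
  rewrite -[face X ord0 x]/(act X (coface ord0) x) -act_cmp; congr (act X _ x).
  apply: dhom_eq => v; apply: val_inj.
  rewrite -[LHS]/(nat_of_ord (sval (tsteps p.+1 (add_first S)) (lift ord0 v))).
  rewrite tstepsE ?card_add ?Sp // lift0 cnt_add.
  rewrite -[RHS]/(nat_of_ord (lift ord0 (sval (tsteps p S) v))) lift0.
  by rewrite tstepsE.
congr (act X _ y); have Sq := card_setC pq Sp.
apply: dhom_eq => v; apply: val_inj.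
rewrite -[LHS]/(nat_of_ord (sval (tsteps q (skip_first (~: S))) (lift ord0 v))).
rewrite -[RHS]/(nat_of_ord (sval (tsteps q (~: S)) v)).
by rewrite !tstepsE ?card_skip // lift0 cnt_skip.
Qed.

Lemma face0_shuffle_r n p q (x : X p) (y : X q.+1) : (p + q = n)%N ->
  is_cycle x -> face X ord0 (gshuffle n.+1 x y) = (-1) ^+ p *: gshuffle n x (face X ord0 y).
Proof.
move=> pq hx; rewrite /gshuffle linear_sum /= scaler_sumr.
rewrite (bigID (fun S : {set 'I_n.+1} => ord0 \in S)) /= big1 ?add0r; last first.
  move=> S /andP[/eqP Sp S0]; rewrite face_term (@act_straight _ p x) ?sp_0l ?scaler0 //.
  - by move=> j j0; have -> : j = ord0 by apply: val_inj.
  - exact: cycle_moore.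
rewrite (reindex_onto (@skip_first n) (@drop_first n)) /=; last first.
  by move=> S /andP[_ S0]; apply: skip_firstK.
apply: eq_big => [S|S /andP[/andP[Sp _] _]].
  by rewrite card_skip skip_first0 drop_skip eqxx !andbT.
have {}Sp : #|S| = p by apply/eqP; rewrite -card_skip.
rewrite face_term inversions_skip skip_firstC Sp exprD -scalerA; congr (_ *: (_ *: mul _ _)).
  congr (act X _ x); apply: dhom_eq => v; apply: val_inj.
  rewrite -[LHS]/(nat_of_ord (sval (tsteps p (skip_first S)) (lift ord0 v))).
  rewrite -[RHS]/(nat_of_ord (sval (tsteps p S) v)).
  by rewrite !tstepsE ?card_skip // lift0 cnt_skip.
have Sq := card_setC pq Sp.
rewrite -[face X ord0 y]/(act X (coface ord0) y) -act_cmp; congr (act X _ y).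
apply: dhom_eq => v; apply: val_inj.
rewrite -[LHS]/(nat_of_ord (sval (tsteps q.+1 (add_first (~: S))) (lift ord0 v))).
rewrite tstepsE ?card_add ?Sq // lift0 cnt_add.
rewrite -[RHS]/(nat_of_ord (lift ord0 (sval (tsteps q (~: S)) v))) lift0.
by rewrite tstepsE.
Qed.

Lemma shuffle_cycle p q (x : X p) (y : X q) :
  is_cycle x -> is_cycle y -> is_cycle (gshuffle (p + q) x y).
Proof.
move=> hx hy; suff H n : (p + q = n)%N -> is_cycle (gshuffle n x y) by apply: H.
case: n => // n pq i; by apply: face_shuffle => //; apply: cycle_moore.
Qed.

Lemma shuffle_boundary_l p q (x : X p) (y : X q) :
  boundary x -> is_cycle y -> boundary (gshuffle (p + q) x y).
Proof.
move=> [u hu <-] hy; exists (gshuffle (p + q).+1 u y); last exact: face0_shuffle_l.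
move=> i i0; apply: face_shuffle => //; first exact: cycle_moore.
by move=> e; rewrite e in i0.
Qed.

Lemma shuffle_boundary_r p q (x : X p) (y : X q) :
  is_cycle x -> boundary y -> boundary (gshuffle (p + q) x y).
Proof.
move=> hx [u hu <-]; exists ((-1) ^+ p *: gshuffle (p + q).+1 x u).
  move=> i i0; rewrite linearZ /= face_shuffle ?scaler0 ?addnS //; first exact: cycle_moore.
  by move=> e; rewrite e in i0.
by rewrite linearZ /= face0_shuffle_r // scalerA -expr2 sqrr_sign scale1r.
Qed.

Lemma pi_mul_class p q (x : X p) (y : X q) : is_cycle x -> is_cycle y ->
  pi_mul mul (pclass x) (pclass y) = pclass (shuffle mul x y).
Proof.
move=> hx hy; rewrite /pi_mul; set x' := prepr _; set y' := prepr _.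
have hx' : is_cycle x' by exact: prepr_cycle.
have hy' : is_cycle y' by exact: prepr_cycle.
have bx : boundary (x' - x) by apply/pclass_eq => //; rewrite preprK.
have bY : boundary (y' - y) by apply/pclass_eq => //; rewrite preprK.
rewrite !shuffleE; apply/pclass_eq; do ?exact: shuffle_cycle.
have -> : gshuffle (p + q) x' y' - gshuffle (p + q) x y =
    gshuffle (p + q) (x' - x) y' + gshuffle (p + q) x (y' - y).
  have e1 : gshuffle (p + q) (x' - x) y' = gshuffle (p + q) x' y' - gshuffle (p + q) x y'.
    by rewrite [x' - x]addrC -scaleN1r gshuffle_linl scaleN1r [LHS]addrC.
  have e2 : gshuffle (p + q) x (y' - y) = gshuffle (p + q) x y' - gshuffle (p + q) x y.
    by rewrite [y' - y]addrC -scaleN1r gshuffle_linr scaleN1r [LHS]addrC.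
  by rewrite e1 e2 addrA subrK.
by apply: boundaryD; [apply: shuffle_boundary_l|apply: shuffle_boundary_r].
Qed.
End Product.

Lemma pi_map_mul (X Y : smod k) (mulX : forall n : nat, X n -> X n -> X n)
    (mulY : forall n : nat, Y n -> Y n -> Y n) (f : ctrans X Y) :
  simplicial_product mulX -> simplicial_product mulY ->
  (forall n (x y : X n), f n (mulX n x y) = mulY n (f n x) (f n y)) ->
  forall p q (u : piS X p) (v : piS X q),
    pi_map f (pi_mul mulX u v) = pi_mul mulY (pi_map f u) (pi_map f v).
Proof.
move=> hX hY fM p q u v; rewrite -[u]preprK -[v]preprK.
set x := prepr u; set y := prepr v.
have hx : is_cycle x by exact: prepr_cycle.
have hy : is_cycle y by exact: prepr_cycle.
rewrite (pi_mul_class hX hx hy) !pi_map_class //; last first.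
  by rewrite shuffleE; apply: shuffle_cycle.
rewrite (pi_mul_class hY) //; do ?exact: cycle_map.
congr pclass; rewrite !shuffleE /gshuffle linear_sum; apply: eq_bigr => S _.
by rewrite /shuffle_term linearZ /= fM !act_nat.
Qed.
End Shuffle.

(** * The algebra structure *)

Section ChainProduct.
Context (k : fieldType).

Definition CAelt (A : salg k) (d : opcat Delta) (x : nat) (s : @usimp DeltaSp x d)
    (a : 'I_x -> A d) : CA A d :=
  @ten k DeltaSp (opcat Delta) (nerve k DeltaSp) (bsymp A) d x (fgen k s) (tensor a).

Lemma CA_ind (A : salg k) (d : opcat Delta) (P : CA A d -> Prop) :
  P 0 -> (forall c u v, P u -> P v -> P (c *: u + v)) ->
  (forall x s a, P (@CAelt A d x s a)) -> forall w, P w.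
Proof.
move=> P0 Plin Pelt; apply: ten_ind => // x u v.
elim/free_ind: u => [|c u u' Hu Hu'|s]; first by rewrite ten0l.
  by rewrite tenDl tenZl; apply: Plin.
rewrite -[v]qreprK; elim/free_ind: (qrepr v) => [|c y z Hy Hz|a]; first by rewrite linear0 ten0r.
  by rewrite linearP tenDr tenZr; apply: Plin.
exact: Pelt.
Qed.

Lemma CA_mulE (A : salg k) (d : opcat Delta) x y (s : @usimp DeltaSp x d) (t : @usimp DeltaSp y d)
    (a : 'I_x -> A d) (b : 'I_y -> A d) :
  CA_mul (CAelt s a) (CAelt t b) = CAelt (usum s t) (cat_fun a b).
Proof.
apply: etrans (plift2_gen _ _ _ _) _.
rewrite /CA_gen /= ncat_gen tcat_tensor.
by [].
Qed.

Lemma CA_mul_linl (A : salg k) (d : opcat Delta) (v : CA A d) : linear (@CA_mul k A d ^~ v).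
Proof. exact: plift2_linl. Qed.
Lemma CA_mul_linr (A : salg k) (d : opcat Delta) (u : CA A d) : linear (@CA_mul k A d u).
Proof. exact: plift2_linr. Qed.

Lemma CA_mul_ext (A : salg k) (d : opcat Delta) (W : lmodType k) (f : {linear CA A d -> W})
    (m : W -> W -> W) : (forall v, linear (m^~ v)) -> (forall u, linear (m u)) ->
  (forall x y s t a b, f (CA_mul (@CAelt A d x s a) (@CAelt A d y t b)) =
     m (f (CAelt s a)) (f (CAelt t b))) ->
  forall u v, f (CA_mul u v) = m (f u) (f v).
Proof.
move=> ml mr fm u v.
have m0l w : m 0 w = 0.
  by have := ml w (-1) 0 0; rewrite scaler0 addr0 scaleN1r addNr.
have m0r w : m w 0 = 0.
  by have := mr w (-1) 0 0; rewrite scaler0 addr0 scaleN1r addNr.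
have M0l (w : CA A d) : CA_mul 0 w = 0.
  by have := CA_mul_linl w (-1) 0 0; rewrite scaler0 addr0 scaleN1r addNr.
have M0r (w : CA A d) : CA_mul w 0 = 0.
  by have := CA_mul_linr w (-1) 0 0; rewrite scaler0 addr0 scaleN1r addNr.
have f0 : f 0 = 0 by exact: linear0.
have fl c x y : f (c *: x + y) = c *: f x + f y by exact: linearP.
elim/CA_ind: u => [|c u u' Hu Hu'|x s a]; first by rewrite M0l f0 m0l.
  apply: etrans (congr1 f (CA_mul_linl v c u u')) _; apply: etrans (fl _ _ _) _.
  apply: etrans (congr2 (fun a b => c *: a + b) Hu Hu') _; apply: esym.
  exact: etrans (congr1 (m^~ (f v)) (fl c u u')) (ml (f v) c (f u) (f u')).
elim/CA_ind: v => [|c v v' Hv Hv'|y t b]; first by rewrite M0r f0 m0r.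
  apply: etrans (congr1 f (CA_mul_linr _ c v v')) _; apply: etrans (fl _ _ _) _.
  apply: etrans (congr2 (fun a b => c *: a + b) Hv Hv') _; apply: esym.
  exact: etrans (congr1 (m _) (fl c v v')) (mr _ c (f v) (f v')).
exact: fm.
Qed.

Lemma act_CAelt (A : salg k) (m n : nat) (g : dhom m n) x (s : @usimp DeltaSp x n)
    (a : 'I_x -> A n) :
  act (CA A) g (CAelt s a) =
    CAelt (usimp_act (@idm DeltaSp x) g s) (fun i => amap A (g : @hom (opcat Delta) n m) (a i)).
Proof.
rewrite [LHS]act_ten; congr (@ten _ _ _ _ _ _ _ _ _).
  exact: (@nerve_mapE k DeltaSp (x, n) (x, m) (idm x, g)).
exact: act_tpows.
Qed.

Lemma CA_product (A : salg k) : simplicial_product (@CA_mul k A).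
Proof.
split=> [n y|n x|m n f x y]; [exact: CA_mul_linl|exact: CA_mul_linr|].
apply: (@CA_mul_ext A n (CA A m) (act (CA A) f) (@CA_mul k A m)) => [v|u|{}x {}y s t a b].
- exact: CA_mul_linl.
- exact: CA_mul_linr.
rewrite CA_mulE !act_CAelt CA_mulE.
have -> : usimp_act (@idm DeltaSp (x + y)%N) f (usum s t) =
    usum (usimp_act (@idm DeltaSp x) f s) (usimp_act (@idm DeltaSp y) f t).
  apply: (@usimp_eq DeltaSp (x + y)%N m
    (@usimp_act DeltaSp (x + y)%N (x + y)%N n m (@idm DeltaSp (x + y)%N) f (usum s t))
    (usum (usimp_act (@idm DeltaSp x) f s) (usimp_act (@idm DeltaSp y) f t)) erefl) => [i|//].
  by rewrite /= !scmpm1.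
congr CAelt; apply: funext => i; rewrite /cat_fun; by case: (fintype.split i).
Qed.

Lemma ab_product (A : salg k) :
  @simplicial_product k (calg_mod (abC A)) (fun n (x y : abC A n) => x * y).
Proof.
split=> [n y c x x'|n x c y y'|m n f x y].
- by rewrite mulrDl alg_scaleAl.
- by rewrite mulrDr alg_scaleAr.
exact: (@ahomM k _ _ (amap (abC A) (f : @hom (opcat Delta) n m))).
Qed.

Lemma CA_oneE (A : salg k) (d : opcat Delta) :
  CA_one A d = CAelt (@usimp_const DeltaSp 0%N d) (fun=> 1 : A d).
Proof. by []. Qed.

Definition CA_map (A B : salg k) (f : atrans A B) : ctrans (CA A) (CA B) :=
  dtens_trans (bsymp_trans f).

Lemma CA_mapE (A B : salg k) (f : atrans A B) d x s a :
  CA_map f d (@CAelt A d x s a) = CAelt s (fun i => f d (a i)).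
Proof.
rewrite [LHS]tens_trans_ten; congr (@ten _ _ _ _ _ _ _ _ _).
exact: plift_gen.
Qed.

Lemma CA_mapM (A B : salg k) (f : atrans A B) (d : opcat Delta) (u v : CA A d) :
  CA_map f d (CA_mul u v) = CA_mul (CA_map f d u) (CA_map f d v).
Proof.
apply: (@CA_mul_ext A d (CA B d) (CA_map f d) (@CA_mul k B d)) => [w|w|x y s t a b].
- exact: CA_mul_linl.
- exact: CA_mul_linr.
rewrite CA_mulE !CA_mapE CA_mulE; congr CAelt; apply: funext => i.
by rewrite /cat_fun; case: (fintype.split i).
Qed.

Lemma CA_map1 (A B : salg k) (f : atrans A B) (d : opcat Delta) :
  CA_map f d (CA_one A d) = CA_one B d.
Proof.
rewrite CA_oneE; apply: etrans (CA_mapE _ _ _) _; rewrite CA_oneE; congr CAelt.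
by apply: funext => -[].
Qed.

Definition CA_ab (A : salg k) : ctrans (CA A) (calg_mod (abC A)) :=
  ctrans_cmp (bsymp_ab A) (dtens_ctens (bsymp A)).

Lemma CA_abE (A : salg k) d x s a : CA_ab A d (@CAelt A d x s a) = ab_pi (\prod_i a i).
Proof.
rewrite -[LHS]/(bsymp_ab_fun (tens_trans (augm k DeltaSp) (ctrans_id (bsymp A)) d (CAelt s a))).
rewrite /CAelt tens_trans_ten bsymp_ab_funE.
have -> : augm k DeltaSp (x : DeltaSp, d) (fgen k s) = 1 by exact: flift_gen.
by rewrite scale1r; apply: mult_ab_tensor.
Qed.

Lemma CA_abM (A : salg k) (d : opcat Delta) (u v : CA A d) :
  CA_ab A d (CA_mul u v) = (CA_ab A d u : abC A d) * CA_ab A d v.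
Proof.
apply: (@CA_mul_ext A d (calg_mod (abC A) d) (CA_ab A d)
  (fun x y : abC A d => x * y)) => [w|w|x y s t a b].
- exact: (@sp_linl _ _ _ (ab_product A) d w).
- exact: (@sp_linr _ _ _ (ab_product A) d w).
rewrite CA_mulE !CA_abE -ab_piM big_split_ord; congr (ab_pi (_ * _)); apply: eq_bigr => i _.
  exact: cat_funl.
exact: cat_funr.
Qed.

Lemma CA_ab1 (A : salg k) (d : opcat Delta) : CA_ab A d (CA_one A d) = (1 : abC A d).
Proof. by rewrite CA_oneE CA_abE big_ord0. Qed.

Definition CA_cmpr (A : salg k) : ctrans (dtens (bsym A)) (CA A) :=
  @cmpr k DeltaSp nat S (bsymp A).

Lemma bsym_ext (A : salg k) (d : opcat Delta) (W : lmodType k)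
    (f g : {linear dtens (bsym A) d -> W}) :
  (forall (x : DeltaS) (s : @usimp DeltaS x d) (v : bsym A (x, d)),
    f (@ten k DeltaS (opcat Delta) (nerve k DeltaS) (bsym A) d x (fgen k s) v) =
    g (@ten k DeltaS (opcat Delta) (nerve k DeltaS) (bsym A) d x (fgen k s) v)) -> f =1 g.
Proof.
move=> fg; apply: ten_ext => x u v.
elim/free_ind: u => [|c u u' Hu Hu'|s]; first by rewrite ten0l !linear0.
  by rewrite tenDl tenZl !linearP /= Hu Hu'.
exact: fg.
Qed.

Lemma CA_cmprE (A : salg k) (d : opcat Delta) (x : DeltaS) (s : @usimp DeltaS x d)
    (v : bsym A (x, d)) :
  CA_cmpr A d (@ten k DeltaS (opcat Delta) (nerve k DeltaS) (bsym A) d x (fgen k s) v) =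
  @ten k DeltaSp (opcat Delta) (nerve k DeltaSp) (bsymp A) d x.+1
    (fgen k (@usimp_incl DeltaSp nat S x d s)) v.
Proof.
apply: etrans (plift_gen _ _) _; rewrite /ten_lift /cmpr_gen /=.
congr (@ten _ _ _ _ _ _ _ _ _); exact: flift_gen.
Qed.

Lemma CA_cmpr_nat (A B : salg k) (f : atrans A B) n w :
  CA_cmpr B n (dtens_trans (bsym_trans f) n w) = CA_map f n (CA_cmpr A n w).
Proof.
apply: (bsym_ext (f := CA_cmpr B n \o dtens_trans (bsym_trans f) n)
  (g := CA_map f n \o CA_cmpr A n)) => x s v.
rewrite -[LHS]/(CA_cmpr B n (dtens_trans (bsym_trans f) n _)).
rewrite -[RHS]/(CA_map f n (CA_cmpr A n _)) CA_cmprE.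
rewrite [X in CA_cmpr B n X]tens_trans_ten CA_cmprE.
by apply/esym; apply: tens_trans_ten.
Qed.

(** This triangle over B_ab shows by two out of three that [CA_cmpr] is a weak equivalence when B is
    free in each degree. *)
Lemma CA_ab_cmpr (A : salg k) n w :
  CA_ab A n (CA_cmpr A n w) = ctrans_cmp (bsym_ab A) (dtens_ctens (bsym A)) n w.
Proof.
apply: (bsym_ext (f := CA_ab A n \o CA_cmpr A n)
  (g := ctrans_cmp (bsym_ab A) (dtens_ctens (bsym A)) n)) => x s v.
rewrite -[LHS]/(CA_ab A n (CA_cmpr A n _)) CA_cmprE.
rewrite -[LHS]/(bsymp_ab_fun (tens_trans (augm k DeltaSp) (ctrans_id (bsymp A)) n _)).
rewrite -[RHS]/(bsym_ab A n (tens_trans (augm k DeltaS) (ctrans_id (bsym A)) n _)).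
rewrite !tens_trans_ten bsymp_ab_funE bsym_ab_funE.
have -> : augm k DeltaSp (x.+1 : DeltaSp, n) (fgen k (@usimp_incl DeltaSp nat S x n s)) = 1.
  exact: flift_gen.
by have -> : augm k DeltaS (x, n) (fgen k s) = 1 by exact: flift_gen.
Qed.
End ChainProduct.

Theorem theorem3p1 (k : fieldType) (char0 : [pchar k]%R =i pred0)
    (A : salg k) (R : resolution A) :
  galg_iso (G := HS A) (H := HR R) (SR R).
Proof.
pose B := res_alg R; pose f : atrans B A := res_map R.
have fw := res_weq R; have Bfree := res_free R.
pose psi := ctrans_cmp (bsym_ab B) (dtens_ctens (bsym B)).
have psiw : weq psi := weq_bsym_HR char0 Bfree.
have phiw : weq (CA_ab B) := weq_bsymp_HR char0 Bfree.
have hsw : weq (dtens_trans (bsym_trans f)) := weq_dtens_bsym fw.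
have caw : weq (CA_map f) := weq_dtens_bsymp fw.
have cBw : weq (CA_cmpr B) := weq_right (@CA_ab_cmpr k B) phiw psiw.
(* The comparison for A follows from that for the resolution, through the naturality square of
   [CA_cmpr_nat]. *)
have cAw : weq (CA_cmpr A).
  apply: (weq_left (h := ctrans_cmp (CA_map f) (CA_cmpr B)) _ hsw) => [n w|].
    exact: CA_cmpr_nat.
  exact: (weq_comp _ cBw caw).
have cAE n (u : HS A n) : HS_CA u = pi_map (CA_cmpr A) u by [].
have cmE n (r : HS B n) : pi_map (CA_cmpr A) (HS_map f r) = pi_map (CA_map f) (pi_map (CA_cmpr B) r).
  rewrite /HS_map -!pi_map_cmp; apply: eq_pi_map => w; exact: CA_cmpr_nat.
have psiE n (r : HS B n) : pi_map psi r = pi_map (CA_ab B) (pi_map (CA_cmpr B) r).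
  by rewrite -pi_map_cmp; apply: eq_pi_map => w; rewrite -[LHS]CA_ab_cmpr.
(* As [HS_map f] is injective, r is the only preimage that [xget] can pick. *)
have SRE n (r : HS B n) : SR R (HS_map f r) = pi_map psi r.
  rewrite /SR; congr (pi_map psi _); apply: (bij_inj (hsw n)).
  by apply: (@xgetPex _ 0 (fun s : HS B n => HS_map f s = HS_map f r)); exists r.
have hsS n (u : HS A n) : exists r : HS B n, u = HS_map f r.
  by have [g _ gK] := hsw n; exists (g u); rewrite -[LHS]gK.
have cAS n (v : pi_CA A n) : exists u : HS A n, HS_CA u = v.
  by have [g _ gK] := cAw n; exists (g v); rewrite -[RHS]gK.
split.
- move=> n c u v; have [r ->] := hsS n u; have [s ->] := hsS n v.
  have -> : c *: HS_map f r + HS_map f s = HS_map f (c *: r + s).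
    by rewrite /HS_map linearP.
  by rewrite !SRE linearP.
- move=> n; have [g gK Kg] := hsw n.
  apply: (@eq_bij _ _ (pi_map psi (n := n) \o g)).
    by apply: bij_comp; [exact: psiw|exists (HS_map f (n := n))].
  by move=> u; apply: etrans (esym (SRE n (g u))) _; congr (SR R _); apply: Kg.
- move=> p q u v; have [r ->] := hsS p u; have [s ->] := hsS q v.
  set w := gmul (HS A) _ _.
  (* [HS_CA] is onto, so [xget] returns a true preimage and never its default 0. *)
  have : HS_CA w = gmul (pi_CA A) (HS_CA (HS_map f r)) (HS_CA (HS_map f s)).
    exact: (@xgetPex _ 0 (fun w : HS_mod A (p + q) => HS_CA w = _) (cAS _ _)).
  have [t ->] := hsS _ w; rewrite !SRE !cAE !cmE.
  rewrite -[gmul (pi_CA A) _ _]/(pi_mul (@CA_mul k A) _ _).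
  (* Both sides are now images under [CA_map f], and injectivity moves the identity from CA of A to
     CA of the resolution, where [CA_ab] is multiplicative. *)
  rewrite -(pi_map_mul (CA_product B) (CA_product A) (fun n => @CA_mapM k B A f n)).
  move/(bij_inj (caw (p + q)%N)) => e.
  rewrite !psiE e.
  exact: (pi_map_mul (CA_product B) (ab_product B) (fun n => @CA_abM k B n)).
- set w := gone (HS A).
  have : HS_CA w = gone (pi_CA A).
    exact: (@xgetPex _ 0 (fun w : HS_mod A 0 => HS_CA w = _) (cAS _ _)).
  have [t ->] := hsS _ w; rewrite SRE cAE cmE psiE.
  have -> : gone (pi_CA A) = pi_map (CA_map f) (pclass (CA_one B 0%N)).
    by rewrite pi_map_class // CA_map1.
  move/(bij_inj (caw 0%N)) => ->.
  by rewrite pi_map_class // CA_ab1.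
Qed.
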